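(* Let $n\ge 1$ be an integer, $H\in(n-1,n)$, $T>0$, and let $B_H^{(n)}=(B_H^{(n)}(t),t\in[0,T])$ be the $n$th order fractional Brownian motion, $B_H^{(n)}(t)=\int_0^t k_H^{(n)}(t,u)\,\mathrm{d}W(u)$, with $W$ the associated standard Brownian motion. Define an operator $k_H^{(n)*}:\mathcal{H}_H^{(n)}\to L^2([0,T])$ by linearly extending (and closing) $$k_H^{(n)*}\mathbf{1}_t=k_H^{(n)}(t,\cdot),\qquad t\in[0,T].$$ Then $k_H^{(n)*}$ provides an isometry between $\mathcal{H}_H^{(n)}$ and $L^2([0,T])$, i.e. $\langle k_H^{(n)*}f,k_H^{(n)*}g\rangle_{L^2([0,T])}=\langle f,g\rangle_{\mathcal{H}_H^{(n)}}$ for all $f,g\in\mathcal{H}_H^{(n)}$. Moreover, for any $f\in\mathcal{H}_H^{(n)}$, $$\int_0^T f(u)\,\mathrm{d}B_H^{(n)}(u)=\int_0^T\left(k_H^{(n)*}f\right)(u)\,\mathrm{d}W(u).$$ Furthermore, if $n\ge 2$, then $L^2([0,T])\subset\mathcal{H}_H^{(n)}$, and for any $f\in L^2([0,T])$, $$\left(k_H^{(n)*}f\right)(u)=\int_0^T f(t)\,k_{H-1}^{(n-1)}(t,u)\,\mathrm{d}t .$$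
   Context: **Kernels.** For $h\in(0,1)$ and $0<s<t$, $$k_h(t,s)=d_h\left[\left(\tfrac{t}{s}\right)^{h-\frac12}(t-s)^{h-\frac12}-\left(h-\tfrac12\right)s^{\frac12-h}\int_s^t z^{h-\frac32}(z-s)^{h-\frac12}\,\mathrm{d}z\right],\quad d_h=\sqrt{\frac{2h\,\Gamma(\frac32-h)}{\Gamma(h+\frac12)\Gamma(2-2h)}}.$$ For $n=1$, $H\in(0,1)$: $k_H^{(1)}=k_H$. For $n\ge2$, $H\in(n-1,n)$: $k_H^{(n)}(t,u)=\int_u^t k_{H-1}^{(n-1)}(s,u)\,\mathrm{d}s$ for $0<u<t$. All are Volterra kernels: $k_H^{(n)}(t,u)=0$ for $u\ge t$. **The process.** $W$ is a standard Brownian motion and $B_H^{(n)}(t)=\int_0^t k_H^{(n)}(t,u)\,\mathrm{d}W(u)$ is the $n$th order fractional Brownian motion with Hurst index $H$; its covariance is $r_H^{(n)}(t,s)=\mathbb{E}[B_H^{(n)}(t)B_H^{(n)}(s)]$. **Hilbert space and Wiener integral.** With $\mathbf{1}_t=\mathbf{1}_{[0,t)}$, $t\le T$, the Hilbert space $\mathcal{H}_H^{(n)}=\mathcal{H}_H^{(n)}([0,T])$ is the completion of the linear span of $\{\mathbf{1}_t:t\le T\}$ under the inner product determined by $\langle\mathbf{1}_t,\mathbf{1}_s\rangle_{\mathcal{H}_H^{(n)}}=r_H^{(n)}(t,s)$. The Wiener integral $f\mapsto\int_0^T f(s)\,\mathrm{d}B_H^{(n)}(s)$ is the isometry from $\mathcal{H}_H^{(n)}$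 into $L^2(\Omega)$ that linearly extends $\mathbf{1}_t\mapsto B_H^{(n)}(t)$. The inclusion $L^2([0,T])\subset\mathcal{H}_H^{(n)}$ is understood in the sense that the identity map on step functions extends to a continuous linear injection $L^2([0,T])\to\mathcal{H}_H^{(n)}$. *)

(* Defs.v *)
From HB Require Import structures.
From mathcomp Require Import all_boot all_order all_algebra.
From mathcomp Require Import all_classical all_reals all_analysis.

Set Implicit Arguments.
Unset Strict Implicit.
Unset Printing Implicit Defensive.

Import Order.TTheory GRing.Theory Num.Theory.
Import numFieldNormedType.Exports.

Local Open Scope classical_set_scope.
Local Open Scope ring_scope.

Section Kernels.
Context {R : realType}.
Implicit Types (x h t s u H : R) (n : nat).
Local Notation leb := (@lebesgue_measure R).

(* Euler's integral; only used at x > 0, where it converges. *)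
Definition Gamma x : R :=
  \int[leb]_(y in `]0, +oo[) (y `^ (x - 1) * expR (- y)).

Definition fbm_const h : R :=
  Num.sqrt (2 * h * Gamma (3 / 2 - h) / (Gamma (h + 1 / 2) * Gamma (2 - 2 * h))).

Definition fbm_kernel1 h t s : R :=
  if 0 < s < t then
    fbm_const h *
      ((t / s) `^ (h - 1 / 2) * (t - s) `^ (h - 1 / 2)
       - (h - 1 / 2) * s `^ (1 / 2 - h) *
         \int[leb]_(z in `[s, t]) (z `^ (h - 3 / 2) * (z - s) `^ (h - 1 / 2)))
  else 0.

(* The kernel of order n >= 1; the value at n = 0 is junk. *)
Fixpoint fbm_kernel n H t u : R :=
  match n with
  | 0 => 0
  | 1 => fbm_kernel1 H t u
  | m.+1 =>
      if 0 < u < t then \int[leb]_(s in `[u, t]) fbm_kernel m (H - 1) s u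
      else 0
  end.

End Kernels.

Section StepFunctions.
Context {R : realType}.
Implicit Types T t : R.

(* On linear combinations of a family e of vectors indexed by times, encoded as
   lists of pairs (coefficient, time). *)
Definition lin_comb (V : lmodType R) (e : R -> V) (c : seq (R * R)) : V :=
  \sum_(p <- c) p.1 *: e p.2.

Definition times_in T (c : seq (R * R)) : Prop :=
  forall p, p \in c -> 0 <= p.2 <= T.

Definition ind t : R -> R := \1_(`[0, t[%classic : set R).

Definition step_fun T : set (R -> R) :=
  [set phi | exists2 c, times_in T c & phi = lin_comb ind c].

End StepFunctions.

Section L2.
Context {R : realType}.
Implicit Types (T : R) (f g : R -> R).

(* Lebesgue measure on [0, T], as a measure on the whole line. *)
Definition lebT T : {measure set (measurableTypeR R) -> \bar R} :=
  mrestr (@lebesgue_measure R) (measurable_itv `[0, T]).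

(* L^2([0, T]) is handled through representatives R -> R, up to equality
   lebT T-almost everywhere. *)
Definition L2 T : set (R -> R) := [set f | f \in Lfun (lebT T) 2%:E].

Definition L2_dot T f g : \bar R := (\int[lebT T]_u (f u * g u)%:E)%E.

Definition L2_dist T f g : \bar R := 'N[lebT T]_2%:E[EFin \o (f \- g)%R]%E.

End L2.

Section Processes.
Context {R : realType} d (Omega : measurableType d) (P : probability Omega R).

Definition increment (W : R -> {RV P >-> R}) (s t : R) : Omega -> R :=
  fun w => W t w - W s w.

(* Standard Brownian motion on [0, T]; values W t with t outside [0, T] are
   unconstrained. *)
Definition brownian (T : R) (W : R -> {RV P >-> R}) : Prop :=
  [/\ (W 0 : Omega -> R) = cst 0 %[ae P],
      forall s t : R, 0 <= s -> s < t -> t <= T ->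
        forall A : set R, measurable A ->
        P (increment W s t @^-1` A) = normal_prob 0 (Num.sqrt (t - s)) A,
      forall (m : nat) (t : nat -> R) (A : nat -> set R),
        0 <= t 0%N -> (forall i, (i < m)%N -> t i <= t i.+1) -> t m <= T ->
        (forall i, measurable (A i)) ->
        P (\bigcap_(i in `I_m) increment W (t i) (t i.+1) @^-1` A i) =
        (\prod_(i < m) P (increment W (t i) (t i.+1) @^-1` A i))%E
    & {ae P, forall w, {within `[0, T], continuous (fun t : R => W t w)}}].

Definition covar_fun (B : R -> {RV P >-> R}) (t s : R) : \bar R :=
  'E_P[(B t : Omega -> R) \* B s]%E.

(* I is (a choice of representatives of) the Wiener integral of the process X:
   the isometry from the subspace D of V, with inner product dot, to L^2(Omega)
   that linearly extends e t |-> X t for t in [0, T]. *)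
Definition wiener_integral (T : R) (V : lmodType R) (D : set V)
    (dot : V -> V -> \bar R) (e : R -> V) (X : R -> {RV P >-> R})
    (I : V -> Omega -> R) : Prop :=
  [/\ forall f, D f -> I f \in Lfun P 2%:E,
      forall (a : R) f g, D f -> D g ->
        I (a *: f + g) = (fun w => a * I f w + I g w) %[ae P],
      forall f g, D f -> D g -> 'E_P[I f \* I g]%E = dot f g
    & forall t : R, 0 <= t <= T -> I (e t) = X t %[ae P]].

End Processes.

Section Completion.
Context {R : realType}.

(* (V, dot) with the map iota is a Hilbert space completion of the linear span
   of the functions ind t, 0 <= t <= T, for the inner product determined by
   <ind t, ind s> = r t s. *)
Definition step_completion (T : R) (r : R -> R -> \bar R)
    (V : completeNormedModType R) (dot : {dot V for idfun})
    (iota : (R -> R) -> V) : Prop :=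
  [/\ forall x, dot x x = `|x| ^+ 2,
      forall (a : R) phi psi, step_fun T phi -> step_fun T psi ->
        iota (a *: phi + psi) = a *: iota phi + iota psi,
      forall t s : R, 0 <= t <= T -> 0 <= s <= T ->
        (dot (iota (ind t)) (iota (ind s)))%:E = r t s
    & closure (iota @` step_fun T) = setT].

(* The closure in V x L^2([0, T]) of the graph of the linear extension of
   ind t |-> k t. *)
Definition closed_ext (T : R) (V : completeNormedModType R)
    (iota : (R -> R) -> V) (k : R -> R -> R) (f : V) (g : R -> R) : Prop :=
  exists2 c : nat -> seq (R * R),
    forall m, times_in T (c m) &
    (fun m => iota (lin_comb ind (c m))) @ \oo --> f /\
    (fun m => L2_dist T (lin_comb k (c m)) g) @ \oo --> 0%E.

(* K : V -> L^2([0, T]) is the operator obtained by linearly extending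
   ind t |-> k t and closing: its graph is the closure above. *)
Definition closed_operator (T : R) (V : completeNormedModType R)
    (iota : (R -> R) -> V) (k : R -> R -> R) (K : V -> R -> R) : Prop :=
  [/\ forall f, L2 T (K f),
      forall (a : R) f g,
        K (a *: f + g) = (fun u => a * K f u + K g u) %[ae lebT T],
      forall t : R, 0 <= t <= T -> K (iota (ind t)) = k t %[ae lebT T]
    & forall f g, L2 T g ->
        closed_ext T iota k f g <-> g = K f %[ae lebT T]].

(* J : L^2([0, T]) -> V is a continuous linear injection (of classes modulo
   almost everywhere equality) that extends the identity on step functions. *)
Definition L2_inclusion (T : R) (V : completeNormedModType R)
    (iota : (R -> R) -> V) (J : (R -> R) -> V) : Prop :=
  [/\ forall (a : R) f g, L2 T f -> L2 T g -> J (a *: f + g) = a *: J f + J g,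
      forall f g, L2 T f -> L2 T g -> J f = J g <-> f = g %[ae lebT T],
      forall f, L2 T f -> forall e : R, 0 < e -> exists2 delta : R, 0 < delta &
        forall g, L2 T g -> (L2_dist T g f < delta%:E)%E -> `|J g - J f| < e
    & forall phi, step_fun T phi -> J phi = iota phi].

End Completion.

(* Main.v *)
(* The map [ind t |-> k t] preserves inner products, since by the Ito isometry both
   Gram matrices are the covariance of B; its closure K is thus an isometry, and the
   two Wiener integrals agree because they do on step functions.  When n >= 2,
   Fubini gives [A (ind t) = k t] for A f = \int f(t) k'(t, .) dt, k' the kernel of
   order n - 1.  Any g orthogonal to every k t is orthogonal to the range of A, which
   therefore lies in the closed range of K, and J := K^-1 o A is the inclusion.
   Injectivity of A is proved by induction on the order, peeling off one primitive
   f |-> \int_u^T f at a time.  For order 1, with a = h - 1/2, pairing the kernel with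
   the Abel weight (u - v)^-a u^a on (v, T] turns it, by the Beta integral, into a
   nonzero multiple of \int_v^t z^a dz, whose associated operator is injective by
   Lebesgue differentiation. *)
Require Import Defs.
From HB Require Import structures.
From mathcomp Require Import all_boot all_order all_algebra.
From mathcomp Require Import all_classical all_reals all_analysis.
From mathcomp Require Import measurable_realfun.
From mathcomp Require Import ring lra.

Set Implicit Arguments.
Unset Strict Implicit.
Unset Printing Implicit Defensive.

Import Order.TTheory GRing.Theory Num.Theory.
Import numFieldNormedType.Exports.

Local Open Scope classical_set_scope.
Local Open Scope ring_scope.

(** * Square integrable functions *)

(** All analysis of the kernels is funnelled into one bound, k(t, u)^2 <= D (u^-p + (t - u)^-p) on 0
    < u < t with p < 1. It survives the recursion on the order and makes every operator A
    Hilbert-Schmidt, so A is bounded on L^2 and Fubini provides its adjoint g |-> (t |-> <g, k'(t,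
    .)>). The adjoint then carries the argument: the orthogonality of g to the range of A, the
    factorisation of A through primitives and the Abel inversion are all identities between
    functions of t, tested against f. Elements of L^2 are plain functions, compared only almost
    everywhere, whereas V is a genuine complete normed space. The closed range of K is therefore
    exploited inside V: a preimage of h is found by minimising the squared norm of K x - h over x in
    V. Abel inversion is done by testing rather than by differentiating. For v > 0 the weight (u -
    v)^-a u^a lies in L^2(v, T), because u^a is bounded there and 2a < 1, so it can be paired with A
    f directly. *)

Lemma ae_imp (R : realType) d (X : measurableType d) (mu : {measure set X -> \bar R})
  (P Q : X -> Prop) : (forall x, P x -> Q x) ->
  {ae mu, forall x, P x} -> {ae mu, forall x, Q x}.
Proof. by move=> PQ; apply: filterS. Qed.

Lemma ae_imp2 (R : realType) d (X : measurableType d) (mu : {measure set X -> \bar R})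
  (P Q S : X -> Prop) : (forall x, P x -> Q x -> S x) ->
  {ae mu, forall x, P x} -> {ae mu, forall x, Q x} -> {ae mu, forall x, S x}.
Proof. by move=> PQ; apply: filterS2. Qed.

Lemma ae_and (R : realType) d (X : measurableType d) (mu : {measure set X -> \bar R})
  (P Q : X -> Prop) :
  {ae mu, forall x, P x} -> {ae mu, forall x, Q x} -> {ae mu, forall x, P x /\ Q x}.
Proof. by apply: filterS2 => x. Qed.

Section L2Theory.
Context {R : realType} d (X : measurableType d) (mu : {measure set X -> \bar R}).
Implicit Types f g : X -> R.
Local Notation L2m f := (f \in Lfun mu 2%:E).

(** Real valued through [fine], hence 0 when the integral is infinite; [ipE] recovers the extended
    integral for square integrable arguments. *)
Definition ip f g : R := \int[mu]_x (f x * g x).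
Definition nrm f : R := Num.sqrt (ip f f).

Let le12 : (1 <= 2%:E :> \bar R)%E. Proof. by rewrite lee_fin ler1n. Qed.

Lemma Lfun2_measurable f : L2m f -> measurable_fun setT f.
Proof. by rewrite inE => /andP[/[!inE]]. Qed.

Lemma Lfun2D f g : L2m f -> L2m g -> L2m (f + g).
Proof. by move=> lf lg; have [_ /(_ 1 f g lf lg)] := Lfun_submod_closed mu le12; rewrite scale1r. Qed.

Lemma Lfun20 : L2m (0 : X -> R).
Proof. by have [] := Lfun_submod_closed mu le12. Qed.

Lemma Lfun2Z a f : L2m f -> L2m (a *: f).
Proof.
move=> lf; have [_ /(_ a f 0 lf Lfun20)] := Lfun_submod_closed mu le12.
by rewrite addr0.
Qed.

Lemma Lfun2N f : L2m f -> L2m (- f).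
Proof. by move=> lf; rewrite -scaleN1r; exact: Lfun2Z. Qed.

Lemma Lfun2B f g : L2m f -> L2m g -> L2m (f - g).
Proof. by move=> lf lg; apply: Lfun2D => //; exact: Lfun2N. Qed.

Lemma Lfun2_ipI f g : L2m f -> L2m g ->
  mu.-integrable setT (fun x => (f x * g x)%:E).
Proof. by move=> lf lg; apply/Lfun1_integrable; exact: Lfun2_mul_Lfun1. Qed.

Lemma ipE f g : L2m f -> L2m g ->
  (ip f g)%:E = (\int[mu]_x (f x * g x)%:E)%E.
Proof.
by move=> lf lg; rewrite fineK//; apply: integrable_fin_num => //; exact: Lfun2_ipI.
Qed.

Lemma ipC f g : ip f g = ip g f.
Proof. by apply: eq_Rintegral => x _; rewrite mulrC. Qed.

Lemma ipDl f g h : L2m f -> L2m g -> L2m h -> ip (f + g) h = ip f h + ip g h.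
Proof.
move=> lf lg lh; rewrite /ip -RintegralD//; [|exact: Lfun2_ipI..].
by apply: eq_Rintegral => x _; rewrite mulrDl.
Qed.

Lemma ipZl a f h : L2m f -> L2m h -> ip (a *: f) h = a * ip f h.
Proof.
move=> lf lh; rewrite /ip -RintegralZl//; last exact: Lfun2_ipI.
by apply: eq_Rintegral => x _; rewrite mulrA.
Qed.

Lemma ip0l f : ip 0 f = 0.
Proof. by rewrite /ip /Rintegral integral0_eq// => x _; rewrite mul0r. Qed.

Lemma ip_ge0 f : 0 <= ip f f.
Proof. by apply: Rintegral_ge0 => x _; rewrite -expr2 sqr_ge0. Qed.

Lemma nrm_sqr f : nrm f ^+ 2 = ip f f.
Proof. by rewrite sqr_sqrtr// ip_ge0. Qed.

Lemma nrm_ge0 f : 0 <= nrm f. Proof. exact: sqrtr_ge0. Qed.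

(** Identifies [nrm] with the general L^p norm, so that the Minkowski and Hoelder inequalities
    become available for it. *)
Lemma LnormE f : L2m f -> 'N[mu]_2%:E[EFin \o f]%E = (nrm f)%:E.
Proof.
move=> lf; have := @powR_Lnorm _ _ _ mu (EFin \o f) 2.
rewrite pnatr_eq0 => /(_ erefl) e.
have : ('N[mu]_2%:E[EFin \o f] `^ 2 = (ip f f)%:E)%E.
  rewrite e ipE//; apply: eq_integral => x _ /=.
  by rewrite powR_mulrn// -normrX ger0_norm ?sqr_ge0// expr2.
have fN : 'N[mu]_2%:E[EFin \o f]%E \is a fin_num.
  by rewrite ge0_fin_numE ?Lnorm_ge0//; move: lf; rewrite inE => /andP[_ /[!inE]].
rewrite -(fineK fN); have := Lnorm_ge0 mu 2%:E (EFin \o f).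
rewrite -(fineK fN) lee_fin; set y := fine _ => y0.
rewrite poweR_EFin => -[]; rewrite powR_mulrn// => e2.
by congr EFin; rewrite /nrm -e2 sqrtr_sqr ger0_norm.
Qed.

Lemma ler_nrmD f g : L2m f -> L2m g -> nrm (f + g) <= nrm f + nrm g.
Proof.
move=> lf lg; rewrite -lee_fin EFinD -!LnormE//; last exact: Lfun2D.
by apply: eminkowski => //; exact: Lfun2_measurable.
Qed.

Lemma nrmZ a f : L2m f -> nrm (a *: f) = `|a| * nrm f.
Proof.
move=> lf; rewrite /nrm ipZl//; last exact: Lfun2Z.
rewrite ipC ipZl// mulrA -expr2 sqrtrM ?sqr_ge0//.
by rewrite sqrtr_sqr.
Qed.

Lemma nrm0 : nrm 0 = 0.
Proof. by rewrite /nrm ip0l sqrtr0. Qed.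

Lemma nrmN f : nrm (- f) = nrm f.
Proof. by congr Num.sqrt; apply: eq_Rintegral => x _; rewrite mulrNN. Qed.

Lemma ler_nrm_dist f g h : L2m f -> L2m g -> L2m h ->
  nrm (f - h) <= nrm (f - g) + nrm (g - h).
Proof.
move=> lf lg lh; rewrite -[f - h](subrKA g).
by apply: ler_nrmD; exact: Lfun2B.
Qed.

Lemma cauchy_schwarz f g : L2m f -> L2m g -> `|ip f g| <= nrm f * nrm g.
Proof.
move=> lf lg; rewrite -lee_fin EFinM -!LnormE//.
have := @hoelder _ _ _ mu f g 2 2 (Lfun2_measurable lf) (Lfun2_measurable lg).
rewrite !ltr0n => /(_ erefl erefl); rewrite -div1r -splitr => /(_ erefl).
apply: le_trans; rewrite Lnorm1 EFin_normr_Rintegral//; last exact: Lfun2_ipI.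
apply: le_abse_integral => //; exact: measurable_int (Lfun2_ipI lf lg).
Qed.

Lemma nrm_eq0 f : L2m f -> nrm f = 0 -> f = 0 %[ae mu].
Proof.
move=> lf nf; have := @Lnorm_eq0_eq0 _ _ _ mu (EFin \o f) 2%:E.
rewrite LnormE// nf => /(_ _ _ erefl) H.
have mf : measurable_fun [set: X] (EFin \o f) by apply/measurable_EFinP; exact: Lfun2_measurable.
by apply: filterS (H mf _); rewrite ?lte_fin// => x /= h /h [].
Qed.

Lemma ae_eq_ip f f' g : L2m f -> L2m f' -> L2m g -> f = f' %[ae mu] -> ip f g = ip f' g.
Proof.
move=> lf lf' lg ff'; congr fine; apply: ae_eq_integral => //.
1,2: by apply/measurable_EFinP; apply: measurable_funM; exact: Lfun2_measurable.
by apply: ae_imp ff' => x /= h /h ->.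
Qed.

Lemma Lfun2P f : L2m f <-> measurable_fun setT f /\ (\int[mu]_x (f x ^+ 2)%:E < +oo)%E.
Proof.
split=> [lf|[mf fi]].
  split; first exact: Lfun2_measurable.
  by apply: integrable_lty => //; exact: Lfun2_integrable_sqr.
rewrite inE; apply/andP; split; rewrite inE//=.
rewrite /finite_norm; apply: (@lty_poweRy _ _ 2); rewrite ?pnatr_eq0//.
rewrite powR_Lnorm ?pnatr_eq0//; apply: le_lt_trans fi.
apply: ge0_le_integral => //.
- by move=> x _; rewrite lee_fin powR_ge0.
- apply/measurable_EFinP; apply: (measurableT_comp (measurable_powR _)).
  exact: measurableT_comp.
- by apply/measurable_EFinP; exact: measurable_funX.
- by move=> x _; rewrite /= lee_fin powR_mulrn// -normrX ger0_norm// sqr_ge0.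
Qed.

Lemma nrm_eq f g : L2m f -> L2m g -> nrm (f - g) = 0 -> f = g %[ae mu].
Proof.
move=> lf lg /nrm_eq0 -/(_ (Lfun2B lf lg)); apply: ae_imp => x /= h /h /eqP.
by rewrite subr_eq0 => /eqP.
Qed.

Lemma eq_nrm f g : L2m f -> L2m g -> f = g %[ae mu] -> nrm (f - g) = 0.
Proof.
move=> lf lg fg; rewrite /nrm (@ae_eq_ip (f - g) 0 (f - g)).
- by rewrite ip0l sqrtr0.
- exact: Lfun2B.
- exact: Lfun20.
- exact: Lfun2B.
- by apply: ae_imp fg => x /= h /h e; rewrite /= !fctE e subrr.
Qed.

Lemma nrm_ae f g : L2m f -> L2m g -> f = g %[ae mu] -> nrm f = nrm g.
Proof.
move=> lf lg fg; rewrite /nrm (@ae_eq_ip f g f)// (ipC g f).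
by rewrite (@ae_eq_ip f g g).
Qed.

End L2Theory.

(** * Completeness of L^2 *)

Section L2Complete.
Context {R : realType} d (X : measurableType d) (mu : {measure set X -> \bar R}).
Local Notation L2m f := (f \in Lfun mu 2%:E).

Lemma limn_einf_le (u : (\bar R)^nat) (C : \bar R) :
  (forall n, (u n <= C)%E) -> (limn_einf u <= C)%E.
Proof.
move=> uC; rewrite limn_einf_lim; apply: lime_le; first exact: is_cvg_einfs.
apply: nearW => n; apply: le_trans (uC n).
by apply: ereal_inf_lbound; exists n => /=.
Qed.

Lemma measurable_limn_einf (f : (X -> \bar R)^nat) :
  (forall n, measurable_fun setT (f n)) ->
  measurable_fun setT (fun x => limn_einf (f ^~ x)).
Proof.
move=> mf; rewrite /limn_einf; apply: measurableT_comp => //.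
by apply: measurable_fun_limn_esup => n; apply: measurableT_comp.
Qed.

(** Each weighted term is at most the whole sum M, so the increments are at most sqrt M times 2^-n
    and the telescoping series converges absolutely. *)
Lemma cvgn_sqr_summable (u : R^nat) :
  (\sum_(n <oo) (4 ^+ n * (u n.+1 - u n) ^+ 2)%:E < +oo)%E -> cvgn u.
Proof.
pose D n := 4 ^+ n * (u n.+1 - u n) ^+ 2.
rewrite -[X in (X < _)%E -> _]/(\sum_(n <oo) (D n)%:E)%E => Dlt.
have D0 n : 0 <= D n by apply: mulr_ge0; [exact: exprn_ge0|exact: sqr_ge0].
have S0 : (0 <= \sum_(n <oo) (D n)%:E)%E by apply: nneseries_ge0 => n _ _; rewrite lee_fin.
set M := fine (\sum_(n <oo) (D n)%:E).
have SE : (\sum_(n <oo) (D n)%:E)%E = M%:E by rewrite fineK// ge0_fin_numE.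
have DM n : D n <= M.
  rewrite -lee_fin -SE; apply: le_trans (nneseries_lim_ge n.+1 _); last first.
    by move=> k _ _; rewrite lee_fin.
  rewrite big_nat_recr//= leeDr// sume_ge0// => k _; by rewrite lee_fin.
have M0 : 0 <= M by apply: le_trans (DM 0%N).
have dle n : `|telescope u n| <= geometric (Num.sqrt M) 2^-1 n.
  rewrite /= /telescope -(@ler_pXn2r _ 2)// ?nnegrE ?mulr_ge0 ?sqrtr_ge0 ?exprn_ge0 ?invr_ge0//.
  rewrite exprMn sqr_sqrtr// -exprM mulnC exprM real_normK ?num_real//.
  have -> : (2^-1 ^+ 2) ^+ n = (4 ^+ n)^-1 :> R by rewrite !exprVn -natrX.
  by rewrite ler_pdivlMr ?exprn_gt0// mulrC; exact: DM.
have : cvgn (series (telescope u)).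
  apply: normed_cvg; apply: series_le_cvg dle _ => [n|n|].
  - exact: normr_ge0.
  - by rewrite /= mulr_ge0 ?sqrtr_ge0// exprn_ge0// invr_ge0.
  - apply: is_cvg_geometric_series.
    by rewrite gtr0_norm ?invr_gt0// invf_lt1// ltr1n.
move=> cs; have <- : (fun n => u 0%N + series (telescope u) n) = u.
  by apply/funext => n; rewrite -eq_sum_telescope.
by apply: is_cvgD => //; exact: is_cvg_cst.
Qed.

Lemma Lfun2_sqr_integral f : L2m f -> (\int[mu]_x (f x ^+ 2)%:E = (nrm mu f ^+ 2)%:E)%E.
Proof. by move=> lf; rewrite nrm_sqr ipE//; apply: eq_integral => x _; rewrite expr2. Qed.

Lemma Lfun2_sqr_integralB f g : L2m f -> L2m g ->
  (\int[mu]_x ((f x - g x) ^+ 2)%:E = (nrm mu (f - g) ^+ 2)%:E)%E.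
Proof. by move=> lf lg; rewrite -Lfun2_sqr_integral//; exact: Lfun2B. Qed.

(** Riesz-Fischer for sequences with geometric steps, which is enough because approximating
    sequences can be chosen. The series of 4^n (F (n+1) - F n)^2 has integral at most the sum of 4^n
    (4^-n)^2 = 4^-n; it is thus finite almost everywhere, where [cvgn_sqr_summable] gives pointwise
    convergence. *)
Lemma L2_complete (F : (X -> R)^nat) : (forall n, L2m (F n)) ->
  (forall n, nrm mu (F n.+1 - F n) <= 4^-1 ^+ n) ->
  exists2 g, L2m g & (fun n => nrm mu (F n - g)) @ \oo --> 0.
Proof.
move=> LF dF.
have q0 : 0 < 4^-1 :> R by rewrite invr_gt0.
have q1 : `|4^-1 : R| < 1 by rewrite gtr0_norm// invf_lt1// ltr1n.
have qn n : 0 <= 4^-1 ^+ n :> R by rewrite exprn_ge0// ltW.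
have mF n : measurable_fun setT (F n) by exact: Lfun2_measurable (LF n).
(* The geometric tail has ratio sum 4/3, rounded up to 2. *)
have dn n m : nrm mu (F n - F (n + m)%N) <= 2 * 4^-1 ^+ n.
  suff : nrm mu (F n - F (n + m)%N) <= series (geometric (4^-1 ^+ n) 4^-1) m.
    move/le_trans; apply.
    apply: (le_trans (geometric_le_lim _ (qn n) q0 q1)).
    rewrite mulrC ler_wpM2r// (_ : (1 - 4^-1)^-1 = 4 / 3); last by field.
    by lra.
  elim: m => [|m IH].
    by rewrite addn0 subrr nrm0 /series /= big_nil.
  apply: (le_trans (ler_nrm_dist (LF n) (LF (n + m)%N) (LF _))).
  rewrite seriesS addrC lerD// -nrmN opprB addnS (le_trans (dF _))//=.
  by rewrite exprD.
(* The limsup is measurable whether or not the sequence converges; [fine] changes it only where it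
   is infinite, a null set by [Fg]. *)
pose g x := fine (limn_esup (fun n => (F n x)%:E)).
have mg : measurable_fun setT g.
  apply: measurableT_comp => //; apply: measurable_fun_limn_esup => n.
  exact/measurable_EFinP.
pose D n x := (4 ^+ n * (F n.+1 x - F n x) ^+ 2)%:E.
have mD n : measurable_fun setT (D n).
  apply/measurable_EFinP; apply: measurable_funM => //.
  by apply: measurable_funX; apply: measurable_funB.
have D0 n x : (0 <= D n x)%E.
  by rewrite lee_fin; apply: mulr_ge0; [exact: exprn_ge0|exact: sqr_ge0].
have intD : (\int[mu]_x \sum_(n <oo) D n x < +oo)%E.
  rewrite integral_nneseries//.
  have Dle n : (\int[mu]_x D n x <= (4^-1 ^+ n)%:E)%E.
    rewrite /D; under eq_integral do rewrite EFinM.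
    rewrite ge0_integralZl_EFin//=; last 2 first.
    - by move=> x _; rewrite lee_fin sqr_ge0.
    - by apply/measurable_EFinP; apply: measurable_funX; exact: measurable_funB.
    rewrite Lfun2_sqr_integralB//.
    rewrite -EFinM lee_fin (@le_trans _ _ (4 ^+ n * (4^-1 ^+ n) ^+ 2))//.
      by rewrite ler_wpM2l// ?exprn_ge0// ler_pXn2r// ?nnegrE ?nrm_ge0//.
    by rewrite expr2 mulrA -exprMn divff// expr1n mul1r.
  apply: (@le_lt_trans _ _ (\sum_(n <oo) (geometric 1 (4^-1 : R) n)%:E)%E).
    apply: lee_nneseries => n _; first by move=> _; apply: integral_ge0.
    by rewrite /= mul1r.
  have c4 : cvgn (series (geometric 1 (4^-1 : R))).
    exact: is_cvg_geometric_series.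
  rewrite (_ : limn _ = (limn (series (geometric 1 (4^-1 : R))))%:E) ?ltry//.
  rewrite -EFin_lim//; congr (limn _); apply/funext => n /=.
  by rewrite -sumEFin.
have Fg : {ae mu, forall x, F n x @[n --> \oo] --> g x}.
  have : mu.-integrable setT (fun x => \sum_(n <oo) D n x)%E.
    apply/integrableP; split; first exact: ge0_emeasurable_sum.
    rewrite (eq_integral (fun x => \sum_(n <oo) D n x)%E)// => x _.
    by rewrite gee0_abs// nneseries_ge0.
  move/integrable_ae => /(_ measurableT); apply: ae_imp => x /(_ I).
  rewrite ge0_fin_numE ?nneseries_ge0// => /cvgn_sqr_summable cF.
  have h : (F n x)%:E @[n --> \oo] --> (limn (F ^~ x))%:E.
    by apply: cvg_EFin; [exact: nearW|exact: cF].
  by rewrite /g (cvg_limn_einf_sup h).2.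
(* Fatou in m: the squares of F n - F (n + m) tend almost everywhere to that of F n - g, with
   integrals bounded by [dn] uniformly in m. *)
have Fatou n : (\int[mu]_x ((F n x - g x) ^+ 2)%:E <= ((2 * 4^-1 ^+ n) ^+ 2)%:E)%E.
  pose u m x := ((F n x - F (n + m)%N x) ^+ 2)%:E.
  have mu' m : measurable_fun setT (u m).
    by apply/measurable_EFinP; apply: measurable_funX; exact: measurable_funB.
  rewrite (@ge0_ae_eq_integral _ _ _ _ _ _ (fun x => limn_einf (u ^~ x)))//; last 5 first.
  - by apply/measurable_EFinP; apply: measurable_funX; exact: measurable_funB.
  - exact: measurable_limn_einf.
  - by move=> x _; rewrite lee_fin sqr_ge0.
  - move=> x _; rewrite limn_einf_lim; apply: lime_ge; first exact: is_cvg_einfs.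
    by apply: nearW => m; apply: le_ereal_inf_tmp => _ [k _ <-]; rewrite lee_fin sqr_ge0.
  - apply: ae_imp Fg => x Fx _; symmetry.
    apply: (fst (cvg_limn_einf_sup _)).
    apply: cvg_EFin; first exact: nearW.
    have c : (fun m => F n x - F (n + m)%N x) @ \oo --> F n x - g x.
      apply: cvgB; first exact: cvg_cst.
      have -> : (fun m => F (n + m)%N x) = [sequence F (m + n)%N x]_m.
        by apply/funext => m; rewrite addnC.
      by rewrite (cvg_shiftn n (F ^~ x)).
    exact: (cvgM c c).
  apply: (le_trans (fatou mu measurableT mu' _)).
    by move=> m x _; rewrite lee_fin sqr_ge0.
  apply: limn_einf_le => m; rewrite /u Lfun2_sqr_integralB//.
  by rewrite lee_fin ler_pXn2r// ?nnegrE ?nrm_ge0// mulr_ge0.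
have LFg n : L2m (F n - g).
  apply/Lfun2P; split; first exact: measurable_funB.
  exact: le_lt_trans (Fatou n) (ltry _).
have Lg : L2m g by rewrite -(subKr (F 0%N) g); apply: Lfun2B.
exists g => //.
have bnd n : nrm mu (F n - g) <= geometric 2 (4^-1) n.
  rewrite -(@ler_pXn2r _ 2)// ?nnegrE ?nrm_ge0//; last by rewrite /= mulr_ge0.
  by rewrite -lee_fin -Lfun2_sqr_integralB.
apply: (@squeeze_cvgr _ _ _ _ (cst 0) (geometric 2 (4^-1))).
- by apply: nearW => n; rewrite nrm_ge0 bnd.
- exact: cvg_cst.
- exact: cvg_geometric.
Qed.

End L2Complete.

(** * The closure of the map on step functions *)

Section StepCombinations.
Context {R : realType}.

(** The combination a c + c' on codes; working on codes makes it act on the families [ind] and [k]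
    simultaneously. *)
Definition comb_axpy (a : R) (c c' : seq (R * R)) : seq (R * R) :=
  [seq (a * p.1, p.2) | p <- c] ++ c'.

Lemma lin_comb_nil (V : lmodType R) (e : R -> V) : lin_comb e [::] = 0.
Proof. by rewrite /lin_comb big_nil. Qed.

Lemma lin_comb_cons (V : lmodType R) (e : R -> V) p c :
  lin_comb e (p :: c) = p.1 *: e p.2 + lin_comb e c.
Proof. by rewrite /lin_comb big_cons. Qed.

Lemma lin_comb_axpy (V : lmodType R) (e : R -> V) a c c' :
  lin_comb e (comb_axpy a c c') = a *: lin_comb e c + lin_comb e c'.
Proof.
elim: c => [|p c IH]; first by rewrite lin_comb_nil scaler0 add0r.
by rewrite /comb_axpy /= !lin_comb_cons IH scalerDr scalerA addrA.
Qed.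

Lemma times_in_axpy (T : R) a c c' :
  times_in T c -> times_in T c' -> times_in T (comb_axpy a c c').
Proof.
move=> tc tc' p; rewrite mem_cat => /orP[/mapP[q qc ->]|]; last exact: tc'.
exact: (tc q qc).
Qed.

Lemma times_in_cons (T : R) (p : R * R) c : times_in T (p :: c) -> 0 <= p.2 <= T /\ times_in T c.
Proof.
move=> h; split; first by apply: h; rewrite mem_head.
by move=> q qc; apply: h; rewrite inE qc orbT.
Qed.

End StepCombinations.

(** * Riesz representation in a real Hilbert space *)

Section RealDot.
Context {R : realType} (V : completeNormedModType R) (dot : {dot V for idfun}).
Hypothesis dot_sqr : forall x, dot x x = `|x| ^+ 2.

Lemma dotC x y : dot x y = dot y x.
Proof. by rewrite hermC/= expr0 mul1r. Qed.

Lemma dotDl x y z : dot (x + y) z = dot x z + dot y z.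
Proof. by rewrite linearDl. Qed.

Lemma dotZl a x z : dot (a *: x) z = a * dot x z.
Proof. by rewrite linearZl_LR. Qed.

Lemma dotDr x y z : dot z (x + y) = dot z x + dot z y.
Proof. by rewrite !(dotC z) dotDl. Qed.

Lemma dotZr a x z : dot z (a *: x) = a * dot z x.
Proof. by rewrite !(dotC z) dotZl. Qed.

Lemma dot_polar x y : dot x y = (`|x + y| ^+ 2 - `|x| ^+ 2 - `|y| ^+ 2) / 2.
Proof.
rewrite -!dot_sqr dotDl (dotC x (x + y)) (dotC y (x + y)) !dotDl (dotC y x).
by field.
Qed.

(** The lower bound on the quadratic functional q replaces continuity of l; in the application q x
    is the squared norm of K x - h. A minimising sequence of q is Cauchy by the parallelogram law,
    and its limit represents l because q is stationary there. *)
Lemma riesz (l : V -> R) (c : R) :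
  (forall a x y, l (a *: x + y) = a * l x + l y) ->
  (forall x, 0 <= `|x| ^+ 2 - 2 * l x + c) ->
  exists x, forall y, dot x y = l y.
Proof.
move=> ll qge0; pose q x := `|x| ^+ 2 - 2 * l x + c.
have lD x y : l (x + y) = l x + l y by have := ll 1 x y; rewrite scale1r mul1r.
have l0 : l 0 = 0 by have := lD 0 0; rewrite addr0 => /eqP; rewrite -subr_eq subrr eq_sym => /eqP.
have lZ a x : l (a *: x) = a * l x by have := ll a x 0; rewrite !addr0 l0 addr0.
have infq : has_inf (range q).
  by split; [exists (q 0); exists 0|exists 0 => _ [x _ <-]; exact: qge0].
pose m := inf (range q).
have mq x : m <= q x by apply: ge_inf; [case: infq|exists x].
(* The parallelogram identity: l is linear and c constant, so both drop out. *)
have mid x y : `|x - y| ^+ 2 = 2 * (q x - m) + 2 * (q y - m) - 4 * (q (2^-1 *: (x + y)) - m).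
  rewrite /q lZ lD -!dot_sqr !dotZl !dotZr -scaleN1r !(dotDl, dotDr, dotZl, dotZr) (dotC y x).
  by field.
have eps_gt0 n : 0 < 4^-1 ^+ n / 4 :> R by rewrite divr_gt0// exprn_gt0// invr_gt0.
(* With this precision [mid] bounds the squared step by (1/8 + 1/2) 4^-n, hence the step by 2^-n. *)
have /choice[x hx] (n : nat) : exists x, q x < m + 4^-1 ^+ n / 4.
  have [_ [x _ <-] qx] := inf_adherent (eps_gt0 n) infq.
  by exists x.
have dx n : `|telescope x n| <= geometric 1 (2^-1 : R) n.
  rewrite /= mul1r /telescope /= -(@ler_pXn2r _ 2)// ?nnegrE// ?exprn_ge0// ?invr_ge0//.
  rewrite mid -exprM mulnC exprM (_ : 2^-1 ^+ 2 = 4^-1 :> R); last by field.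
  have := hx n; have := hx n.+1; have := mq (2^-1 *: (x n.+1 + x n)); have := eps_gt0 n.
  rewrite exprS; lra.
have cx : cvgn x.
  have cs : cvgn (series (telescope x)).
    apply: normed_cvg; apply: series_le_cvg dx _ => [n|n|].
    - exact: normr_ge0.
    - by rewrite /= mul1r exprn_ge0// invr_ge0.
    - by apply: is_cvg_geometric_series; rewrite gtr0_norm ?invr_gt0// invf_lt1// ltr1n.
  have <- : (fun n => x 0%N + series (telescope x) n) = x.
    by apply/funext => n; rewrite -eq_sum_telescope.
  by apply: is_cvgD => //; exact: is_cvg_cst.
exists (limn x) => y; apply/eqP; rewrite -subr_eq0 -sqrf_eq0; apply/eqP.
pose dl n := (dot (x n) y - l y) ^+ 2.
have dln : dl @ \oo --> (dot (limn x) y - l y) ^+ 2.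
  rewrite /dl expr2 (_ : (fun n => _) = (fun n => (dot (x n) y - l y) * (dot (x n) y - l y))); last first.
    by apply/funext => n; rewrite expr2.
  suff h : (fun n => dot (x n) y - l y) @ \oo --> dot (limn x) y - l y by exact: cvgM.
  apply: cvgB; last exact: cvg_cst.
  (* Polarisation expresses [dot] by norms, which yields its continuity in the first argument. *)
  rewrite dot_polar; under eq_fun do rewrite dot_polar !expr2.
  rewrite !expr2; apply: cvgM; last exact: cvg_cst.
  apply: cvgB; last exact: cvg_cst.
  by apply: cvgB; apply: cvgM; apply: cvg_norm => //; apply: cvgD => //; exact: cvg_cst.
apply: cvg_unique dln _ => //.
have dle n : 0 <= dl n <= geometric (`|y| ^+ 2 / 4) 4^-1 n.
  rewrite sqr_ge0 /=; have [y0|y0] := eqVneq y 0.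
    by rewrite /dl y0 l0 dotC -(scale0r (0 : V)) dotZl mul0r subr0 scale0r normr0 !expr0n !mul0r.
  have y2 : 0 < `|y| ^+ 2 by rewrite exprn_gt0// normr_gt0.
  (* This [s] minimises q on the line through x n with direction y. The drop of q there, e^2 over
     the squared norm of y, cannot exceed the gap between q (x n) and the infimum. *)
  set e := dot (x n) y - l y; pose s := - e / `|y| ^+ 2.
  have : q (s *: y + x n) = q (x n) + 2 * s * e + s ^+ 2 * `|y| ^+ 2.
    rewrite /q -!dot_sqr ll !(dotDl, dotDr, dotZl, dotZr) (dotC y) /e.
    by ring.
  have -> : q (x n) + 2 * s * e + s ^+ 2 * `|y| ^+ 2 = q (x n) - e ^+ 2 / `|y| ^+ 2.
    by rewrite /s; field; rewrite normr_eq0.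
  move=> qs; have := mq (s *: y + x n); rewrite qs => h.
  have : e ^+ 2 / `|y| ^+ 2 <= 4^-1 ^+ n / 4 by have := hx n; lra.
  rewrite ler_pdivrMr// => /le_trans; apply.
  by rewrite [leRHS]mulrAC mulrC mulrA.
apply: (@squeeze_cvgr _ _ _ _ (cst 0) (geometric (`|y| ^+ 2 / 4) 4^-1)).
- exact: nearW.
- exact: cvg_cst.
- by apply: cvg_geometric; rewrite gtr0_norm ?invr_gt0// invf_lt1// ltr1n.
Qed.

End RealDot.

Section Operator.
Context {R : realType} (T : R) (V : completeNormedModType R)
  (dot : {dot V for idfun}) (iota : (R -> R) -> V) (r : R -> R -> \bar R)
  (k : R -> R -> R).
Local Notation mu := (lebT T).
Hypothesis comp : step_completion T r dot iota.
Hypothesis kL2 : forall t, 0 <= t <= T -> L2 T (k t).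
Hypothesis rk : forall t s, 0 <= t <= T -> 0 <= s <= T ->
  r t s = (ip mu (k t) (k s))%:E.

Lemma L2_distE (f g : R -> R) : L2 T f -> L2 T g -> L2_dist T f g = (nrm mu (f - g))%:E.
Proof. by move=> lf lg; rewrite /L2_dist -LnormE//; exact: Lfun2B. Qed.

Lemma dot_sqr x : dot x x = `|x| ^+ 2. Proof. by case: comp. Qed.

Lemma step_fun_lin_comb c : times_in T c -> step_fun T (lin_comb ind c).
Proof. by move=> tc; exists c. Qed.

Lemma step_fun_ind t : 0 <= t <= T -> step_fun T (ind t : R -> R).
Proof.
move=> tT; exists [:: (1, t)]; first by move=> p; rewrite inE => /eqP ->.
by rewrite lin_comb_cons lin_comb_nil addr0 scale1r.
Qed.

Lemma iota_lin_comb c : times_in T c ->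
  iota (lin_comb ind c) = lin_comb (fun t => iota (ind t)) c.
Proof.
case: comp => _ il _ _.
elim: c => [_|p c IH /times_in_cons[pT tc]].
  have s0 : step_fun T (0 : R -> R) by exists [::] => //; rewrite lin_comb_nil.
  have := il 1 0 0 s0 s0; rewrite !scale1r addr0 => /eqP.
  by rewrite -subr_eq subrr eq_sym !lin_comb_nil => /eqP.
rewrite !lin_comb_cons il ?IH//; first exact: step_fun_ind.
exact: step_fun_lin_comb.
Qed.

Lemma lin_comb_L2 c : times_in T c -> L2 T (lin_comb k c).
Proof.
elim: c => [_|p c IH /times_in_cons[pT tc]]; first by rewrite lin_comb_nil; exact: Lfun20.
by rewrite lin_comb_cons; apply: Lfun2D; [apply: Lfun2Z; exact: kL2|exact: IH].
Qed.

Lemma dot_lin_comb c c' : times_in T c -> times_in T c' ->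
  dot (iota (lin_comb ind c)) (iota (lin_comb ind c')) =
  ip mu (lin_comb k c) (lin_comb k c').
Proof.
move=> tc tc'; rewrite !iota_lin_comb//.
have dot0 x : dot 0 x = 0 by rewrite -(scale0r (0 : V)) dotZl mul0r.
elim: c tc => [_|p c IH /times_in_cons[pT tc]].
  by rewrite !lin_comb_nil dot0 ip0l.
rewrite !lin_comb_cons dotDl dotZl IH// ipDl//; last 3 first.
- by apply: Lfun2Z; exact: kL2.
- exact: lin_comb_L2.
- exact: lin_comb_L2.
rewrite ipZl; [|exact: kL2|exact: lin_comb_L2]; congr (_ * _ + _) => {IH tc c}.
elim: c' tc' => [_|q c IH /times_in_cons[qT tc]].
  by rewrite !lin_comb_nil dotC ipC dot0 ip0l.
rewrite !lin_comb_cons dotDr dotZr IH//.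
rewrite [RHS]ipC ipDl//; last 3 first.
- by apply: Lfun2Z; exact: kL2.
- exact: lin_comb_L2.
- exact: kL2.
rewrite ipZl; [|exact: kL2..]; rewrite (ipC mu (lin_comb k c)); congr (_ * _ + _).
by case: comp => _ _ ik _; rewrite ipC; apply: EFin_inj; rewrite -rk// ik.
Qed.

Lemma norm_lin_comb c : times_in T c ->
  `|iota (lin_comb ind c)| = nrm mu (lin_comb k c).
Proof.
by move=> tc; rewrite /nrm -dot_lin_comb// dot_sqr sqrtr_sqr normr_id.
Qed.

Lemma iota_axpy a c c' : times_in T c -> times_in T c' ->
  iota (lin_comb ind (comb_axpy a c c')) =
  a *: iota (lin_comb ind c) + iota (lin_comb ind c').
Proof.
move=> tc tc'; rewrite lin_comb_axpy; case: comp => _ il _ _.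
by rewrite il//; exact: step_fun_lin_comb.
Qed.

(** Contains the well-definedness of the extension: two codes with the same image in V have
    combinations of [k] at distance 0 in L^2. *)
Lemma norm_sub_lin_comb c c' : times_in T c -> times_in T c' ->
  `|iota (lin_comb ind c) - iota (lin_comb ind c')| =
  nrm mu (lin_comb k c - lin_comb k c').
Proof.
move=> tc tc'; have := norm_lin_comb (times_in_axpy (a := -1) tc tc').
rewrite iota_axpy// lin_comb_axpy !scaleN1r.
rewrite -[LHS]normrN -[RHS]nrmN (opprD _ (lin_comb k c')) opprK => <-.
by rewrite opprD opprK.
Qed.

Lemma closed_extP f g : L2 T g -> closed_ext T iota k f g <->
  exists2 c : nat -> seq (R * R), forall m, times_in T (c m) &
    (fun m => iota (lin_comb ind (c m))) @ \oo --> f /\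
    (fun m => nrm mu (lin_comb k (c m) - g)) @ \oo --> 0.
Proof.
move=> lg; have E c : (forall m, times_in T (c m)) ->
  (fun m => L2_dist T (lin_comb k (c m)) g) = EFin \o (fun m => nrm mu (lin_comb k (c m) - g)).
  by move=> tc; apply/funext => m; rewrite L2_distE//; exact: lin_comb_L2.
split=> -[c tc [cf cg]]; exists c => //; split=> //.
  by move: cg; rewrite E// => /fine_cvgP[_].
by rewrite E//; apply: cvg_EFin cg; exact: nearW.
Qed.

(** Density gives codes within 4^-n / 2 of f; the isometry turns this into steps of norm at most
    4^-n in L^2, the rate required by [L2_complete]. *)
Lemma closed_ext_ex f : exists2 g, L2 T g & closed_ext T iota k f g.
Proof.
have q0 n : 0 < 4^-1 ^+ n / 2 :> R by rewrite divr_gt0// exprn_gt0// invr_gt0.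
have /choice[c hc] (n : nat) : exists c, times_in T c /\
    `|f - iota (lin_comb ind c)| < 4^-1 ^+ n / 2.
  have : closure (iota @` step_fun T) f by case: comp => _ _ _ ->.
  move=> /(_ _ (nbhsx_ballx f _ (q0 n)))[_ [[_ [c tc ->] <-] /=]].
  by rewrite -ball_normE /=; exists c.
have tc n : times_in T (c n) by case: (hc n).
have fc n : `|f - iota (lin_comb ind (c n))| < 4^-1 ^+ n / 2 by case: (hc n).
have [||g lg cg] := @L2_complete _ _ _ mu (fun n => lin_comb k (c n)).
- by move=> n; exact: lin_comb_L2.
- move=> n; rewrite -norm_sub_lin_comb//.
  rewrite (le_trans (ler_distD f _ _))// (distrC _ f).
  have := fc n; have := fc n.+1; have := q0 n; rewrite exprS; lra.
exists g => //; apply/closed_extP => //; exists c => //; split=> //.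
apply/cvgrPdist_lt => e e0.
have /cvgrPdist_lt /(_ e e0) : geometric (2^-1 : R) (4^-1) @ \oo --> 0.
  by apply: cvg_geometric; rewrite gtr0_norm ?invr_gt0// invf_lt1// ltr1n.
apply: filterS => n; rewrite sub0r normrN /= mulrC => h.
by apply: lt_le_trans (fc n) _; apply: le_trans (ler_norm _) (ltW h).
Qed.

Lemma closed_ext_axpy a f f' g g' : L2 T g -> L2 T g' ->
  closed_ext T iota k f g -> closed_ext T iota k f' g' ->
  closed_ext T iota k (a *: f + f') (a *: g + g').
Proof.
move=> lg lg' /closed_extP -/(_ lg)[c tc [cf cg]] /closed_extP -/(_ lg')[c' tc' [cf' cg']].
apply/closed_extP; first by apply: Lfun2D => //; exact: Lfun2Z.
exists (fun m => comb_axpy a (c m) (c' m)); first by move=> m; exact: times_in_axpy.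
split.
  rewrite (_ : (fun m => _) = (fun m => a *: iota (lin_comb ind (c m)) + iota (lin_comb ind (c' m)))).
    by apply: cvgD => //; apply: cvgZ => //; exact: cvg_cst.
  by apply/funext => m; rewrite iota_axpy.
apply: (@squeeze_cvgr _ _ _ _ (cst 0)
  (fun m => `|a| * nrm mu (lin_comb k (c m) - g) + nrm mu (lin_comb k (c' m) - g'))).
- apply: nearW => m; rewrite nrm_ge0/= lin_comb_axpy.
  have l1 : L2 T (lin_comb k (c m) - g) by apply: Lfun2B => //; exact: lin_comb_L2.
  have l2 : L2 T (lin_comb k (c' m) - g') by apply: Lfun2B => //; exact: lin_comb_L2.
  rewrite opprD addrACA -scalerBr -nrmZ//; apply: ler_nrmD => //; exact: Lfun2Z.
- exact: cvg_cst.
- rewrite -[X in _ --> X]addr0 -[X in _ --> X + _](mulr0 `|a|).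
  by apply: cvgD => //; apply: cvgM => //; exact: cvg_cst.
Qed.

Lemma closed_ext_norm f g : L2 T g -> closed_ext T iota k f g -> `|f| = nrm mu g.
Proof.
move=> lg /closed_extP -/(_ lg)[c tc [cf cg]].
have c1 : (fun m => nrm mu (lin_comb k (c m))) @ \oo --> `|f|.
  rewrite (_ : (fun m => _) = (fun m => `|iota (lin_comb ind (c m))|)); last first.
    by apply/funext => m; rewrite norm_lin_comb.
  exact: cvg_norm.
apply: cvg_unique c1 _ => //.
apply/cvgrPdist_lt => e e0; move/cvgrPdist_lt : cg => /(_ e e0).
apply: filterS => m; rewrite sub0r normrN ger0_norm ?nrm_ge0// => h.
apply: le_lt_trans h; have lc := lin_comb_L2 (tc m); set h := lin_comb _ _ in lc *.
have := ler_nrmD (Lfun2B lc lg) lg; rewrite subrK.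
have := ler_nrmD (Lfun2B lg lc) lc; rewrite subrK -(nrmN mu (g - h)) opprB.
by rewrite ler_norml => *; apply/andP; split; lra.
Qed.

(** By linearity g - g' is a value of the closed graph at 0, so the isometry gives it norm 0: the
    map is closable. *)
Lemma closed_ext_uniq f g g' : L2 T g -> L2 T g' ->
  closed_ext T iota k f g -> closed_ext T iota k f g' -> g = g' %[ae mu].
Proof.
move=> lg lg' cg cg'; apply: nrm_eq => //.
have := closed_ext_axpy (-1) lg' lg cg' cg.
rewrite !scaleN1r addrC subrr addrC => /closed_ext_norm <-; last exact: Lfun2B.
by rewrite normr0.
Qed.

Lemma closed_ext_ae f g g' : L2 T g -> L2 T g' ->
  closed_ext T iota k f g -> g = g' %[ae mu] -> closed_ext T iota k f g'.
Proof.
move=> lg lg' /closed_extP -/(_ lg)[c tc [cf cg]] gg'.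
apply/closed_extP => //; exists c => //; split=> //.
rewrite (_ : (fun m => _) = (fun m => nrm mu (lin_comb k (c m) - g)))//.
apply/funext => m; have lc := lin_comb_L2 (tc m).
apply/eqP; rewrite eq_le; apply/andP; split.
  apply: (le_trans (ler_nrm_dist lc lg lg')).
  by rewrite (eq_nrm lg lg')// addr0.
apply: (le_trans (ler_nrm_dist lc lg' lg)).
by rewrite -(nrmN mu (g' - g)) opprB (eq_nrm lg lg')// addr0.
Qed.

(** Values are representatives picked by choice, so linearity can only be expected almost
    everywhere. *)
Definition closed_op (f : V) : R -> R := sval (cid2 (closed_ext_ex f)).
Local Notation K := closed_op.

Lemma closed_op_L2 f : L2 T (K f).
Proof. by rewrite /K; case: cid2. Qed.

Lemma closed_op_ext f : closed_ext T iota k f (K f).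
Proof. by rewrite /K; case: cid2. Qed.

Lemma closed_op_axpy a f g : K (a *: f + g) = (a *: K f + K g) %[ae mu].
Proof.
apply: (@closed_ext_uniq (a *: f + g)).
- exact: closed_op_L2.
- by apply: Lfun2D; [apply: Lfun2Z|]; exact: closed_op_L2.
- exact: closed_op_ext.
- by apply: closed_ext_axpy; [exact: closed_op_L2..|exact: closed_op_ext|exact: closed_op_ext].
Qed.

Lemma closed_op_lin_comb c : times_in T c ->
  K (iota (lin_comb ind c)) = lin_comb k c %[ae mu].
Proof.
move=> tc; apply: (@closed_ext_uniq (iota (lin_comb ind c))).
- exact: closed_op_L2.
- exact: lin_comb_L2.
- exact: closed_op_ext.
- apply/closed_extP; first exact: lin_comb_L2.
  exists (fun=> c) => //; split; first exact: cvg_cst.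
  by rewrite subrr nrm0; exact: cvg_cst.
Qed.

Lemma closed_op_norm f : nrm mu (K f) = `|f|.
Proof.
by symmetry; apply: closed_ext_norm; [exact: closed_op_L2|exact: closed_op_ext].
Qed.

Lemma closed_op_isometry f g : ip mu (K f) (K g) = dot f g.
Proof.
have l f : K f \in Lfun mu 2%:E := closed_op_L2 f.
have ls : K f + K g \in Lfun mu 2%:E by exact: Lfun2D.
rewrite (dot_polar dot_sqr) -!closed_op_norm !nrm_sqr.
have -> : ip mu (K (f + g)) (K (f + g)) = ip mu (K f + K g) (K f + K g).
  have e : K (f + g) = (K f + K g) %[ae mu].
    by have := closed_op_axpy 1 f g; rewrite !scale1r.
  rewrite (@ae_eq_ip _ _ _ mu _ (K f + K g))//.
  by rewrite ipC (@ae_eq_ip _ _ _ mu _ (K f + K g)).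
rewrite ipDl// (ipC mu (K f) (_ + _)) (ipC mu (K g) (_ + _)) !ipDl// (ipC mu (K g) (K f)).
by field.
Qed.

Lemma closed_op_closed : closed_operator T iota k K.
Proof.
split; [exact: closed_op_L2|exact: closed_op_axpy|move=> t tT|move=> f g lg; split].
- have tc : times_in T [:: (1, t)] by move=> p; rewrite inE => /eqP ->.
  by have := closed_op_lin_comb tc; rewrite !lin_comb_cons !lin_comb_nil !addr0 !scale1r.
- move=> cg; apply: closed_ext_uniq cg _ => //; [exact: closed_op_L2|exact: closed_op_ext].
- move=> e; apply: (@closed_ext_ae f (K f)) => //; first exact: closed_op_L2.
    exact: closed_op_ext.
  by apply: ae_imp e => x h /h.
Qed.

(** Closed range without projections in L^2. Apply [riesz] to y |-> <K y, h> with c the squared norm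
    of h. The resulting x makes K x - h orthogonal to every K y, in particular to every [k t], so by
    hypothesis also to h; being orthogonal to both K x and h, it has norm 0. *)
Lemma closed_op_range h : L2 T h ->
  (forall g, L2 T g -> (forall t, 0 <= t <= T -> ip mu g (k t) = 0) -> ip mu g h = 0) ->
  exists x, K x = h %[ae mu].
Proof.
move=> lh hk; have lK f : K f \in Lfun mu 2%:E := closed_op_L2 f.
have [|x|x xl] := riesz dot_sqr (l := fun x => ip mu (K x) h) (c := ip mu h h).
- move=> a x y; rewrite -ipZl// -ipDl//; last exact: Lfun2Z.
  apply: ae_eq_ip => //; first by apply: Lfun2D => //; exact: Lfun2Z.
  exact: closed_op_axpy.
- rewrite -dot_sqr -closed_op_isometry.
  have := ip_ge0 mu (K x - h).
  have -> : K x - h = (-1) *: h + K x by rewrite scaleN1r addrC.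
  have lm : (-1) *: h \in Lfun mu 2%:E by exact: Lfun2Z.
  rewrite ipDl//; last exact: Lfun2D.
  rewrite ipZl//; last exact: Lfun2D.
  rewrite (ipC mu h) (ipC mu (K x) (_ + _)) !ipDl// !ipZl// (ipC mu h (K x)); lra.
exists x; apply: nrm_eq; [exact: lK|by []|].
have lg : K x - h \in Lfun mu 2%:E by exact: Lfun2B.
have gip f : L2 T f -> ip mu (K x - h) f = ip mu (K x) f - ip mu h f.
  by move=> lf; rewrite ipDl//; [rewrite -scaleN1r ipZl ?mulN1r|exact: Lfun2N].
suff e : ip mu (K x - h) (K x - h) = 0 by rewrite /nrm e sqrtr0.
have gh : ip mu (K x - h) h = 0.
  apply: hk => // t tT; have tc : times_in T [:: (1, t)] by move=> p; rewrite inE => /eqP ->.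
  have e := closed_op_lin_comb tc.
  rewrite lin_comb_cons lin_comb_nil addr0 scale1r in e.
  rewrite lin_comb_cons lin_comb_nil addr0 scale1r in e.
  rewrite ipC -(@ae_eq_ip _ _ _ mu _ _ _ (lK _) _ _ e)//; last exact: kL2.
  by rewrite ipC gip ?closed_op_isometry ?xl; [rewrite (ipC mu h) subrr|exact: lK].
rewrite gip; last exact: lg.
rewrite (ipC mu h) gh subr0 (ipC mu (K x)) gip; last exact: lK.
by rewrite closed_op_isometry xl (ipC mu h) subrr.
Qed.

End Operator.

(** * Comparison of the two Wiener integrals *)

Section WienerIntegral.
Context {R : realType} (T : R) d (Omega : measurableType d) (P : probability Omega R)
  (W B : R -> {RV P >-> R}) (intW : (R -> R) -> Omega -> R)
  (V : completeNormedModType R) (dot : {dot V for idfun})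
  (iota : (R -> R) -> V) (intB : V -> Omega -> R) (k : R -> R -> R).
Local Notation mu := (lebT T).
Hypothesis kL2 : forall t, 0 <= t <= T -> L2 T (k t).
Hypothesis wW : wiener_integral T (L2 T) (L2_dot T) ind W intW.
Hypothesis Bk : forall t : R, 0 <= t <= T -> (B t : Omega -> R) = intW (k t) %[ae P].

Lemma covar_kernel t s : 0 <= t <= T -> 0 <= s <= T ->
  covar_fun B t s = (ip mu (k t) (k s))%:E.
Proof.
move=> tT sT; case: wW => lW _ iW _.
rewrite ipE; [|exact: kL2..]; rewrite -[RHS]/(L2_dot T (k t) (k s)) -iW; [|exact: kL2..].
rewrite /covar_fun unlock /expectation.
have ml t' : 0 <= t' <= T -> measurable_fun setT (intW (k t')).
  by move=> h; apply: (@Lfun2_measurable _ _ _ P); apply: lW; exact: kL2.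
apply: ae_eq_integral => //.
- by apply/measurable_EFinP; apply: measurable_funM.
- by apply/measurable_EFinP; apply: measurable_funM; exact: ml.
- by apply: ae_imp2 (Bk tT) (Bk sT) => w /= h1 h2 /[dup] /h1 -> /h2 ->.
Qed.

Hypothesis comp : step_completion T (covar_fun B) dot iota.
Hypothesis wB : wiener_integral T setT (fun f g => (dot f g)%:E) (fun t => iota (ind t)) B intB.
Local Notation K := (closed_op comp kL2 covar_kernel).

(** Kept abstract in the domain and in the inner product, so as to serve both [intB] on V and [intW]
    on L^2. *)
Lemma wiener_sub (U : lmodType R) (D : set U) (dotU : U -> U -> \bar R) (e : R -> U)
    (X : R -> {RV P >-> R}) (I : U -> Omega -> R) f g :
  wiener_integral T D dotU e X I -> D f -> D g -> D (f - g) ->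
  (nrm P (I f - I g) ^+ 2)%:E = dotU (f - g) (f - g).
Proof.
move=> [lI linI dI _] Df Dg Dfg.
rewrite -dI// nrm_sqr unlock /expectation ipE; last 2 first.
- by apply: Lfun2B; exact: lI.
- by apply: Lfun2B; exact: lI.
have e1 : I (f - g) = (I f - I g) %[ae P].
  have := linI (-1) g f Dg Df; rewrite scaleN1r addrC.
  by apply: ae_imp => w h /h ->; rewrite mulN1r addrC.
have m1 : measurable_fun setT (I f - I g).
  by apply: (@Lfun2_measurable _ _ _ P); apply: Lfun2B; exact: lI.
have m2 : measurable_fun setT (I (f - g)) by apply: (@Lfun2_measurable _ _ _ P); exact: lI.
apply: ae_eq_integral => //.
- by apply/measurable_EFinP; apply: measurable_funM.
- by apply/measurable_EFinP; apply: measurable_funM.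
- by apply: ae_imp e1 => w /= h /h ->.
Qed.

Lemma wiener_lin_comb c : times_in T c ->
  intB (iota (lin_comb ind c)) = intW (lin_comb k c) %[ae P].
Proof.
case: (wW) => lW linW _ eW; case: (wB) => lB linB _ eB.
elim: c => [_|p c IH /times_in_cons[pT tc]].
  have i0 : iota (lin_comb ind [::]) = 0.
    by rewrite (iota_lin_comb comp)// lin_comb_nil.
  rewrite i0 lin_comb_nil.
  (* Since -1 *: 0 + 0 is 0, linearity reads I 0 = - I 0 + I 0 almost surely, so both integrals of 0
     vanish. *)
  have := linW (-1) 0 0 (Lfun20 mu) (Lfun20 mu).
  have := linB (-1) 0 0 Logic.I Logic.I.
  rewrite !scaler0 !addr0; apply: ae_imp2 => w h1 h2 /[dup] /h1 -> /h2 ->.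
  by rewrite !mulN1r !addNr.
have lB1 := linB p.1 (iota (ind p.2)) (iota (lin_comb ind c)) Logic.I Logic.I.
have lW1 := linW p.1 (k p.2) (lin_comb k c) (kL2 pT) (lin_comb_L2 kL2 tc).
have -> : iota (lin_comb ind (p :: c)) = p.1 *: iota (ind p.2) + iota (lin_comb ind c).
  rewrite lin_comb_cons; case: comp => _ il _ _; rewrite il//.
    exact: step_fun_ind.
  exact: step_fun_lin_comb.
rewrite lin_comb_cons.
apply: ae_imp2 (ae_and (ae_and lB1 lW1) (IH tc)) (ae_and (eB _ pT) (Bk pT)).
by move=> w [[h1 h2] h3] [h4 h5] wT; rewrite h1// h2// h3// h4// h5.
Qed.

(** The graph closure yields one sequence of codes approximating f in V and K f in L^2 together.
    Each integral is an isometry, so either side moves by less than e / 2, while on the codes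
    themselves the integrals coincide. *)
Lemma wiener_closed_op f : intB f = intW (K f) %[ae P].
Proof.
case: (wW) => lW _ _ _; case: (wB) => lB _ _ _.
have lK := closed_op_L2 comp kL2 covar_kernel f.
have lBf := lB f Logic.I; have lWf := lW _ lK.
suff e0 : nrm P (intB f - intW (K f)) = 0.
  have := nrm_eq0 (Lfun2B lBf lWf) e0; apply: ae_imp => w /= h /h /eqP.
  by rewrite subr_eq0 => /eqP.
have /(closed_extP _ kL2 f lK)[c tc [cf cg]] := closed_op_ext comp kL2 covar_kernel f.
apply/eqP; rewrite eq_le nrm_ge0 andbT; apply/ler_addgt0Pr => e e_gt0; rewrite add0r.
have e2 : 0 < e / 2 by rewrite divr_gt0.
move/cvgrPdist_lt : cf => /(_ _ e2) [N1 _ h1]; move/cvgrPdist_lt : cg => /(_ _ e2) [N2 _ h2].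
pose m := maxn N1 N2.
have := h1 m (leq_maxl _ _); have := h2 m (leq_maxr _ _).
rewrite /= sub0r normrN ger0_norm ?nrm_ge0// => n2 n1.
have lk := lin_comb_L2 kL2 (tc m).
have lBm := lB (iota (lin_comb ind (c m))) Logic.I; have lWm := lW _ lk.
have E1 : nrm P (intB f - intB (iota (lin_comb ind (c m)))) = `|f - iota (lin_comb ind (c m))|.
  apply/eqP; rewrite -(@eqrXn2 _ 2)// ?nrm_ge0//; apply/eqP/EFin_inj.
  rewrite (wiener_sub wB Logic.I Logic.I Logic.I).
  by rewrite (dot_sqr comp).
have E2 : nrm P (intW (lin_comb k (c m)) - intW (K f)) = nrm mu (lin_comb k (c m) - K f).
  apply/eqP; rewrite -(@eqrXn2 _ 2)// ?nrm_ge0//; apply/eqP/EFin_inj.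
  rewrite (wiener_sub wW lk lK); last exact: Lfun2B.
  by rewrite /L2_dot nrm_sqr ipE//; exact: Lfun2B.
have E3 : nrm P (intB (iota (lin_comb ind (c m))) - intW (lin_comb k (c m))) = 0.
  by apply: eq_nrm => //; exact: wiener_lin_comb.
apply: (le_trans (ler_nrm_dist lBf lBm lWf)).
have := ler_nrm_dist lBm lWm lWf; rewrite E1 E2 E3; lra.
Qed.

End WienerIntegral.

(** * Integration on an interval *)

Section LebesgueInterval.
Context {R : realType}.
Local Notation leb := (@lebesgue_measure R).
Local Notation rT := (measurableTypeR R).

Lemma lebTE (T : R) A : lebT T A = leb (A `&` `[0, T]).
Proof. by []. Qed.

Lemma lebT_fin (T : R) : fin_num_fun (lebT T).
Proof.
move=> A mA; rewrite ge0_fin_numE//.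
apply: (@le_lt_trans _ _ (leb `[0, T])).
  rewrite lebTE; apply: le_measure; rewrite ?inE//.
  exact: measurableI.
by rewrite lebesgue_measure_itv/=; case: ifP => //; rewrite -EFinD ltry.
Qed.

(** The measure [lebT T] repackaged as a finite measure, the structure under which Tonelli and
    Fubini apply. *)
Definition lebTf (T : R) : {finite_measure set rT -> \bar R} :=
  HB.pack_for (FiniteMeasure.type rT R) (mrestr leb (measurable_itv `[0, T]))
    (@Measure_isFinite.Build _ rT R (mrestr leb (measurable_itv `[0, T])) (@lebT_fin T)).

Lemma ge0_lebT_integral (T : R) (f : rT -> \bar R) : measurable_fun setT f ->
  (forall x, 0 <= f x)%E ->
  (\int[lebT T]_x f x = \int[leb]_(x in `[0%R, T]) f x)%E.
Proof.
move=> mf f0.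
transitivity (\int[lebT T]_(x in `[0%R, T]) f x)%E; last first.
  by apply: eq_measure_integral => A mA AT; rewrite lebTE (setIidl AT).
have mD : measurable (~` `[0, T] : set rT) by exact: measurableC.
rewrite (@ge0_negligible_integral _ _ _ (lebT T) setT (~` `[0, T]))//; last first.
  by rewrite lebTE setICl measure0.
by rewrite setTD setCK.
Qed.

Lemma lebT_integral (T : R) (f : rT -> \bar R) : measurable_fun setT f ->
  (\int[lebT T]_x f x = \int[leb]_(x in `[0%R, T]) f x)%E.
Proof.
move=> mf; rewrite integralE [RHS]integralE !ge0_lebT_integral//.
- exact: measurable_funeneg.
- exact: measurable_funepos.
Qed.

Lemma lebT_integral_supp (T : R) (f : rT -> \bar R) : measurable_fun setT f ->
  (forall x, ~~ (0 <= x <= T) -> f x = 0%E) ->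
  (\int[lebT T]_x f x = \int[leb]_x f x)%E.
Proof.
move=> mf f0; rewrite lebT_integral// integral_mkcond; apply: eq_integral => x _.
rewrite patchE; case: ifPn => //; rewrite notin_setE /= in_itv/= => /negP h.
by rewrite f0.
Qed.

(** The image of Lebesgue measure under x |-> c x + b, scaled by c, agrees with Lebesgue measure on
    half-open intervals, hence everywhere by uniqueness. *)
Lemma ge0_integral_affine (c b : R) (f : rT -> \bar R) : 0 < c ->
  measurable_fun setT f -> (forall x, 0 <= f x)%E ->
  (\int[leb]_x f x = c%:E * \int[leb]_x f (c * x + b)%R)%E.
Proof.
move=> c0 mf f0.
pose phi : rT -> rT := fun x => c * x + b.
have mphi : measurable_fun setT phi.
  by apply: measurable_funD => //; apply: measurable_funM.
pose nu0 := [the measure _ _ of pushforward leb phi].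
pose nu := nu0 mphi.
have leE (A : set rT) : measurable A -> leb A = mscale (NngNum (ltW c0)) nu A.
  apply: lebesgue_measure_unique => _ [[p q] _ <-].
  transitivity (c%:E * leb (phi @^-1` `]p, q]%classic))%E; last by [].
  have -> : phi @^-1` `]p, q] = `](p - b) / c, (q - b) / c]%classic.
    apply/seteqP; split=> x /=; rewrite !in_itv/= ltr_pdivrMr// ler_pdivlMr// mulrC;
      by rewrite ltrBlDr lerBrDr.
  rewrite !lebesgue_measure_itv/= !lte_fin ltr_pM2r ?invr_gt0// ltrD2r.
  case: ifP => pq; last by rewrite mule0.
  by rewrite -!EFinB -EFinM; congr EFin; field; rewrite gt_eqF.
transitivity (\int[mscale (NngNum (ltW c0)) nu]_x f x)%E.
  by apply: eq_measure_integral => A mA _; exact: leE.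
rewrite ge0_integral_mscale//=; congr (_ * _)%E.
by rewrite ge0_integral_pushforward.
Qed.

(** The bound does not depend on e, so monotone convergence can let e tend to 0 in
    [integral_powR_lty]. *)
Lemma integral_powR_le (p e T : R) : p < 1 -> 0 < e -> e < T ->
  (\int[leb]_(x in `[e, T]) (x `^ (- p))%:E <= (T `^ (1 - p) / (1 - p))%:E)%E.
Proof.
move=> p1 e0 eT.
have q0 : 0 < 1 - p by rewrite subr_gt0.
pose F x : R := x `^ (1 - p) / (1 - p).
have dF (x : R) : 0 < x -> is_derive x 1 F (x `^ (- p)).
  move=> x0; rewrite /F.
  have h : is_derive x 1 (@powR R ^~ (1 - p)) ((1 - p) * x `^ (1 - p - 1)) by exact: is_derive1_powR.
  have := is_deriveM h (is_derive_cst ((1 - p)^-1) x 1).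
  rewrite scaler0 add0r; congr (is_derive _ _ _ _).
  rewrite /GRing.scale /= mulrA mulVf ?gt_eqF// mul1r; congr (_ `^ _); ring.
have cF (x : R) : 0 < x -> {for x, continuous F}.
  by move=> x0; apply: differentiable_continuous; apply/derivable1_diffP; case: (dF _ x0).
rewrite (@continuous_FTC2 _ _ F)//.
- rewrite -EFinB lee_fin /F gerBl; apply: divr_ge0; [exact: powR_ge0|exact: ltW].
- apply/subspace_continuousP => x /=; rewrite in_itv/= => /andP[ex _].
  have x0 : 0 < x by apply: lt_le_trans ex.
  have : {for x, continuous (@powR R ^~ (- p) : R -> R)}.
    apply: differentiable_continuous; apply/derivable1_diffP.
    by apply: derivable_powR; rewrite in_itv/= x0.
  by apply: cvg_within_filter.
- split.
  + by move=> x; rewrite in_itv/= => /andP[ex _]; case: (dF x (lt_trans e0 ex)).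
  + by apply: cvg_at_right_filter; exact: cF.
  + by apply: cvg_at_left_filter; apply: cF; exact: lt_trans eT.
- move=> x; rewrite in_itv/= => /andP[ex _].
  by rewrite derive1E; have [_ ->] := dF x (lt_trans e0 ex).
Qed.

Lemma integral_powR_lty (p T : R) : p < 1 ->
  (\int[leb]_x (if 0 < x <= T then x `^ (- p) else 0)%:E < +oo)%E.
Proof.
move=> p1.
pose F (i : nat) := `[i.+1%:R^-1, T]%classic : set rT.
have -> : (\int[leb]_x (if 0 < x <= T then x `^ (- p) else 0)%:E =
  \int[leb]_(x in \bigcup_i F i) (x `^ (- p))%:E)%E.
  rewrite [RHS]integral_mkcond; apply: eq_integral => x _; rewrite patchE.
  case: ifPn => [/andP[x0 xT]|xN]; case: ifPn => //.
  - rewrite notin_setE => -[]; exists (Num.truncn x^-1) => //=.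
    rewrite /F /= in_itv/= xT andbT invf_ple ?posrE//.
    exact/ltW/Num.Theory.truncnS_gt.
  - rewrite inE => -[i _]; rewrite /F /= in_itv/= => /andP[ix xT].
    by rewrite xT andbT (lt_le_trans _ ix) ?invr_gt0// in xN.
have mp (D : set rT) : measurable_fun D (fun x : rT => (x `^ (- p))%:E).
  by apply/measurable_EFinP; apply: measurable_funTS; exact: measurable_powR.
have p0 (x : rT) : (0 <= (x `^ (- p))%:E :> \bar R)%E by rewrite lee_fin powR_ge0.
have ndF : nondecreasing_seq F.
  move=> i j ij; apply/subsetPset => x; rewrite /F /= !in_itv/= => /andP[ix ->].
  by rewrite andbT (le_trans _ ix)// lef_pV2 ?posrE// ler_nat ltnS.
have c := @ge0_nondecreasing_set_cvg_integral _ rT R F (fun x => (x `^ (- p))%:E)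
  leb ndF (fun i => measurable_itv _) (fun i => mp (F i)) (fun i x _ => p0 x).
apply: (@le_lt_trans _ _ (`|T `^ (1 - p) / (1 - p)|)%:E); last exact: ltry.
rewrite -(cvg_lim _ c)//; apply: lime_le; first by apply/cvg_ex; eexists; exact: c.
apply: nearW => i; have [iT|Ti] := ltP i.+1%:R^-1 T.
  by apply: le_trans (integral_powR_le p1 _ iT) _; rewrite ?invr_gt0// lee_fin ler_norm.
apply: (@le_trans _ _ 0%E); last by rewrite lee_fin.
rewrite [leLHS](_ : _ = 0%E)//; apply: integral_Sset1 (i.+1%:R^-1) _ => x.
by rewrite /F /= in_itv/= => /andP[h1 h2]; apply/eqP; rewrite eq_le h1 (le_trans h2 Ti).
Qed.

End LebesgueInterval.

(** * Functions with vanishing tail integrals *)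

Section TailIntegral.
Context {R : realType}.
Local Notation leb := (@lebesgue_measure R).
Local Notation rT := (measurableTypeR R).

Lemma ae_lebT (T : R) (P : R -> Prop) :
  {ae lebT T, forall x, P x} <-> {ae leb, forall x, 0 <= x <= T -> P x}.
Proof.
split=> [[N [mN N0 PN]]|[N [mN N0 PN]]].
  exists (N `&` `[0, T]); split; [exact: measurableI|by rewrite -lebTE|].
  move=> x /= /not_implyP[xT nP]; split; first exact: PN.
  by rewrite /= in_itv.
exists (N `|` ~` `[0, T]); split; first by apply: measurableU => //; exact: measurableC.
  rewrite lebTE setIUl setICl setU0; apply/eqP; rewrite eq_le measure_ge0 andbT -N0.
  by apply: le_measure; rewrite ?inE//; exact: measurableI.
move=> x /= nP; have [xT|xT] := boolP (0 <= x <= T).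
  by left; apply: PN => /= h; apply: nP; exact: h.
by right => /=; rewrite in_itv/=; exact/negP.
Qed.

(** The primitive G equals a constant c on [0, T] off a null set N, and by Lebesgue differentiation
    has derivative f almost everywhere on [0, T]. At a good interior point x with f x nonzero, the
    difference quotients are nonzero just to the right of x, so G differs from c on a whole
    interval, which would have to lie in N. *)
Lemma ae_eq_tail_integral0 (T : R) (f : R -> R) :
  (lebT T).-integrable setT (EFin \o f) ->
  {ae lebT T, forall s, (\int[lebT T]_t (if s < t then f t else 0)%:E = 0)%E} ->
  f = 0 %[ae lebT T].
Proof.
move=> fi tail0.
have mf : measurable_fun setT (f : rT -> R) by apply/measurable_EFinP; exact: measurable_int fi.
have fiT : leb.-integrable `[0, T] (EFin \o f).
  apply/integrableP; split; first by apply: measurable_funTS; exact/measurable_EFinP.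
  rewrite -ge0_lebT_integral//; first by case/integrableP : fi.
  by apply/measurable_EFinP; exact: measurableT_comp.
pose g := f \_ `[0, T].
have locg : locally_integrable setT g by apply: integrable_locally.
have gi : leb.-integrable setT (EFin \o g).
  by rewrite /g -restrict_EFin; apply/integrable_restrict => //=; rewrite setTI.
have giA (A : set rT) : measurable A -> leb.-integrable A (EFin \o g).
  by move=> mA; exact: integrableS gi.
pose G x := \int[leb]_(t in `]-oo, x]) g t.
pose c := \int[leb]_t g t.
have tailG x : (\int[lebT T]_t (if x < t then f t else 0)%:E = 0)%E -> G x = c.
  have -> : (\int[lebT T]_t (if (x < t)%R then f t else 0)%:E = \int[leb]_(t in `]x, +oo[) (g t)%:E)%E.
    rewrite lebT_integral; last first.
      by apply/measurable_EFinP; apply: measurable_fun_ifT => //; exact: measurable_fun_ltr.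
    rewrite integral_mkcond [RHS]integral_mkcond; apply: eq_integral => t _.
    rewrite /g !patchE !mem_setE/= !in_itv/= andbT.
    by case: ifP; case: ifP.
  move=> e; rewrite /c (_ : setT = `]-oo, x] `|` `]x, +oo[); last first.
    by rewrite -itv_bndbnd_setU// set_itvE.
  rewrite Rintegral_setU//.
  - by rewrite [X in _ + X](_ : _ = 0) ?addr0// /Rintegral e.
  - by apply: giA; exact: measurableU.
  - apply/disj_setPLR => t /=; rewrite !in_itv/= => tx; by rewrite andbT; apply/negP; rewrite -leNgt.
have {tail0} Gc : {ae leb, forall x, 0 <= x <= T -> G x = c}.
  by apply/ae_lebT; apply: ae_imp tail0 => x; exact: tailG.
have dG := @FTC1Ny R g (fun y => giA _ (measurable_itv _)) locg.
apply/ae_lebT.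
have ae1 (r : R) : {ae leb, forall x, x != r}.
  exists [set r]; split; [by []|exact: lebesgue_measure_set1|].
  by move=> x /= /negP/negPn/eqP.
move: (Gc) => [N [mN N0 GN]].
apply: ae_imp2 (ae_and dG (ae_and (ae1 0) (ae1 T))) Gc => x [[Dx dGx] [x0 xT]] Gx0 xI _.
have Gx := Gx0 xI.
have {x0 xT xI} [x0 xT] : 0 < x /\ x < T.
  by move/andP : xI => [h1 h2]; rewrite !lt_neqAle h1 h2 eq_sym x0 xT.
have gx : g x = f x by rewrite /g patchE mem_set//= in_itv/= !ltW.
apply/eqP/negPn/negP => fx0.
have cv : h^-1 *: (G (h *: 1 + x) - G x) @[h --> 0^'] --> f x.
  by have := Dx; rewrite /derivable; move/cvg_ex => [l hl]; rewrite -gx -dGx derive1E /derive (cvg_lim _ hl).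
move/cvgrPdist_lt : cv => /(_ `|f x|); rewrite normr_gt0 => /(_ fx0)[e /= e0 He].
pose m := Num.min e (T - x).
have m0 : 0 < m by rewrite lt_min e0 subr_gt0.
have sub : `]x, (x + m)%R[ `<=` N.
  move=> y /=; rewrite in_itv/= => /andP[xy yxm]; apply: GN => /=.
  have ye : y - x < e by rewrite ltrBlDl; apply: lt_le_trans yxm _; rewrite lerD2l ge_min lexx.
  have yT : y < T by rewrite (lt_le_trans yxm)// -lerBrDl ge_min lexx orbT.
  move=> /(_ _); rewrite (ltW (lt_trans x0 xy)) (ltW yT) => /(_ erefl) Gy.
  have := He (y - x); rewrite /ball_ /= sub0r normrN gtr0_norm ?subr_gt0// => /(_ ye).
  rewrite subr_eq0 (gt_eqF xy) => /(_ erefl).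
  have -> : (y - x) *: 1 = y - x by rewrite /GRing.scale /= mulr1.
  by rewrite subrK Gy Gx subrr scaler0 subr0 ltxx.
have : (leb `]x, (x + m)%R[ <= leb N)%E.
  by apply: le_measure => //; rewrite inE.
have -> : leb N = 0%E by exact: N0.
rewrite lebesgue_measure_itv/= lte_fin ltrDl m0.
by rewrite -EFinD lee_fin addrAC subrr add0r leNgt m0.
Qed.

End TailIntegral.

(** * Joint measurability of the kernels *)

Section KernelMeasurability.
Context {R : realType}.
Local Notation leb := (@lebesgue_measure R).
Local Notation rT := (measurableTypeR R).

Lemma measurable_integral_param d1 d2 (X : measurableType d1) (Y : measurableType d2)
    (m2 : {sigma_finite_measure set Y -> \bar R}) (F : X * Y -> R) :
  measurable_fun setT F -> measurable_fun setT (fun x => \int[m2]_y (F (x, y))%:E)%E.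
Proof.
move=> mF.
have mE : measurable_fun setT (EFin \o F) by exact/measurable_EFinP.
rewrite (_ : (fun x => _) = (fun x => \int[m2]_y ((EFin \o F)^\+)%E (x, y) -
   \int[m2]_y ((EFin \o F)^\-)%E (x, y))%E); last first.
  apply/funext => x; rewrite [LHS]integralE.
  by congr (_ - _)%E; apply: eq_integral => y _; rewrite !unlock.
apply: emeasurable_funB.
- apply: (measurable_fun_fubini_tonelli_F ((EFin \o F)^\+)%E) => //.
  exact: measurable_funepos.
- apply: (measurable_fun_fubini_tonelli_F ((EFin \o F)^\-)%E) => //.
  exact: measurable_funeneg.
Qed.

Lemma measurable_Rintegral_param d1 d2 (X : measurableType d1) (Y : measurableType d2)
    (m2 : {sigma_finite_measure set Y -> \bar R}) (F : X * Y -> R) :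
  measurable_fun setT F -> measurable_fun setT (fun x => \int[m2]_y F (x, y)).
Proof.
by move=> mF; apply: measurableT_comp => //; exact: measurable_integral_param.
Qed.

(** Form used throughout with a = h - 1/2: the power s^-a is factored out of both terms, and the
    range of integration becomes a cutoff in the integrand, so that the latter is jointly measurable
    in (t, s, z). *)
Lemma fbm_kernel1E (h t s : R) : 0 < s -> s < t ->
  fbm_kernel1 h t s = fbm_const h * s `^ (- (h - 1 / 2)) *
    (t `^ (h - 1 / 2) * (t - s) `^ (h - 1 / 2) -
     (h - 1 / 2) * \int[leb]_z (if s < z < t then z `^ (h - 1 / 2 - 1) * (z - s) `^ (h - 1 / 2) else 0)).
Proof.
move=> s0 st; rewrite /fbm_kernel1 s0 st /=.
have -> : \int[leb]_(z in `[s, t]) (z `^ (h - 3 / 2) * (z - s) `^ (h - 1 / 2)) =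
  \int[leb]_z (if s < z < t then z `^ (h - 1 / 2 - 1) * (z - s) `^ (h - 1 / 2) else 0).
  rewrite [RHS](_ : _ = \int[leb]_(z in `]s, t[) (z `^ (h - 3 / 2) * (z - s) `^ (h - 1 / 2))).
    rewrite /Rintegral; congr fine; apply: integral_itv_bndoo.
    apply/measurable_EFinP; apply: measurable_funTS; apply: measurable_funM; first exact: measurable_powR.
    by apply: (measurableT_comp (measurable_powR _)); exact: measurable_funB.
  rewrite [RHS]Rintegral_mkcond; apply: eq_Rintegral => z _.
  rewrite patchE mem_setE /= in_itv/=; case: ifP => // _; congr (_ `^ _ * _); lra.
have t0 := lt_trans s0 st.
rewrite powRM ?invr_ge0 ?ltW// -(powR_inv1 (ltW s0)) -powRrM mulN1r.
rewrite (_ : 1 / 2 - h = - (h - 1 / 2)); last by ring.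
by ring.
Qed.

Lemma measurable_fbm_kernel1 (h : R) :
  measurable_fun setT (fun p : rT * rT => fbm_kernel1 h p.1 p.2).
Proof.
have m1 : measurable_fun setT (fun p : rT * rT => p.1) by exact: measurable_fst.
have m2 : measurable_fun setT (fun p : rT * rT => p.2) by exact: measurable_snd.
have mp (a : R) (f : rT * rT -> rT) : measurable_fun setT f -> measurable_fun setT (fun p => f p `^ a).
  by move=> mf; exact: (measurableT_comp (measurable_powR a)).
pose a := h - 1 / 2.
pose F (q : (rT * rT) * rT) : R := if q.1.2 < q.2 < q.1.1 then
  q.2 `^ (a - 1) * (q.2 - q.1.2) `^ a else 0.
rewrite (_ : (fun p => _) = (fun p : rT * rT => if 0 < p.2 < p.1 then
    fbm_const h * p.2 `^ (- a) * (p.1 `^ a * (p.1 - p.2) `^ a - a * \int[leb]_z F (p, z))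
  else 0)); last first.
  apply/funext => p; case: ifPn => [/andP[? ?]|pN]; first by rewrite fbm_kernel1E.
  by rewrite /fbm_kernel1 (negbTE pN).
have mF : measurable_fun setT F.
  have n2 : measurable_fun setT (fun q : (rT * rT) * rT => q.2) by exact: measurable_snd.
  have n12 : measurable_fun setT (fun q : (rT * rT) * rT => q.1.2).
    exact: measurableT_comp m2 measurable_fst.
  have n11 : measurable_fun setT (fun q : (rT * rT) * rT => q.1.1).
    exact: measurableT_comp m1 measurable_fst.
  apply: measurable_fun_ifT => //.
    by apply: measurable_and; apply: measurable_fun_ltr.
  apply: measurable_funM; first by exact: (measurableT_comp (measurable_powR _)).
  by apply: (measurableT_comp (measurable_powR _)); exact: measurable_funB.
apply: measurable_fun_ifT => //.
  by apply: measurable_and; apply: measurable_fun_ltr.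
apply: measurable_funM; first by apply: measurable_funM => //; exact: mp.
apply: measurable_funB.
  by apply: measurable_funM; apply: mp => //; exact: measurable_funB.
apply: measurable_funM => //.
exact: measurable_Rintegral_param.
Qed.

Lemma fbm_kernelSE n (H t u : R) : (1 <= n)%N -> 0 < u -> u < t ->
  fbm_kernel n.+1 H t u = \int[leb]_(s in `[u, t]) fbm_kernel n (H - 1) s u.
Proof. by case: n => // n _ u0 ut /=; rewrite u0 ut. Qed.

Lemma fbm_kernel_out n (H t u : R) : ~~ (0 < u < t) -> fbm_kernel n H t u = 0.
Proof. by case: n => [|[|n]] //= /negbTE h; rewrite /fbm_kernel1 ?h. Qed.

Lemma measurable_fbm_kernel n (H : R) :
  measurable_fun setT (fun p : rT * rT => fbm_kernel n H p.1 p.2).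
Proof.
case: n => [|n]; first exact: measurable_cst.
elim: n H => [|n IH] H; first exact: measurable_fbm_kernel1.
have m1 : measurable_fun setT (fun p : rT * rT => p.1) by exact: measurable_fst.
have m2 : measurable_fun setT (fun p : rT * rT => p.2) by exact: measurable_snd.
pose F (q : (rT * rT) * rT) : R :=
  if q.1.2 <= q.2 <= q.1.1 then fbm_kernel n.+1 (H - 1) q.2 q.1.2 else 0.
rewrite (_ : (fun p => _) = (fun p : rT * rT => if 0 < p.2 < p.1 then
    \int[leb]_z F (p, z) else 0)); last first.
  apply/funext => p; case: ifPn => [/andP[? ?]|pN]; last by rewrite fbm_kernel_out.
  rewrite fbm_kernelSE// Rintegral_mkcond; apply: eq_Rintegral => z _.
  by rewrite patchE mem_setE /= in_itv/= /F.
apply: measurable_fun_ifT => //.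
  by apply: measurable_and; apply: measurable_fun_ltr.
apply: measurable_Rintegral_param.
have n2 : measurable_fun setT (fun q : (rT * rT) * rT => q.2) by exact: measurable_snd.
have n12 : measurable_fun setT (fun q : (rT * rT) * rT => q.1.2).
    exact: measurableT_comp m2 measurable_fst.
have n11 : measurable_fun setT (fun q : (rT * rT) * rT => q.1.1).
    exact: measurableT_comp m1 measurable_fst.
apply: measurable_fun_ifT => //.
  by apply: measurable_and; apply: measurable_fun_ler.
have mq : measurable_fun setT (fun q : (rT * rT) * rT => (q.2, q.1.2)).
  exact/measurable_fun_pairP.
exact: measurableT_comp (IH (H - 1)) mq.
Qed.

End KernelMeasurability.

(** * Bounds on the kernels *)

Section PowerBounds.
Context {R : realType}.
Local Notation leb := (@lebesgue_measure R).
Local Notation rT := (measurableTypeR R).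
Implicit Types x y z t u T p q r a : R.

Lemma ge0_integral_oppr (f : rT -> \bar R) :
  measurable_fun setT f -> (forall x, 0 <= f x)%E ->
  (\int[leb]_x f x = \int[leb]_x f (- x)%R)%E.
Proof.
move=> mf f0.
have mN : measurable_fun setT (-%R : rT -> rT) by [].
rewrite -[RHS](@ge0_integral_pushforward _ _ _ _ R (-%R : rT -> rT) mN leb setT)//.
by apply: eq_measure_integral => A mA _; exact/esym/lebesgue_measureN.
Qed.

Lemma normr_Rintegral_le d (X : measurableType d) (m : {measure set X -> \bar R})
    (D : set X) (f : X -> R) (c : R) : measurable D -> measurable_fun D f ->
  (\int[m]_(x in D) `|f x|%:E <= c%:E)%E -> `|\int[m]_(x in D) f x| <= c.
Proof.
move=> mD mf fc; have fi : m.-integrable D (EFin \o f).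
  apply/integrableP; split; first exact/measurable_EFinP.
  exact: le_lt_trans fc (ltry _).
rewrite -lee_fin EFin_normr_Rintegral//; apply: le_trans fc.
by apply: le_abse_integral => //; exact/measurable_EFinP.
Qed.

Lemma ler_powR_base r x y : 0 <= r -> 0 <= x -> x <= y -> x `^ r <= y `^ r.
Proof.
move=> r0 x0 xy; apply: ge0_ler_powR => //; rewrite nnegrE//.
exact: le_trans xy.
Qed.

Lemma ler_powRN_base r x y : 0 <= r -> 0 < x -> x <= y -> y `^ (- r) <= x `^ (- r).
Proof.
move=> r0 x0 xy; have y0 := lt_le_trans x0 xy.
by rewrite !powRN lef_pV2 ?posrE ?powR_gt0//; apply: ler_powR_base => //; exact: ltW.
Qed.

Lemma powRD_gt0 x r s : 0 < x -> x `^ (r + s) = x `^ r * x `^ s.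
Proof. by move=> x0; rewrite powRD// (gt_eqF x0) implybT. Qed.

Lemma ler_powRN_exp p q x T : 0 < x -> x <= T -> p <= q ->
  x `^ (- p) <= T `^ (q - p) * x `^ (- q).
Proof.
move=> x0 xT pq; have -> : x `^ (- p) = x `^ ((q - p) + - q) by congr (_ `^ _); ring.
rewrite powRD_gt0// ler_wpM2r ?powR_ge0//; apply: ler_powR_base => //.
  by rewrite subr_ge0.
exact: ltW.
Qed.

(** Explicit for p < 1, but only its finiteness and its sign matter; it is the constant in all
    bounds below. *)
Definition moment p T : R := \int[leb]_x (if 0 < x <= T then x `^ (- p) else 0).

Lemma measurable_moment p T :
  measurable_fun setT (fun x : rT => (if 0 < x <= T then x `^ (- p) else 0)%:E).
Proof.
apply/measurable_EFinP; apply: measurable_fun_ifT => //.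
  by apply: measurable_and; [exact: measurable_fun_ltr|exact: measurable_fun_ler].
Qed.

Lemma momentE p T : p < 1 ->
  (\int[leb]_x (if (0 < x <= T)%R then x `^ (- p) else 0)%:E = (moment p T)%:E)%E.
Proof.
move=> p1; rewrite fineK// ge0_fin_numE; first exact: integral_powR_lty.
by apply: integral_ge0 => x _; rewrite lee_fin; case: ifP => // _; exact: powR_ge0.
Qed.

Lemma moment_ge0 p T : 0 <= moment p T.
Proof. by apply: Rintegral_ge0 => x _; case: ifP => // _; exact: powR_ge0. Qed.

Lemma integral_powR_shift p u t T : p < 1 -> 0 <= u -> t <= T ->
  (\int[leb]_x (if (u < x <= t)%R then (x - u) `^ (- p) else 0)%:E <= (moment p T)%:E)%E.
Proof.
move=> p1 u0 tT; rewrite -momentE//.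
have m0 x : (0 <= (if 0 < x <= T then x `^ (- p) else 0)%:E)%E.
  by rewrite lee_fin; case: ifP => // _; exact: powR_ge0.
rewrite [leRHS](ge0_integral_affine (- u) ltr01 (measurable_moment p T) m0) mul1e.
apply: ge0_le_integral => //.
- by move=> x _; rewrite lee_fin; case: ifP => // _; exact: powR_ge0.
- apply/measurable_EFinP; apply: measurable_fun_ifT => //.
    by apply: measurable_and; [exact: measurable_fun_ltr|exact: measurable_fun_ler].
  by apply: (measurableT_comp (measurable_powR _)); exact: measurable_funB.
- apply: (measurableT_comp (measurable_moment p T)) => /=.
  by apply: measurable_funD => //; apply: measurable_funM.
- move=> x _; rewrite lee_fin mul1r subr_gt0.
  case: ifPn => [/andP[ux xt]|_]; last by case: ifP => // _; exact: powR_ge0.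
  by rewrite ux /= lerBlDr (le_trans (le_trans xt tT))// lerDl.
Qed.

Lemma integral_powR_refl p t T : p < 1 -> t <= T ->
  (\int[leb]_x (if (0 < x < t)%R then (t - x) `^ (- p) else 0)%:E <= (moment p T)%:E)%E.
Proof.
move=> p1 tT; rewrite -momentE//.
have m0 x : (0 <= (if 0 < x <= T then x `^ (- p) else 0)%:E)%E.
  by rewrite lee_fin; case: ifP => // _; exact: powR_ge0.
rewrite [leRHS](ge0_integral_affine t ltr01 (measurable_moment p T) m0).
rewrite mul1e [leRHS]ge0_integral_oppr//; last first.
  apply: (measurableT_comp (measurable_moment p T)) => /=.
  by apply: measurable_funD => //; apply: measurable_funM.
apply: ge0_le_integral => //.
- by move=> x _; rewrite lee_fin; case: ifP => // _; exact: powR_ge0.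
- apply/measurable_EFinP; apply: measurable_fun_ifT => //.
    by apply: measurable_and; exact: measurable_fun_ltr.
  by apply: (measurableT_comp (measurable_powR _)); exact: measurable_funB.
- apply: (measurableT_comp (measurable_moment p T)) => /=.
  by apply: measurable_funD => //; apply: measurable_funM => //; exact: measurable_oppr.
- move=> x _; rewrite lee_fin mul1r (addrC (- x)) subr_gt0.
  case: ifPn => [/andP[ux xt]|_]; last by case: ifP => // _; exact: powR_ge0.
  by rewrite xt /= lerBlDr (le_trans tT)// lerDl ltW.
Qed.

(* With theta strictly between |a| and 1/2, z^-1 is split as
   u^-(theta - |a|) (z - u)^-(1 - theta + |a|) or u^-theta (z - u)^-(1 - theta). *)
Lemma kernel1_integrand_le a theta T u z : `|a| < theta -> theta < 1 / 2 -> 0 < T ->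
  0 < u -> u < z -> z <= T ->
  z `^ (a - 1) * (z - u) `^ a <=
  (1 + T `^ (`|a| + `|a|)) * u `^ (a - theta) * (z - u) `^ (- (1 - theta + `|a|)).
Proof.
move=> ath th2 T0 u0 uz zT; have z0 := lt_trans u0 uz.
have zu0 : 0 < z - u by rewrite subr_gt0.
have zuz : z - u <= z by rewrite gerBl ltW.
have zuT : z - u <= T := le_trans zuz zT.
have TT : 0 <= T `^ (`|a| + `|a|) by exact: powR_ge0.
have [a0|a0] := leP 0 a.
  have aE : `|a| = a by rewrite ger0_norm.
  rewrite aE in ath TT *.
  have e1 : z `^ (a - 1) = z `^ a * (z `^ (- (theta - a)) * z `^ (- (1 - theta + a))).
    by rewrite -!powRD_gt0//; congr (_ `^ _); ring.
  have b1 : z `^ a * (z - u) `^ a <= T `^ (a + a).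
    by rewrite powRD_gt0// ler_pM ?powR_ge0//; apply: ler_powR_base => //; exact: ltW.
  have b2 : z `^ (- (theta - a)) <= u `^ (a - theta).
    by rewrite -(opprB theta a); apply: ler_powRN_base; [rewrite subr_ge0 ltW|by []|exact: ltW].
  have b3 : z `^ (- (1 - theta + a)) <= (z - u) `^ (- (1 - theta + a)).
    by apply: ler_powRN_base => //; lra.
  have -> : z `^ (a - 1) * (z - u) `^ a =
    (z `^ a * (z - u) `^ a) * (z `^ (- (theta - a)) * z `^ (- (1 - theta + a))).
    by rewrite e1; ring.
  apply: (@le_trans _ _ (T `^ (a + a) * (u `^ (a - theta) * (z - u) `^ (- (1 - theta + a))))).
    apply: ler_pM => //; rewrite ?mulr_ge0 ?powR_ge0//.
    by apply: ler_pM => //; exact: powR_ge0.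
  by rewrite -mulrA ler_wpM2r ?mulr_ge0 ?powR_ge0// lerDr.
have aE : `|a| = - a by rewrite ltr0_norm.
rewrite aE in ath TT *.
have e1 : z `^ (a - 1) = z `^ (- - a) * (z `^ (- theta) * z `^ (- (1 - theta))).
  by rewrite -!powRD_gt0//; congr (_ `^ _); ring.
have b1 : z `^ (- - a) <= u `^ a.
  by rewrite -{2}(opprK a); apply: ler_powRN_base => //; [lra|exact: ltW].
have b2 : z `^ (- theta) <= u `^ (- theta).
  by apply: ler_powRN_base => //; [lra|exact: ltW].
have b3 : z `^ (- (1 - theta)) * (z - u) `^ a <= (z - u) `^ (- (1 - theta + - a)).
  have -> : - (1 - theta + - a) = - (1 - theta) + a by ring.
  rewrite powRD_gt0// ler_wpM2r ?powR_ge0//; apply: ler_powRN_base => //; lra.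
have -> : z `^ (a - 1) * (z - u) `^ a =
   z `^ (- - a) * z `^ (- theta) * (z `^ (- (1 - theta)) * (z - u) `^ a) by rewrite e1; ring.
rewrite ler_pM ?mulr_ge0 ?powR_ge0// powRD_gt0//.
have : z `^ (- - a) * z `^ (- theta) <= u `^ a * u `^ (- theta) by rewrite ler_pM ?powR_ge0.
move/le_trans; apply; rewrite ler_peMl ?mulr_ge0 ?powR_ge0//.
by rewrite lerDl.
Qed.

(** Only one factor is singular for each sign of a. For a >= 0 it is u^-a, dominated by u^-theta up
    to a power of T. For a < 0 it is (t - u)^a, while u^-a t^a <= 1 because u < t. *)
Lemma kernel1_main_le a theta T u t : `|a| < theta -> 0 < u -> u < t -> t <= T ->
  u `^ (- a) * (t `^ a * (t - u) `^ a) <=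
  (T `^ (a + a) * T `^ (theta - a) + T `^ (theta + a)) * (u `^ (- theta) + (t - u) `^ (- theta)).
Proof.
move=> ath u0 ut tT; have t0 := lt_trans u0 ut.
have tu0 : 0 < t - u by rewrite subr_gt0.
have tuT : t - u <= T by apply: le_trans tT; rewrite gerBl ltW.
have T0 : 0 < T by exact: lt_le_trans tT.
have [a0|a0] := leP 0 a.
  rewrite ger0_norm// in ath.
  have b1 : t `^ a * (t - u) `^ a <= T `^ (a + a).
    by rewrite powRD_gt0// ler_pM ?powR_ge0//; apply: ler_powR_base => //; exact: ltW.
  have b2 := ler_powRN_exp u0 (le_trans (ltW ut) tT) (ltW ath).
  have : u `^ (- a) * (t `^ a * (t - u) `^ a) <= (T `^ (theta - a) * u `^ (- theta)) * T `^ (a + a).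
    by rewrite ler_pM ?mulr_ge0 ?powR_ge0.
  move/le_trans; apply; rewrite mulrAC (mulrC (T `^ (theta - a))).
  by rewrite ler_pM ?mulr_ge0 ?powR_ge0// ?lerDl ?powR_ge0.
rewrite ltr0_norm// in ath.
have b1 : u `^ (- a) * t `^ a <= 1.
  have : t `^ (- - a) <= u `^ (- - a) by apply: ler_powRN_base; [lra|by []|exact: ltW].
  rewrite opprK powRN -(@ler_pM2l _ (u `^ a)^-1) ?invr_gt0 ?powR_gt0//.
  by rewrite mulVf// gt_eqF// powR_gt0.
have b2 : (t - u) `^ a <= T `^ (theta + a) * (t - u) `^ (- theta).
  have := ler_powRN_exp tu0 tuT (ltW ath); by rewrite !opprK.
rewrite mulrA (@le_trans _ _ (1 * (T `^ (theta + a) * (t - u) `^ (- theta))))//.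
  by rewrite ler_pM ?mulr_ge0 ?powR_ge0.
rewrite mul1r ler_pM ?mulr_ge0 ?powR_ge0//.
  by rewrite lerDr mulr_ge0 ?powR_ge0.
by rewrite lerDr powR_ge0.
Qed.

Lemma measurable_kernel1_integrand a u t : measurable_fun setT
  (fun z : rT => if u < z < t then z `^ (a - 1) * (z - u) `^ a else 0).
Proof.
apply: measurable_fun_ifT => //.
  by apply: measurable_and; exact: measurable_fun_ltr.
apply: measurable_funM; first exact: measurable_powR.
by apply: (measurableT_comp (measurable_powR _)); exact: measurable_funB.
Qed.

(** The exponent 1 - theta + |a| is below 1 exactly because |a| < theta, so the integral over z is
    finite uniformly in u and t. *)
Lemma kernel1_integral_le a theta T u t : `|a| < theta -> theta < 1 / 2 ->
  0 < u -> u < t -> t <= T ->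
  (\int[leb]_z (if (u < z < t)%R then z `^ (a - 1) * (z - u) `^ a else 0)%:E <=
   ((1 + T `^ (`|a| + `|a|)) * u `^ (a - theta) * moment (1 - theta + `|a|) T)%:E)%E.
Proof.
move=> ath th2 u0 ut tT; have T0 : 0 < T by apply: lt_le_trans tT; exact: lt_trans ut.
set M := _ * u `^ _.
have M0 : 0 <= M by rewrite mulr_ge0 ?addr_ge0 ?powR_ge0.
pose q := 1 - theta + `|a|.
have mq : measurable_fun setT (fun x : rT => if u < x <= t then (x - u) `^ (- q) else 0).
  apply: measurable_fun_ifT => //.
    by apply: measurable_and; [exact: measurable_fun_ltr|exact: measurable_fun_ler].
  by apply: (measurableT_comp (measurable_powR _)); exact: measurable_funB.
apply: (@le_trans _ _ (M%:E * \int[leb]_x (if (u < x <= t)%R then (x - u) `^ (- q) else 0)%:E)%E).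
  rewrite -ge0_integralZl_EFin//; last 2 first.
  - by move=> x _; rewrite lee_fin; case: ifP => // _; exact: powR_ge0.
  - exact/measurable_EFinP.
  apply: ge0_le_integral => //.
  - by move=> z _; rewrite lee_fin; case: ifP => // _; rewrite mulr_ge0 ?powR_ge0.
  - by apply/measurable_EFinP; exact: measurable_kernel1_integrand.
  - by apply/measurable_EFinP; exact: measurable_funM.
  - move=> z _; rewrite -EFinM lee_fin; case: ifPn => [/andP[uz zt]|_].
      rewrite uz (ltW zt)/=; apply: kernel1_integrand_le => //.
      exact: le_trans (ltW zt) tT.
    by case: ifP => _; rewrite mulr_ge0 ?powR_ge0.
rewrite [leRHS]EFinM; apply: lee_wpmul2l; first by rewrite lee_fin.
by apply: integral_powR_shift => //; [rewrite /q; lra|exact: ltW].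
Qed.

Lemma fbm_kernel1_bound (h T : R) : 0 < h < 1 -> 0 < T ->
  exists2 theta, 0 < theta < 1 / 2 & exists2 C, 0 <= C &
    forall u t, 0 < u -> u < t -> t <= T ->
    `|fbm_kernel1 h t u| <= C * (u `^ (- theta) + (t - u) `^ (- theta)).
Proof.
move=> h01 T0; pose a := h - 1 / 2.
have a2 : `|a| < 1 / 2 by rewrite /a ltr_norml; lra.
(* Midway between |a| and 1/2: above |a| to dominate the singularities of the kernel, below 1/2 to
   keep the square of the bound integrable. *)
pose theta := (`|a| + 1 / 2) / 2.
have ath : `|a| < theta by rewrite /theta; lra.
have th2 : theta < 1 / 2 by rewrite /theta; lra.
have th0 : 0 < theta by have := normr_ge0 a; lra.
exists theta; first by rewrite th0.
pose C1 := T `^ (a + a) * T `^ (theta - a) + T `^ (theta + a).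
pose C2 := (1 + T `^ (`|a| + `|a|)) * moment (1 - theta + `|a|) T.
have C10 : 0 <= C1 by rewrite addr_ge0 ?mulr_ge0 ?powR_ge0.
have C20 : 0 <= C2 by rewrite mulr_ge0 ?moment_ge0 ?addr_ge0 ?powR_ge0.
have d0 : 0 <= fbm_const h by exact: sqrtr_ge0.
exists (fbm_const h * (C1 + `|a| * C2)).
  by apply: mulr_ge0 => //; apply: addr_ge0 => //; exact: mulr_ge0.
move=> u t u0 ut tT; rewrite fbm_kernel1E// -/a.
set J := \int[leb]_z _.
have J0 : 0 <= J.
  by apply: Rintegral_ge0 => z _; case: ifP => // _; rewrite mulr_ge0 ?powR_ge0.
(* The prefactor u^-a cancels the u^a of [kernel1_integral_le], which leaves u^-theta. *)
have JC : u `^ (- a) * J <= C2 * u `^ (- theta).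
  have : J <= (1 + T `^ (`|a| + `|a|)) * u `^ (a - theta) * moment (1 - theta + `|a|) T.
    apply: le_trans (ler_norm _) _; apply: normr_Rintegral_le => //.
      exact: measurable_kernel1_integrand.
    under eq_integral => z _.
      rewrite ger0_norm; last by case: ifP => // _; rewrite mulr_ge0 ?powR_ge0.
      over.
    exact: kernel1_integral_le.
  rewrite -(@ler_pM2l _ (u `^ (- a))) ?powR_gt0// => /le_trans; apply.
  rewrite /C2 -subr_ge0 [X in 0 <= X](_ : _ = 0)//.
  by rewrite (powRD_gt0 a (- theta))// powRN; field; rewrite gt_eqF// powR_gt0.
have MC := kernel1_main_le ath u0 ut tT; rewrite -/C1 in MC.
rewrite -!mulrA normrM (ger0_norm d0) ler_wpM2l// mulrBr.
apply: le_trans (ler_normB _ _) _.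
rewrite (ger0_norm (_ : 0 <= _ * (_ * _)))  ?mulr_ge0 ?powR_ge0// [leRHS]mulrDl lerD//.
rewrite mulrCA normrM -mulrA ler_wpM2l// ger0_norm ?mulr_ge0 ?powR_ge0//.
by apply: le_trans JC _; rewrite ler_wpM2l// lerDl powR_ge0.
Qed.

End PowerBounds.

Section KernelBound.
Context {R : realType}.
Local Notation leb := (@lebesgue_measure R).
Local Notation rT := (measurableTypeR R).
Implicit Types (u t s T p H theta C D : R).

Lemma measurable_curry_l (k : R -> R -> R) u :
  measurable_fun setT (fun q : rT * rT => k q.1 q.2) ->
  measurable_fun setT (fun t : rT => k t u).
Proof.
move=> mk; have mp : measurable_fun setT (fun t : rT => (t, u) : rT * rT).
  by apply/measurable_fun_pairP; split => /=; [exact: measurable_id|exact: measurable_cst].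
exact: (measurableT_comp mk mp).
Qed.

Lemma measurable_curry_r (k : R -> R -> R) t :
  measurable_fun setT (fun q : rT * rT => k q.1 q.2) ->
  measurable_fun setT (fun u : rT => k t u).
Proof.
move=> mk; have mp : measurable_fun setT (fun u : rT => (t, u) : rT * rT).
  by apply/measurable_fun_pairP; split => /=; [exact: measurable_cst|exact: measurable_id].
exact: (measurableT_comp mk mp).
Qed.

Lemma measurable_powR_shift p u (f : rT -> bool) : measurable_fun setT f ->
  measurable_fun setT (fun s : rT => if f s then (s - u) `^ p else 0).
Proof.
move=> mf; apply: measurable_fun_ifT => //.
by apply: (measurableT_comp (measurable_powR _)); exact: measurable_funB.
Qed.

Lemma measurable_powR_refl p t (f : rT -> bool) : measurable_fun setT f ->
  measurable_fun setT (fun s : rT => if f s then (t - s) `^ p else 0).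
Proof.
move=> mf; apply: measurable_fun_ifT => //.
by apply: (measurableT_comp (measurable_powR _)); exact: measurable_funB.
Qed.

(** The exponent theta of order 1 serves every order: integrating the bound in s over [u, t] gives
    at most C (T u^-theta + [moment theta T]), with no new singularity. *)
Lemma fbm_kernel_bound n H T : (1 <= n)%N -> n%:R - 1 < H < n%:R -> 0 < T ->
  exists2 theta, 0 < theta < 1 / 2 & exists2 C, 0 <= C &
    forall u t, 0 < u -> u < t -> t <= T ->
    `|fbm_kernel n H t u| <= C * (u `^ (- theta) + (t - u) `^ (- theta)).
Proof.
case: n => // n _; elim: n H => [|n IH] H HH T0.
  by apply: fbm_kernel1_bound => //; rewrite subrr in HH.
have [|theta th [C C0 kC]] := IH (H - 1) _ T0.
  by move: HH; rewrite -[n.+2%:R]natr1; lra.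
exists theta => //; exists (C * (T + moment theta T * T `^ theta)).
  apply: mulr_ge0 => //; apply: addr_ge0; first exact: ltW.
  by apply: mulr_ge0; [exact: moment_ge0|exact: powR_ge0].
have th1 : theta < 1 by case/andP : th => _; lra.
move=> u t u0 ut tT; rewrite fbm_kernelSE//.
(* As u <= T, the constant [moment theta T] can be absorbed into a multiple of u^-theta. *)
have uTh : 1 <= T `^ theta * u `^ (- theta).
  rewrite powRN -ler_pdivrMr ?invr_gt0 ?powR_gt0// mul1r invrK.
  by apply: ler_powR_base; [case/andP : th => /ltW|exact: ltW|exact/ltW/(lt_le_trans ut)].
have mk : measurable_fun setT (fun s : rT => fbm_kernel n.+1 (H - 1) s u).
  by apply: (@measurable_curry_l (fbm_kernel n.+1 (H - 1))); exact: measurable_fbm_kernel.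
have ms : measurable_fun setT (fun s : rT => if u < s <= t then (s - u) `^ (- theta) else 0).
  apply: measurable_powR_shift.
  by apply: measurable_and; [exact: measurable_fun_ltr|exact: measurable_fun_ler].
have s0 s : 0 <= (if u < s <= t then (s - u) `^ (- theta) else 0) by case: ifP => // _; exact: powR_ge0.
apply: (@le_trans _ _ (C * (u `^ (- theta) * T + moment theta T))); last first.
  rewrite -mulrA ler_wpM2l//.
  have um := mulr_ge0 (powR_ge0 u (- theta)) (moment_ge0 theta T).
  have tu : 0 <= (t - u) `^ (- theta) by exact: powR_ge0.
  have h1 : moment theta T * 1 <= moment theta T * (T `^ theta * u `^ (- theta)).
    by rewrite ler_wpM2l ?moment_ge0.
  have h2 : 0 <= (T + moment theta T * T `^ theta) * (t - u) `^ (- theta).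
    by rewrite mulr_ge0 ?addr_ge0 ?mulr_ge0 ?moment_ge0 ?powR_ge0// ltW.
  have -> : (T + moment theta T * T `^ theta) * (u `^ (- theta) + (t - u) `^ (- theta)) =
    u `^ (- theta) * T + moment theta T * (T `^ theta * u `^ (- theta)) +
    (T + moment theta T * T `^ theta) * (t - u) `^ (- theta) by ring.
  by rewrite mulr1 in h1; lra.
apply: normr_Rintegral_le => //; first exact: measurable_funTS.
apply: (@le_trans _ _ (\int[leb]_(s in `[u, t]) ((C * u `^ (- theta))%:E +
    (C * (if (u < s <= t)%R then (s - u) `^ (- theta) else 0))%:E))%E).
  apply: ge0_le_integral => //.
  - by apply/measurable_EFinP/measurableT_comp => //; exact: measurable_funTS.
  - apply: emeasurable_funD; first exact: measurable_cst.
    by apply/measurable_EFinP; apply: measurable_funM => //; exact: measurable_funTS.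
  - move=> s sI; have /andP[us st] : u <= s <= t by move: sI; rewrite /= in_itv.
    rewrite -EFinD lee_fin st andbT; have [us'|us'] := boolP (u < s).
      by rewrite -mulrDr; apply: kC => //; exact: le_trans st tT.
    rewrite fbm_kernel_out ?normr0 ?mulr0 ?addr0 ?mulr_ge0 ?powR_ge0//.
    by rewrite (negbTE us') andbF.
rewrite ge0_integralD//; last 3 first.
- by move=> s _; rewrite lee_fin mulr_ge0 ?powR_ge0.
- by move=> s _; rewrite lee_fin mulr_ge0.
- by apply/measurable_EFinP; apply: measurable_funM => //; exact: measurable_funTS.
rewrite integral_cst//= lebesgue_measure_itv/= lte_fin ut -EFinD -EFinM.
rewrite [leRHS](_ : _ = ((C * (u `^ (- theta) * T))%:E + (C * moment theta T)%:E)%E);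
  last by rewrite -EFinD mulrDr.
apply: leeD.
  rewrite lee_fin -mulrA ler_wpM2l// ler_wpM2l ?powR_ge0//; lra.
apply: (@le_trans _ _ (\int[leb]_s (C * (if (u < s <= t)%R then (s - u) `^ (- theta) else 0))%:E)%E).
  apply: ge0_subset_integral => //.
  - by apply/measurable_EFinP; exact: measurable_funM.
  - by move=> s _; rewrite lee_fin mulr_ge0.
under eq_integral do rewrite EFinM.
rewrite ge0_integralZl_EFin//; last 2 first.
- by move=> s _; rewrite lee_fin.
- exact/measurable_EFinP.
rewrite [leRHS]EFinM; apply: lee_wpmul2l; first by rewrite lee_fin.
by apply: integral_powR_shift => //; exact: ltW.
Qed.

Lemma sqr_powR_le p x y : (x `^ (- p) + y `^ (- p)) ^+ 2 <= 2 * (x `^ (- (p * 2)) + y `^ (- (p * 2))).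
Proof.
have e z : z `^ (- (p * 2)) = (z `^ (- p)) ^+ 2 by rewrite -mulNr powRrM powR_mulrn ?powR_ge0.
rewrite !e; have := sqr_ge0 (x `^ (- p) - y `^ (- p)); nra.
Qed.

(** Common interface for the fractional kernels, where p is twice theta, and for the power kernels
    [primitive_kernel a], where p is -2 a. It bounds the square because only L^2 estimates of the
    sections are needed. *)
Definition sqr_kernel_bound (T : R) (k : R -> R -> R) p D :=
  [/\ measurable_fun setT (fun q : rT * rT => k q.1 q.2), p < 1, 0 <= D &
   forall u t, t <= T -> k t u ^+ 2 <= (if 0 < u < t then D * (u `^ (- p) + (t - u) `^ (- p)) else 0)].

Lemma fbm_sqr_kernel_bound n H T : (1 <= n)%N -> n%:R - 1 < H < n%:R -> 0 < T ->
  exists p, exists D, sqr_kernel_bound T (fbm_kernel n H) p D.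
Proof.
move=> n1 nH T0; have [theta th [C C0 kC]] := fbm_kernel_bound n1 nH T0.
exists (theta * 2), (C ^+ 2 * 2); split.
- exact: measurable_fbm_kernel.
- by case/andP: th => _; lra.
- by rewrite mulr_ge0// sqr_ge0.
- move=> u t tT; case: ifPn => [/andP[u0 ut]|ut]; last by rewrite fbm_kernel_out// expr0n.
  have := kC u t u0 ut tT; rewrite -(@ler_pXn2r _ 2)// ?nnegrE//; last first.
    by rewrite mulr_ge0// addr_ge0// powR_ge0.
  rewrite real_normK ?num_real// => /le_trans; apply.
  by rewrite exprMn -[leRHS]mulrA ler_wpM2l ?sqr_ge0//; exact: sqr_powR_le.
Qed.

End KernelBound.

Lemma lebT_Fubini (R : realType) (T : R) (F : R -> R -> R) :
  measurable_fun setT (fun q : measurableTypeR R * measurableTypeR R => F q.1 q.2) ->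
  (\int[lebT T]_x \int[lebT T]_y `|F x y|%:E < +oo)%E ->
  (\int[lebT T]_x \int[lebT T]_y (F x y)%:E = \int[lebT T]_y \int[lebT T]_x (F x y)%:E)%E.
Proof.
move=> mF Flt; pose rT := measurableTypeR R.
have mE : measurable_fun setT (fun q : rT * rT => (F q.1 q.2)%:E) by exact/measurable_EFinP.
apply: (@Fubini _ _ rT rT R (lebTf T) (lebTf T) (fun q => (F q.1 q.2)%:E)).
exact/(@integrable12ltyP _ _ rT rT R (lebTf T) (lebTf T) _ mE).
Qed.

Lemma measurable_lebT_integral (R : realType) (T : R) (F : R -> R -> \bar R) :
  measurable_fun setT (fun q : measurableTypeR R * measurableTypeR R => F q.1 q.2) ->
  (forall x y, 0 <= F x y)%E ->
  measurable_fun setT (fun x : measurableTypeR R => \int[lebT T]_y F x y)%E.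
Proof.
move=> mF F0; pose rT := measurableTypeR R.
by apply: (@measurable_fun_fubini_tonelli_F _ _ rT rT R (lebTf T) (fun q => F q.1 q.2)).
Qed.

(** * Volterra operators with square integrable kernels *)

Section VolterraOperator.
Context {R : realType} (T : R) (k : R -> R -> R) (p D : R).
Local Notation leb := (@lebesgue_measure R).
Local Notation rT := (measurableTypeR R).
Local Notation mu := (lebT T).
Hypothesis T0 : 0 < T.
Hypothesis kb : sqr_kernel_bound T k p D.

Let mk : measurable_fun setT (fun q : rT * rT => k q.1 q.2). Proof. by case: kb. Qed.
Let p1 : p < 1. Proof. by case: kb. Qed.
Let D0 : 0 <= D. Proof. by case: kb. Qed.
Let kle u t : t <= T ->
  k t u ^+ 2 <= (if 0 < u < t then D * (u `^ (- p) + (t - u) `^ (- p)) else 0).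
Proof. by case: kb => _ _ _; exact. Qed.
Let mkl u : measurable_fun setT (fun t : rT => k t u). Proof. exact: measurable_curry_l. Qed.
Let mkr t : measurable_fun setT (fun u : rT => k t u). Proof. exact: measurable_curry_r. Qed.

Lemma lebT_setT : mu setT = T%:E.
Proof. by rewrite lebTE setTI lebesgue_measure_itv/= lte_fin T0 -EFinD subr0. Qed.

Lemma lebT_moment : (\int[mu]_u (if (0 < u)%R then u `^ (- p) else 0)%:E = (moment p T)%:E)%E.
Proof.
rewrite lebT_integral; last first.
  apply/measurable_EFinP; apply: measurable_fun_ifT => //; exact: measurable_fun_ltr.
rewrite -momentE// integral_mkcond; apply: eq_integral => x _.
rewrite patchE mem_setE /= in_itv/=.
by case: (ltP 0 x) => x0; case: (leP x T) => xT; rewrite ?(ltW x0)//=; case: ifP.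
Qed.

Lemma ge0_lebT_le (f : rT -> \bar R) : measurable_fun setT f -> (forall x, 0 <= f x)%E ->
  (\int[mu]_x f x <= \int[leb]_x f x)%E.
Proof.
move=> mf f0; rewrite ge0_lebT_integral//.
by apply: ge0_subset_integral => //; exact: measurable_funTS.
Qed.

Lemma kernel_row_integral_le t : t <= T ->
  (\int[mu]_u (k t u ^+ 2)%:E <= (D * (moment p T + moment p T))%:E)%E.
Proof.
move=> tT.
have m1 : measurable_fun setT (fun u : rT => if 0 < u < t then u `^ (- p) else 0).
  apply: measurable_fun_ifT => //.
  by apply: measurable_and; exact: measurable_fun_ltr.
have m2 : measurable_fun setT (fun u : rT => if 0 < u < t then (t - u) `^ (- p) else 0).
  by apply: measurable_powR_refl; apply: measurable_and; exact: measurable_fun_ltr.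
have g1 u : 0 <= (if 0 < u < t then u `^ (- p) else 0) by case: ifP => // _; exact: powR_ge0.
have g2 u : 0 <= (if 0 < u < t then (t - u) `^ (- p) else 0) by case: ifP => // _; exact: powR_ge0.
apply: (@le_trans _ _ (\int[leb]_u (D%:E * ((if (0 < u < t)%R then u `^ (- p) else 0)%:E +
   (if (0 < u < t)%R then (t - u) `^ (- p) else 0)%:E)))%E).
  apply: le_trans (ge0_lebT_le _ _) _ => //.
  - by apply/measurable_EFinP; apply: measurable_funX; exact: mkr.
  - by move=> u; rewrite lee_fin sqr_ge0.
  apply: ge0_le_integral => //.
  - by move=> u _; rewrite lee_fin sqr_ge0.
  - by apply/measurable_EFinP; apply: measurable_funX; exact: mkr.
  - by apply: measurable_funeM; apply: emeasurable_funD; exact/measurable_EFinP.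
  - move=> u _; rewrite -EFinD -EFinM lee_fin; apply: le_trans (kle u tT) _.
    by case: ifP => // _; rewrite addr0 mulr0.
rewrite ge0_integralZl_EFin//; last 2 first.
- by move=> u _; rewrite adde_ge0// lee_fin.
- by apply: emeasurable_funD; exact/measurable_EFinP.
rewrite ge0_integralD//; last 4 first.
- by move=> u _; rewrite lee_fin.
- exact/measurable_EFinP.
- by move=> u _; rewrite lee_fin.
- exact/measurable_EFinP.
rewrite [leRHS]EFinM EFinD; apply: lee_wpmul2l; first by rewrite lee_fin.
apply: leeD; last exact: integral_powR_refl.
rewrite -momentE//; apply: ge0_le_integral => //.
- by move=> u _; rewrite lee_fin.
- exact/measurable_EFinP.
- exact: measurable_moment.
- move=> u _; rewrite lee_fin; case: ifPn => [/andP[u0 ut]|_].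
    by rewrite u0 (ltW (lt_le_trans ut tT)).
  by case: ifP => // _; exact: powR_ge0.
Qed.

Lemma kernel_L2_r t : t <= T -> L2 T (k t).
Proof.
move=> tT; apply/Lfun2P; split; first exact: mkr.
by apply: le_lt_trans (kernel_row_integral_le tT) _; exact: ltry.
Qed.

(** Rows are bounded in L^2 uniformly in t, but columns keep the singularity u^-p; this bound is
    still integrable in u since p < 1. *)
Definition kernel_col_bound u : R :=
  D * (T * (if 0 < u then u `^ (- p) else 0) + moment p T).

Lemma kernel_col_bound_ge0 u : 0 <= kernel_col_bound u.
Proof.
rewrite mulr_ge0// addr_ge0 ?moment_ge0// mulr_ge0 ?(ltW T0)//.
by case: ifP => // _; exact: powR_ge0.
Qed.

Lemma measurable_kernel_col_bound : measurable_fun setT (kernel_col_bound : rT -> R).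
Proof.
apply: measurable_funM => //; apply: measurable_funD => //; apply: measurable_funM => //.
by apply: measurable_fun_ifT => //; exact: measurable_fun_ltr.
Qed.

Lemma kernel_col_integral_le u :
  (\int[mu]_t (k t u ^+ 2)%:E <= (kernel_col_bound u)%:E)%E.
Proof.
rewrite ge0_lebT_integral; last 2 first.
- by apply/measurable_EFinP; apply: measurable_funX; exact: mkl.
- by move=> t; rewrite lee_fin sqr_ge0.
have [u0|u0] := leP u 0.
  apply: (@le_trans _ _ 0%E); last by rewrite lee_fin kernel_col_bound_ge0.
  rewrite integral0_eq// => t; rewrite /= in_itv/= => /andP[_ tT].
  have := kle u tT; rewrite ltNge u0 /= => h.
  by congr EFin; apply/eqP; rewrite eq_le h sqr_ge0.
have ms : measurable_fun setT (fun s : rT => if u < s <= T then (s - u) `^ (- p) else 0).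
  apply: measurable_powR_shift.
  by apply: measurable_and; [exact: measurable_fun_ltr|exact: measurable_fun_ler].
have s0 s : 0 <= (if u < s <= T then (s - u) `^ (- p) else 0) by case: ifP => // _; exact: powR_ge0.
apply: (@le_trans _ _ (\int[leb]_(t in `[0%R, T]) ((D * u `^ (- p))%:E +
    (D * (if (u < t <= T)%R then (t - u) `^ (- p) else 0))%:E))%E).
  apply: ge0_le_integral => //.
  - by move=> t _; rewrite lee_fin sqr_ge0.
  - by apply/measurable_EFinP; apply: measurable_funTS; apply: measurable_funX; exact: mkl.
  - apply: emeasurable_funD; first exact: measurable_cst.
    by apply/measurable_EFinP; apply: measurable_funM => //; exact: measurable_funTS.
  - move=> t; rewrite /= in_itv/= => /andP[_ tT].
    rewrite -EFinD lee_fin tT andbT; apply: le_trans (kle u tT) _.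
    rewrite u0 /=; case: ifPn => _; first by rewrite mulrDr.
    by rewrite mulr0 addr0 mulr_ge0// powR_ge0.
rewrite ge0_integralD//; last 3 first.
- by move=> s _; rewrite lee_fin mulr_ge0 ?powR_ge0.
- by move=> s _; rewrite lee_fin mulr_ge0.
- by apply/measurable_EFinP; apply: measurable_funM => //; exact: measurable_funTS.
rewrite integral_cst//= lebesgue_measure_itv/= lte_fin T0 -EFinD -EFinM subr0.
rewrite /kernel_col_bound u0 mulrDr EFinD; apply: leeD.
  by rewrite lee_fin mulrAC -mulrA.
apply: (@le_trans _ _ (\int[leb]_s (D * (if (u < s <= T)%R then (s - u) `^ (- p) else 0))%:E)%E).
  apply: ge0_subset_integral => //.
  - by apply/measurable_EFinP; exact: measurable_funM.
  - by move=> s _; rewrite lee_fin mulr_ge0.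
under eq_integral do rewrite EFinM.
rewrite ge0_integralZl_EFin//; last 2 first.
- by move=> s _; rewrite lee_fin.
- exact/measurable_EFinP.
rewrite [leRHS]EFinM; apply: lee_wpmul2l; first by rewrite lee_fin.
by apply: integral_powR_shift => //; exact: ltW.
Qed.

Lemma kernel_L2_l u : L2 T (k ^~ u).
Proof.
apply/Lfun2P; split; first exact: mkl.
by apply: le_lt_trans (kernel_col_integral_le u) _; exact: ltry.
Qed.

Lemma kernel_col_bound_integral :
  (\int[mu]_u (kernel_col_bound u)%:E = (D * (T * moment p T + T * moment p T))%:E)%E.
Proof.
have mi : measurable_fun setT (fun u : rT => if 0 < u then u `^ (- p) else 0).
  by apply: measurable_fun_ifT => //; exact: measurable_fun_ltr.
have i0 u : 0 <= (if 0 < u then u `^ (- p) else 0) by case: ifP => // _; exact: powR_ge0.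
rewrite /kernel_col_bound; under eq_integral do rewrite EFinM.
rewrite ge0_integralZl_EFin//; last 2 first.
- by move=> u _; rewrite lee_fin addr_ge0 ?moment_ge0// mulr_ge0// ltW.
- by apply/measurable_EFinP; apply: measurable_funD => //; exact: measurable_funM.
rewrite [RHS]EFinM; congr (_ * _)%E; under eq_integral do rewrite EFinD EFinM.
rewrite ge0_integralD//; last 3 first.
- by move=> u _; rewrite -EFinM lee_fin mulr_ge0// ltW.
- by apply: measurable_funeM; exact/measurable_EFinP.
- by move=> u _; rewrite lee_fin moment_ge0.
rewrite ge0_integralZl_EFin//; last 3 first.
- by move=> u _; rewrite lee_fin.
- exact/measurable_EFinP.
- exact: ltW.
have -> := lebT_moment.
rewrite (integral_cst mu measurableT (moment p T)%:E) EFinD !EFinM.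
by rewrite (_ : (mu setT = T%:E)%E) 1?muleC//; exact: lebT_setT.
Qed.

Definition volterra (f : R -> R) (u : R) : R := \int[mu]_t (f t * k t u).

Lemma measurable_volterra f : measurable_fun setT (f : rT -> R) ->
  measurable_fun setT (volterra f : rT -> R).
Proof.
move=> mf; apply: (@measurable_Rintegral_param _ _ _ rT rT (lebTf T) (fun q => f q.2 * k q.2 q.1)).
apply: measurable_funM; first by apply: (measurableT_comp mf); exact: measurable_snd.
have ms : measurable_fun setT (fun q : rT * rT => (q.2, q.1)).
  by apply/measurable_fun_pairP; split; [exact: measurable_snd|exact: measurable_fst].
exact: (measurableT_comp mk ms).
Qed.

Lemma volterra_sqr_le f u : L2 T f ->
  volterra f u ^+ 2 <= nrm mu f ^+ 2 * kernel_col_bound u.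
Proof.
move=> lf; have := cauchy_schwarz lf (kernel_L2_l u).
rewrite -[ip _ _ _]/(volterra f u) -(@ler_pXn2r _ 2)// ?nnegrE// ?mulr_ge0 ?nrm_ge0//.
rewrite real_normK ?num_real// exprMn => /le_trans; apply.
rewrite ler_wpM2l ?sqr_ge0// -lee_fin -Lfun2_sqr_integral; last exact: kernel_L2_l.
exact: kernel_col_integral_le.
Qed.

(** The square root of the integral of [kernel_col_bound], an upper bound for the Hilbert-Schmidt
    norm of the kernel. *)
Definition volterra_norm : R := Num.sqrt (D * (T * moment p T + T * moment p T)).

Lemma volterra_sqr_integral_le f : L2 T f ->
  (\int[mu]_u (volterra f u ^+ 2)%:E <= ((volterra_norm * nrm mu f) ^+ 2)%:E)%E.
Proof.
move=> lf; have mf := Lfun2_measurable lf.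
apply: (@le_trans _ _ (\int[mu]_u ((nrm mu f ^+ 2)%:E * (kernel_col_bound u)%:E))%E).
  apply: ge0_le_integral => //.
  - by move=> u _; rewrite lee_fin sqr_ge0.
  - by apply/measurable_EFinP; apply: measurable_funX; exact: measurable_volterra.
  - by apply: measurable_funeM; apply/measurable_EFinP; exact: measurable_kernel_col_bound.
  - by move=> u _; rewrite -EFinM lee_fin volterra_sqr_le.
rewrite ge0_integralZl_EFin//; last 3 first.
- by move=> u _; rewrite lee_fin kernel_col_bound_ge0.
- by apply/measurable_EFinP; exact: measurable_kernel_col_bound.
- exact: sqr_ge0.
rewrite kernel_col_bound_integral -EFinM lee_fin exprMn mulrC.
rewrite [volterra_norm ^+ 2]sqr_sqrtr//.
by rewrite mulr_ge0// addr_ge0// mulr_ge0 ?moment_ge0// ltW.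
Qed.

Lemma volterra_L2 f : L2 T f -> L2 T (volterra f).
Proof.
move=> lf; apply/Lfun2P; split.
  by apply: measurable_volterra; exact: Lfun2_measurable lf.
by apply: le_lt_trans (volterra_sqr_integral_le lf) _; exact: ltry.
Qed.

Lemma volterra_nrm_le f : L2 T f -> nrm mu (volterra f) <= volterra_norm * nrm mu f.
Proof.
move=> lf; rewrite -(@ler_pXn2r _ 2)// ?nnegrE ?nrm_ge0// ?mulr_ge0 ?nrm_ge0 ?sqrtr_ge0//.
rewrite -lee_fin -Lfun2_sqr_integral; last exact: volterra_L2.
exact: volterra_sqr_integral_le.
Qed.

Lemma volterraD a f g u : L2 T f -> L2 T g ->
  volterra (a *: f + g) u = a * volterra f u + volterra g u.
Proof.
move=> lf lg; have lk := kernel_L2_l u.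
have := ipDl (Lfun2Z a lf) lg lk; rewrite ipZl//; exact.
Qed.

(** Fubini for g(u) f(t) k(t, u). The absolute value is at most (g(u) f(t))^2 + k(t, u)^2, whose
    double integral is finite by the column bound. *)
Lemma volterra_adjoint f g : L2 T f -> L2 T g ->
  ip mu g (volterra f) = ip mu f (fun t => ip mu g (k t)).
Proof.
move=> lf lg; have mf := Lfun2_measurable lf; have mg := Lfun2_measurable lg.
pose F u t : R := g u * (f t * k t u).
have mF : measurable_fun setT (fun q : rT * rT => F q.1 q.2).
  apply: measurable_funM.
    by apply: (measurableT_comp mg); exact: measurable_fst.
  apply: measurable_funM; first by apply: (measurableT_comp mf); exact: measurable_snd.
  have ms : measurable_fun setT (fun q : rT * rT => (q.2, q.1)).
    by apply/measurable_fun_pairP; split; [exact: measurable_snd|exact: measurable_fst].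
  exact: (measurableT_comp mk ms).
have mf2 : measurable_fun setT (fun t : rT => (f t ^+ 2)%:E).
  by apply/measurable_EFinP; exact: measurable_funX.
have mg2 : measurable_fun setT (fun t : rT => (g t ^+ 2)%:E).
  by apply/measurable_EFinP; exact: measurable_funX.
have iF : (\int[mu]_u \int[mu]_t `|F u t|%:E < +oo)%E.
  apply: (@le_lt_trans _ _ (\int[mu]_u ((nrm mu f ^+ 2)%:E * (g u ^+ 2)%:E + (kernel_col_bound u)%:E))%E).
    apply: ge0_le_integral => //.
    - by move=> u _; apply: integral_ge0.
    - apply: (@measurable_lebT_integral R T (fun u t => `|F u t|%:E)) => //.
      by apply/measurable_EFinP; exact: measurableT_comp.
    - apply: emeasurable_funD; first exact: measurable_funeM.
      by apply/measurable_EFinP; exact: measurable_kernel_col_bound.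
    - move=> u _.
      apply: (@le_trans _ _ (\int[mu]_t ((g u ^+ 2)%:E * (f t ^+ 2)%:E + (k t u ^+ 2)%:E))%E).
        apply: ge0_le_integral => //.
        - apply/measurable_EFinP; apply: measurableT_comp => //.
          by apply: measurable_funM => //; apply: measurable_funM => //; exact: mkl.
        - apply: emeasurable_funD; first exact: measurable_funeM.
          by apply/measurable_EFinP; apply: measurable_funX; exact: mkl.
        - move=> t _; rewrite -EFinM -EFinD lee_fin /F mulrA -exprMn.
          rewrite normrM -(real_normK (num_real (g u * f t))) -(real_normK (num_real (k t u))).
          have := normr_ge0 (g u * f t); have := normr_ge0 (k t u).
          set x := `|_|; set y := `|_| => x0 y0.
          by have := sqr_ge0 (x - y); have := mulr_ge0 x0 y0; nra.
      rewrite ge0_integralD//; last 4 first.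
      - by move=> t _; rewrite -EFinM lee_fin mulr_ge0 ?sqr_ge0.
      - exact: measurable_funeM.
      - by move=> t _; rewrite lee_fin sqr_ge0.
      - by apply/measurable_EFinP; apply: measurable_funX; exact: mkl.
      apply: leeD; last exact: kernel_col_integral_le.
      rewrite ge0_integralZl_EFin ?sqr_ge0//; last by move=> t _; rewrite lee_fin sqr_ge0.
      by rewrite Lfun2_sqr_integral// muleC.
  rewrite ge0_integralD//; last 4 first.
  - by move=> t _; rewrite -EFinM lee_fin mulr_ge0 ?sqr_ge0.
  - exact: measurable_funeM.
  - by move=> t _; rewrite lee_fin kernel_col_bound_ge0.
  - by apply/measurable_EFinP; exact: measurable_kernel_col_bound.
  rewrite kernel_col_bound_integral lte_add_pinfty ?ltry//.
  rewrite ge0_integralZl_EFin ?sqr_ge0//; last by move=> t _; rewrite lee_fin sqr_ge0.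
  by rewrite Lfun2_sqr_integral// -EFinM ltry.
have := lebT_Fubini mF iF.
have -> : (\int[mu]_u \int[mu]_t (F u t)%:E = \int[mu]_u (g u * volterra f u)%:E)%E.
  apply: eq_integral => u _; rewrite /F; under eq_integral do rewrite EFinM.
  rewrite (@integralZl _ _ _ mu)//; last exact: (Lfun2_ipI lf (kernel_L2_l u)).
  by rewrite EFinM -(ipE lf (kernel_L2_l u)).
move=> /(congr1 fine) e; rewrite /ip /Rintegral e; congr fine.
apply: ae_eq_integral => //.
- apply: (@measurable_integral_param _ _ _ rT rT (lebTf T) (fun q => F q.2 q.1)).
  have ms : measurable_fun setT (fun q : rT * rT => (q.2, q.1)).
    by apply/measurable_fun_pairP; split; [exact: measurable_snd|exact: measurable_fst].
  exact: (measurableT_comp mF ms).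
- apply/measurable_EFinP; apply: measurable_funM => //.
  apply: (@measurable_Rintegral_param _ _ _ rT rT (lebTf T) (fun q => g q.2 * k q.1 q.2)).
  by apply: measurable_funM => //; apply: (measurableT_comp mg); exact: measurable_snd.
- apply/ae_lebT; apply: aeW => t /andP[_ tT] _; rewrite /F.
  have lk := kernel_L2_r tT.
  rewrite EFinM (ipE lg lk) -(@integralZl _ _ _ mu)//; last exact: (Lfun2_ipI lg lk).
  by apply: eq_integral => u _; rewrite -EFinM mulrCA.
Qed.

Lemma kernel_ip_L2 g : L2 T g -> L2 T (fun t => ip mu g (k t)).
Proof.
move=> lg; have mg := Lfun2_measurable lg; apply/Lfun2P.
have mphi : measurable_fun setT ((fun t => ip mu g (k t)) : rT -> R).
  apply: (@measurable_Rintegral_param _ _ _ rT rT (lebTf T) (fun q => g q.2 * k q.1 q.2)).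
  by apply: measurable_funM => //; apply: (measurableT_comp mg); exact: measurable_snd.
split => //; pose C : R := nrm mu g ^+ 2 * (D * (moment p T + moment p T)).
apply: (@le_lt_trans _ _ (\int[mu]_t C%:E)%E).
  apply: ae_ge0_le_integral => //.
  - by move=> t _; rewrite lee_fin sqr_ge0.
  - by apply/measurable_EFinP; exact: measurable_funX.
  - by move=> t _; rewrite lee_fin mulr_ge0 ?sqr_ge0// mulr_ge0// addr_ge0// moment_ge0.
  - apply/ae_lebT; apply: aeW => t /andP[_ tT] _; rewrite lee_fin.
    have lk := kernel_L2_r tT.
    have : `|ip mu g (k t)| ^+ 2 <= (nrm mu g * nrm mu (k t)) ^+ 2.
      by rewrite ler_pXn2r ?nnegrE ?mulr_ge0 ?nrm_ge0//; exact: cauchy_schwarz.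
    rewrite real_normK ?num_real// exprMn => /le_trans; apply.
    rewrite ler_wpM2l ?sqr_ge0// -lee_fin -Lfun2_sqr_integral//.
    exact: kernel_row_integral_le.
rewrite (integral_cst mu measurableT C%:E) (_ : (mu setT = T%:E)%E); last exact: lebT_setT.
by rewrite -EFinM ltry.
Qed.

End VolterraOperator.

(** * Abel inversion of the first order kernel *)

Section GammaPositive.
Context {R : realType}.
Local Notation leb := (@lebesgue_measure R).
Local Notation rT := (measurableTypeR R).

Lemma ge0_integral_gt0 (f : rT -> R) (a b : R) : measurable_fun setT f ->
  (forall x, 0 <= f x) -> a < b -> (forall x, a < x < b -> 0 < f x) ->
  (0 < \int[leb]_x (f x)%:E)%E.
Proof.
move=> mf f0 ab fpos; rewrite lt_neqAle integral_ge0 ?andbT; last by move=> x _; rewrite lee_fin.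
apply/negP => /eqP e.
have mE : measurable_fun setT (EFin \o f) by exact/measurable_EFinP.
have : (\int[leb]_x `|(EFin \o f) x| = 0)%E.
  by rewrite [RHS]e; apply: eq_integral => x _; rewrite gee0_abs// lee_fin.
move/(ae_eq_integral_abs leb measurableT mE) => [N [mN N0 fN]].
have sub : `]a, b[ `<=` N.
  move=> x; rewrite /= in_itv/= => xab; apply: fN => /= /(_ Logic.I)[] fx.
  by have := fpos _ xab; rewrite fx ltxx.
have : (leb `]a, b[ <= leb N)%E by apply: le_measure => //; rewrite inE.
have -> : leb N = 0%E by exact: N0.
by rewrite lebesgue_measure_itv/= lte_fin ab -EFinD lee_fin leNgt subr_gt0 ab.
Qed.

(** Finiteness is part of the claim, since a divergent integral would give the value 0. The range
    (0, 2) contains 3/2 - h, h + 1/2 and 2 - 2h for 0 < h < 1. *)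
Lemma Gamma_gt0 (x : R) : 0 < x < 2 -> 0 < Gamma x.
Proof.
move=> /andP[x0 x2].
pose g (y : R) := if 0 < y then y `^ (x - 1) * expR (- y) else 0.
have mg : measurable_fun setT (g : rT -> R).
  apply: measurable_fun_ifT => //; first exact: measurable_fun_ltr.
  apply: measurable_funM; first exact: measurable_powR.
  by apply: measurableT_comp => //; exact: measurable_oppr.
have g0 y : 0 <= g y.
  by rewrite /g; case: ifP => // _; rewrite mulr_ge0 ?powR_ge0 ?expR_ge0.
have -> : Gamma x = \int[leb]_y g y.
  rewrite /Gamma Rintegral_mkcond; apply: eq_Rintegral => y _.
  by rewrite patchE mem_setE /= in_itv/= andbT.
rewrite -lte_fin fineK.
  apply: (@ge0_integral_gt0 g 0 1) => // y /andP[y0 _].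
  by rewrite /g y0 mulr_gt0 ?powR_gt0 ?expR_gt0.
rewrite ge0_fin_numE; last by apply: integral_ge0 => y _; rewrite lee_fin.
pose m y : R := if 0 < y <= 1 then y `^ (- (1 - x)) else 0.
(* Majorant on y > 1: from 1 + y/2 <= exp(y/2) follows y exp(-y) <= 2 exp(-y/2), which is 4 times
   this density. *)
pose e := exponential_pdf (2^-1 : R).
have e0 y : 0 <= e y by apply: exponential_pdf_ge0; rewrite ?invr_ge0 ?invr_gt0.
have me : measurable_fun setT (e : rT -> R) by exact: measurable_exponential_pdf.
have mm : measurable_fun setT (fun y : rT => (m y)%:E) by exact: measurable_moment.
apply: (@le_lt_trans _ _ (\int[leb]_y ((m y)%:E + (4%:E * (e y)%:E)))%E).
  apply: ge0_le_integral => //.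
  - by move=> y _; rewrite lee_fin.
  - exact/measurable_EFinP.
  - by apply: emeasurable_funD => //; apply: measurable_funeM; exact/measurable_EFinP.
  - move=> y _; rewrite -EFinM -EFinD lee_fin /g /m.
    case: ltP => y0 /=; last by rewrite add0r mulr_ge0.
    case: (leP y 1) => y1.
      rewrite opprB -[leLHS]addr0 lerD ?mulr_ge0//.
      by rewrite ler_piMr ?powR_ge0// -expR0 ler_expR lerNl oppr0 ltW.
    rewrite add0r /e /exponential_pdf patchE mem_set/=; last by rewrite in_itv/= andbT ltW.
    have -> : 4 * (2^-1 * expR (- 2^-1 * y)) = 2 * expR (- (y / 2)) :> R.
      by rewrite mulrA mulNr (mulrC _ y); congr (_ * _); field.
    apply: (@le_trans _ _ (y * expR (- y))).
      rewrite ler_wpM2r ?expR_ge0// -[leRHS]powRr1 ?(ltW y0)//.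
      by apply: ler_powR; [exact: ltW|lra].
    have -> : expR (- y) = expR (- (y / 2)) * expR (- (y / 2)) by rewrite -expRD; congr expR; field.
    rewrite mulrA ler_wpM2r ?expR_ge0// expRN ler_pdivrMr ?expR_gt0//.
    by have := expR_ge1Dx (y / 2); lra.
rewrite ge0_integralD//; last 3 first.
- by move=> y _; rewrite lee_fin /m; case: ifP => // _; exact: powR_ge0.
- by move=> y _; rewrite -EFinM lee_fin mulr_ge0.
- by apply: measurable_funeM; exact/measurable_EFinP.
rewrite lte_add_pinfty//; first by apply: integral_powR_lty; lra.
rewrite ge0_integralZl_EFin//; last 2 first.
- by move=> y _; rewrite lee_fin.
- exact/measurable_EFinP.
by rewrite /e integral_exponential_pdf ?invr_gt0// mule1 ltry.
Qed.

Lemma fbm_const_gt0 (h : R) : 0 < h < 1 -> 0 < fbm_const h.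
Proof.
move=> h01; rewrite sqrtr_gt0 divr_gt0// mulr_gt0 ?Gamma_gt0 ?mulr_gt0//; lra.
Qed.

End GammaPositive.

(** * The Abel transform of the first order kernel *)

Section AbelIdentity.
Context {R : realType}.
Local Notation leb := (@lebesgue_measure R).
Local Notation rT := (measurableTypeR R).
Implicit Types (a h u v t z : R).

(** The Beta value B(1 - a, 1 + a); only its finiteness and positivity are used. *)
Definition abel_const a : R :=
  \int[leb]_x (if 0 < x < 1 then x `^ (- a) * (1 - x) `^ a else 0).

Lemma measurable_abel a v z :
  measurable_fun setT (fun u : rT => if v < u < z then (u - v) `^ (- a) * (z - u) `^ a else 0).
Proof.
apply: measurable_fun_ifT => //.
  by apply: measurable_and; exact: measurable_fun_ltr.
by apply: measurable_funM; apply: (measurableT_comp (measurable_powR _)); exact: measurable_funB.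
Qed.

Lemma abel_ge0 a v z u : 0 <= (if v < u < z then (u - v) `^ (- a) * (z - u) `^ a else 0).
Proof. by case: ifP => // _; rewrite mulr_ge0 ?powR_ge0. Qed.

(** One factor is at most 1 and the other is an integrable power with exponent -|a|, at the endpoint
    0 or 1 according to the sign of a. *)
Lemma abel_constE a : `|a| < 1 ->
  (\int[leb]_x (if (0 < x < 1)%R then x `^ (- a) * (1 - x) `^ a else 0)%:E = (abel_const a)%:E)%E.
Proof.
move=> a1; rewrite fineK// ge0_fin_numE; last first.
  by apply: integral_ge0 => x _; have := abel_ge0 a 0 1 x; rewrite subr0 lee_fin.
have m1 := measurable_moment `|a| (1 : R).
have m2 : measurable_fun setT (fun x : rT => (if 0 < x < 1 then (1 - x) `^ (- `|a|) else 0)%:E).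
  apply/measurable_EFinP; apply: (@measurable_powR_refl R _ 1 (fun x : rT => 0 < x < 1)).
  by apply: measurable_and; exact: measurable_fun_ltr.
have i1 (x : R) : 0 <= (if 0 < x <= 1 then x `^ (- `|a|) else 0).
  by case: ifP => // _; exact: powR_ge0.
have i2 (x : R) : 0 <= (if 0 < x < 1 then (1 - x) `^ (- `|a|) else 0).
  by case: ifP => // _; exact: powR_ge0.
apply: (@le_lt_trans _ _ (\int[leb]_x ((if (0 < x <= 1)%R then x `^ (- `|a|) else 0)%:E +
   (if (0 < x < 1)%R then (1 - x) `^ (- `|a|) else 0)%:E))%E).
  apply: ge0_le_integral => //.
  - by move=> x _; have := abel_ge0 a 0 1 x; rewrite subr0 lee_fin.
  - have := measurable_abel a 0 1; under eq_fun do rewrite subr0.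
    by move=> ?; exact/measurable_EFinP.
  - exact: emeasurable_funD.
  - move=> x _; rewrite -EFinD lee_fin.
    case: ifPn => [/andP[x0 x1]|_]; last by rewrite addr0.
    rewrite x0 (ltW x1) /=; have x10 : 0 < 1 - x by rewrite subr_gt0.
    have le1 (y r : R) : 0 < y -> y <= 1 -> 0 <= r -> y `^ r <= 1.
      by move=> y0 y1 r0; have := ler_powR_base r0 (ltW y0) y1; rewrite powR1.
    have x1' : 1 - x <= 1 by rewrite gerBl ltW.
    have [a0|a0] := leP 0 a.
      rewrite (ger0_norm a0) ler_wpDr ?powR_ge0// ler_piMr ?powR_ge0//.
      exact: le1.
    rewrite (ltr0_norm a0) opprK ler_wpDl ?powR_ge0// ler_piMl ?powR_ge0//.
    by apply: le1 => //; [exact: ltW|lra].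
rewrite ge0_integralD//; last 2 first.
- by move=> x _; rewrite lee_fin.
- by move=> x _; rewrite lee_fin.
rewrite lte_add_pinfty ?integral_powR_lty//.
by apply: le_lt_trans (integral_powR_refl a1 (lexx 1)) _; exact: ltry.
Qed.

Lemma abel_const_gt0 a : `|a| < 1 -> 0 < abel_const a.
Proof.
move=> a1; rewrite -lte_fin -abel_constE//.
have e : (fun x : R => if 0 < x < 1 then x `^ (- a) * (1 - x) `^ a else 0) =
  (fun x => if 0 < x < 1 then (x - 0) `^ (- a) * (1 - x) `^ a else 0).
  by apply/funext => x; rewrite subr0.
apply: (@ge0_integral_gt0 R (fun x : R => if 0 < x < 1 then x `^ (- a) * (1 - x) `^ a else 0) 0 1) => //.
- by rewrite e; exact: measurable_abel.
- by move=> x; have := abel_ge0 a 0 1 x; rewrite subr0.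
- by move=> x /andP[x0 x1]; rewrite x0 x1 mulr_gt0 ?powR_gt0 ?subr_gt0.
Qed.

(** Substitute u = (z - v) x + v: the exponents -a and a cancel, and only the Jacobian z - v
    remains. *)
Lemma abel_integral a v z : `|a| < 1 -> v < z ->
  (\int[leb]_u (if (v < u < z)%R then (u - v) `^ (- a) * (z - u) `^ a else 0)%:E =
   (abel_const a * (z - v))%:E)%E.
Proof.
move=> a1 vz; have zv : 0 < z - v by rewrite subr_gt0.
pose f u : \bar R := (if v < u < z then (u - v) `^ (- a) * (z - u) `^ a else 0)%:E.
have mf : measurable_fun setT (f : rT -> \bar R) by apply/measurable_EFinP; exact: measurable_abel.
have f0 u : (0 <= f u)%E by rewrite lee_fin; exact: abel_ge0.
have -> : (abel_const a * (z - v))%:E = ((z - v)%:E * (abel_const a)%:E)%E by rewrite -EFinM mulrC.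
rewrite -abel_constE//; apply: etrans (ge0_integral_affine v zv mf f0) _.
congr (_ * _)%E; apply: eq_integral => x _; congr EFin.
have -> : (v < (z - v) * x + v < z) = (0 < x < 1).
  by rewrite ltrDr pmulr_rgt0// -ltrBrDr -{2}[z - v]mulr1 ltr_pM2l.
case: ifPn => // /andP[x0 x1].
rewrite addrK (_ : z - ((z - v) * x + v) = (z - v) * (1 - x)); last by ring.
rewrite !powRM ?(ltW zv) ?(ltW x0)// ?subr_ge0 ?(ltW x1)// mulrACA -powRD_gt0//.
by rewrite addNr powRr0 mul1r.
Qed.

Lemma powR_continuous a x : 0 < x -> {for x, continuous (@powR R ^~ a)}.
Proof.
move=> x0; apply: differentiable_continuous; apply/derivable1_diffP.
by apply: derivable_powR; rewrite in_itv/= x0.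
Qed.

Lemma primitive_shift_powR a v t : 0 < v -> v < t ->
  (\int[leb]_(z in `[v, t]) (z `^ a + a * (z `^ (a - 1) * (z - v)))%:E = (t `^ a * (t - v))%:E)%E.
Proof.
move=> v0 vt; pose F z := z `^ a * (z - v).
have dF z : 0 < z -> is_derive z 1 F (z `^ a + a * (z `^ (a - 1) * (z - v))).
  move=> z0; have h : is_derive z 1 (@powR R ^~ a) (a * z `^ (a - 1)) by exact: is_derive1_powR.
  have h2 : is_derive z 1 (fun z : R => z - v) 1.
    by have := is_deriveB (is_derive_id z 1) (is_derive_cst v z 1); rewrite subr0.
  have := is_deriveM h h2; congr (is_derive _ _ _ _).
  by rewrite /GRing.scale /= mulr1; ring.
have cF z : 0 < z -> {for z, continuous F}.
  by move=> z0; apply: differentiable_continuous; apply/derivable1_diffP; case: (dF _ z0).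
rewrite (@continuous_FTC2 _ _ F)//.
- by rewrite /F subrr mulr0 -EFinB subr0.
- apply/subspace_continuousP => x /=; rewrite in_itv/= => /andP[vx _].
  have x0 : 0 < x by apply: lt_le_trans vx.
  apply: cvg_within_filter; apply: cvgD; first exact: powR_continuous.
  apply: cvgM; first exact: cvg_cst.
  apply: cvgM; first exact: powR_continuous.
  by apply: cvgB; [exact: cvg_id|exact: cvg_cst].
- split.
  + by move=> x; rewrite in_itv/= => /andP[vx _]; case: (dF x (lt_trans v0 vx)).
  + by apply: cvg_at_right_filter; exact: cF.
  + by apply: cvg_at_left_filter; apply: cF; exact: lt_trans vt.
- move=> x; rewrite in_itv/= => /andP[vx _].
  by rewrite derive1E; have [_ ->] := dF x (lt_trans v0 vx).
Qed.

(** Integration by parts for z^a (z - v); it merges the two terms of the transformed kernel into the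
    integral of z^a. *)
Lemma primitive_powR_split a v t : 0 < v -> v < t ->
  \int[leb]_(z in `[v, t]) (z `^ a) + a * \int[leb]_(z in `[v, t]) (z `^ (a - 1) * (z - v)) =
  t `^ a * (t - v).
Proof.
move=> v0 vt.
have cint (f : R -> R) : (forall x, 0 < x -> {for x, continuous f}) ->
    leb.-integrable `[v, t] (EFin \o f).
  move=> cf; apply: continuous_compact_integrable; first exact: segment_compact.
  apply/subspace_continuousP => x /=; rewrite in_itv/= => /andP[vx _].
  by apply: cvg_within_filter; apply: cf; apply: lt_le_trans vx.
have i1 : leb.-integrable `[v, t] (EFin \o (@powR R ^~ a)).
  by apply: cint => x; exact: powR_continuous.
have i2 : leb.-integrable `[v, t] (EFin \o (fun z => z `^ (a - 1) * (z - v))).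
  apply: cint => x x0; apply: cvgM; first exact: powR_continuous.
  by apply: cvgB; [exact: cvg_id|exact: cvg_cst].
have i3 : leb.-integrable `[v, t] (EFin \o (fun z => a * (z `^ (a - 1) * (z - v)))).
  have := @integrableZl _ _ _ leb _ (measurable_itv `[v, t]) a _ i2.
  by apply: eq_integrable => // z _; rewrite /= EFinM.
have := congr1 fine (primitive_shift_powR a v0 vt).
rewrite -[fine _ in LHS]/(Rintegral _ _ _) RintegralD// RintegralZl//.
Qed.

Lemma kernel1_integrand_ge0 a u t z :
  0 <= (if u < z < t then z `^ (a - 1) * (z - u) `^ a else 0).
Proof. by case: ifP => // _; rewrite mulr_ge0 ?powR_ge0. Qed.

(** By Tonelli the integral over u can be done first, on (v, z), where it is the one of
    [abel_integral]. *)
Lemma abel_double_integral a v t : `|a| < 1 -> 0 < v -> v < t ->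
  (\int[leb]_u ((if (v < u < t)%R then (u - v) `^ (- a) else 0)%:E *
     \int[leb]_z (if (u < z < t)%R then z `^ (a - 1) * (z - u) `^ a else 0)%:E) =
   (abel_const a * \int[leb]_(z in `[v, t]) (z `^ (a - 1) * (z - v))%R)%:E)%E.
Proof.
move=> a1 v0 vt.
pose G u z : R := if (v < u < t) && (u < z < t) then (u - v) `^ (- a) * (z `^ (a - 1) * (z - u) `^ a) else 0.
have mG : measurable_fun setT (fun q : rT * rT => (G q.1 q.2)%:E).
  have m1 : measurable_fun setT (fun q : rT * rT => q.1) by exact: measurable_fst.
  have m2 : measurable_fun setT (fun q : rT * rT => q.2) by exact: measurable_snd.
  apply/measurable_EFinP; apply: measurable_fun_ifT => //.
    by apply: measurable_and; apply: measurable_and; exact: measurable_fun_ltr.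
  apply: measurable_funM; first by apply: (measurableT_comp (measurable_powR _)); exact: measurable_funB.
  apply: measurable_funM; first exact: (measurableT_comp (measurable_powR _)).
  by apply: (measurableT_comp (measurable_powR _)); exact: measurable_funB.
have G0 u z : (0 <= (G u z)%:E)%E.
  by rewrite lee_fin /G; case: ifP => // _; rewrite !mulr_ge0 ?powR_ge0.
have tonelli : (\int[leb]_u \int[leb]_z (G u z)%:E = \int[leb]_z \int[leb]_u (G u z)%:E)%E.
  exact: (@fubini_tonelli _ _ rT rT R leb leb (fun q => (G q.1 q.2)%:E) mG (fun q => G0 _ _)).
transitivity (\int[leb]_u \int[leb]_z (G u z)%:E)%E.
  clear tonelli G0; apply: eq_integral => u _; rewrite /G; case: ifPn => vut /=; last first.
    by rewrite mul0e integral0.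
  pose g z : \bar R := (if u < z < t then z `^ (a - 1) * (z - u) `^ a else 0)%:E.
  have g0 (z : rT) : setT z -> (0 <= g z)%E by move=> _; rewrite lee_fin; exact: kernel1_integrand_ge0.
  have mg : measurable_fun setT (g : rT -> \bar R).
    by apply/measurable_EFinP; exact: measurable_kernel1_integrand.
  have E := @ge0_integralZl_EFin _ rT R leb setT measurableT g g0 mg _ (powR_ge0 (u - v) (- a)).
  refine (etrans (esym E) _).
  by apply: eq_integral => z _; rewrite /g -EFinM; case: ifP => //; rewrite mulr0.
rewrite tonelli {tonelli G0}.
have ik : (\int[leb]_(z in `[v, t]) (z `^ (a - 1) * (z - v))%:E =
    (\int[leb]_(z in `[v, t]) (z `^ (a - 1) * (z - v))%R)%:E)%E.
  rewrite fineK//; apply: integrable_fin_num => //.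
  apply: continuous_compact_integrable; first exact: segment_compact.
  apply/subspace_continuousP => x /=; rewrite in_itv/= => /andP[vx _].
  have x0 : 0 < x by apply: lt_le_trans vx.
  apply: cvg_within_filter; apply: cvgM; first exact: powR_continuous.
  by apply: cvgB; [exact: cvg_id|exact: cvg_cst].
rewrite [RHS]EFinM -ik.
pose g z : \bar R := (z `^ (a - 1) * (z - v))%:E.
have g0 (z : rT) : `[v, t]%classic z -> (0 <= g z)%E.
  rewrite /= in_itv/= => /andP[vz _].
  by rewrite lee_fin mulr_ge0 ?powR_ge0// subr_ge0.
have mg (D : set rT) : measurable_fun D (g : rT -> \bar R).
  apply/measurable_EFinP; apply: measurable_funTS; apply: measurable_funM; first exact: measurable_powR.
  exact: measurable_funB.
refine (etrans _ (@ge0_integralZl_EFin _ rT R leb _ (measurable_itv `[v, t])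
  g g0 (mg _) _ (ltW (abel_const_gt0 a1)))).
transitivity (\int[leb]_(z in `]v, t[) ((abel_const a)%:E * (z `^ (a - 1) * (z - v))%:E))%E; last first.
  by symmetry; apply: integral_itv_bndoo; apply: measurable_funeM; exact: mg.
rewrite [RHS]integral_mkcond; apply: eq_integral => z _; rewrite patchE mem_setE /= in_itv/=.
case: ifPn => [/andP[vz zt]|vzt].
  transitivity (\int[leb]_u ((z `^ (a - 1))%:E *
      (if (v < u < z)%R then (u - v) `^ (- a) * (z - u) `^ a else 0)%:E))%E.
    apply: eq_integral => u _; rewrite -EFinM /G zt andbT; congr EFin.
    have [vu|uv] := ltP v u => /=; last by rewrite mulr0.
    have [uz|zu] := ltP u z; last by rewrite andbF mulr0.
    by rewrite (lt_trans uz zt) /=; ring.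
  pose f u : \bar R := (if v < u < z then (u - v) `^ (- a) * (z - u) `^ a else 0)%:E.
  have f0 (u : rT) : setT u -> (0 <= f u)%E by move=> _; rewrite lee_fin; exact: abel_ge0.
  have mf : measurable_fun setT (f : rT -> \bar R) by apply/measurable_EFinP; exact: measurable_abel.
  refine (etrans (@ge0_integralZl_EFin _ rT R leb setT measurableT f f0 mf _ (powR_ge0 z (a - 1))) _).
  by rewrite /f abel_integral// -!EFinM; congr EFin; ring.
apply: integral0_eq => u _; rewrite /G; case: ifPn => // /andP[/andP[vu _] /andP[uz zt]].
by rewrite (lt_trans vu uz) zt in vzt.
Qed.

(** The factor u^a of the weight removes the prefactor u^-a of the kernel. The two terms A and B
    then contribute t^a (t - v) and a times the integral of z^(a - 1) (z - v), both multiplied by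
    [abel_const a]; [primitive_powR_split] evaluates the difference. *)
Lemma abel_fbm_kernel1 h v t : 0 < h < 1 -> 0 < v -> v < t ->
  (\int[leb]_u (if (v < u)%R
     then (u - v) `^ (- (h - 1 / 2)) * u `^ (h - 1 / 2) * fbm_kernel1 h t u else 0)%:E =
  (fbm_const h * abel_const (h - 1 / 2) * \int[leb]_(z in `[v, t]) (z `^ (h - 1 / 2))%R)%:E)%E.
Proof.
move=> h01 v0 vt; set a := h - 1 / 2.
have a2 : `|a| < 1 / 2 by rewrite /a ltr_norml; lra.
have a1 : `|a| < 1 by lra.
(* Serves to obtain the finiteness of the inner integral J from [kernel1_integral_le]. *)
pose theta := (`|a| + 1 / 2) / 2.
have ath : `|a| < theta by rewrite /theta; lra.
have th2 : theta < 1 / 2 by rewrite /theta; lra.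
pose J u : R := \int[leb]_z (if u < z < t then z `^ (a - 1) * (z - u) `^ a else 0).
have JE u : 0 < u -> u < t ->
   (\int[leb]_z (if (u < z < t)%R then z `^ (a - 1) * (z - u) `^ a else 0)%:E = (J u)%:E)%E.
  move=> u0 ut; rewrite fineK// ge0_fin_numE.
    by apply: le_lt_trans (kernel1_integral_le ath th2 u0 ut (lexx t)) _; exact: ltry.
  by apply: integral_ge0 => z _; rewrite lee_fin; case: ifP => // _; rewrite mulr_ge0 ?powR_ge0.
pose A u : R := t `^ a * (if v < u < t then (u - v) `^ (- a) * (t - u) `^ a else 0).
pose B u : R := if v < u < t then (u - v) `^ (- a) * J u else 0.
have IA : (\int[leb]_u (A u)%:E = (t `^ a * (abel_const a * (t - v)))%:E)%E.
  rewrite EFinM -abel_integral//.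
  pose f u : \bar R := (if v < u < t then (u - v) `^ (- a) * (t - u) `^ a else 0)%:E.
  have f0 (u : rT) : setT u -> (0 <= f u)%E by move=> _; rewrite lee_fin; exact: abel_ge0.
  have mf : measurable_fun setT (f : rT -> \bar R) by apply/measurable_EFinP; exact: measurable_abel.
  refine (etrans _ (@ge0_integralZl_EFin _ rT R leb setT measurableT f f0 mf _ (powR_ge0 t a))).
  by apply: eq_integral => u _; rewrite /A EFinM.
have IB : (\int[leb]_u (B u)%:E = (abel_const a * \int[leb]_(z in `[v, t]) (z `^ (a - 1) * (z - v))%R)%:E)%E.
  rewrite -abel_double_integral//; apply: eq_integral => u _.
  rewrite /B; case: ifPn => [/andP[vu ut]|_]; last by rewrite mul0e.
  by rewrite JE// (lt_trans v0 vu).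
have mA : measurable_fun setT (A : rT -> R).
  by apply: measurable_funM => //; exact: measurable_abel.
have mJ : measurable_fun setT (J : rT -> R).
  apply: (@measurable_Rintegral_param _ _ _ rT rT leb
    (fun q => if q.1 < q.2 < t then q.2 `^ (a - 1) * (q.2 - q.1) `^ a else 0)).
  have m1 : measurable_fun setT (fun q : rT * rT => q.1) by exact: measurable_fst.
  have m2 : measurable_fun setT (fun q : rT * rT => q.2) by exact: measurable_snd.
  apply: measurable_fun_ifT => //; first by apply: measurable_and; exact: measurable_fun_ltr.
  apply: measurable_funM; first exact: (measurableT_comp (measurable_powR _)).
  by apply: (measurableT_comp (measurable_powR _)); exact: measurable_funB.
have mB : measurable_fun setT (B : rT -> R).
  apply: measurable_fun_ifT => //; first by apply: measurable_and; exact: measurable_fun_ltr.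
  apply: measurable_funM => //.
  by apply: (measurableT_comp (measurable_powR _)); exact: measurable_funB.
have A0 u : 0 <= A u by rewrite mulr_ge0 ?powR_ge0//; exact: abel_ge0.
have J0 u : 0 <= J u.
  by apply: Rintegral_ge0 => z _; case: ifP => // _; rewrite mulr_ge0 ?powR_ge0.
have B0 u : 0 <= B u by rewrite /B; case: ifP => // _; rewrite mulr_ge0 ?powR_ge0.
have iA : leb.-integrable setT (EFin \o A).
  apply/integrableP; split; first exact/measurable_EFinP.
  have -> : (\int[leb]_u `|(EFin \o A) u| = \int[leb]_u (A u)%:E)%E.
    by apply: eq_integral => u _; rewrite gee0_abs// lee_fin; exact: A0.
  by rewrite IA ltry.
have iB : leb.-integrable setT (EFin \o B).
  apply/integrableP; split; first exact/measurable_EFinP.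
  have -> : (\int[leb]_u `|(EFin \o B) u| = \int[leb]_u (B u)%:E)%E.
    by apply: eq_integral => u _; rewrite gee0_abs// lee_fin; exact: B0.
  by rewrite IB ltry.
transitivity (\int[leb]_u ((fbm_const h)%:E * ((A u)%:E - a%:E * (B u)%:E)))%E.
  apply: eq_integral => u _; rewrite [RHS](_ : _ = (fbm_const h * (A u - a * B u))%:E)//; congr EFin.
  rewrite /A /B; have [vu|uv] := ltP v u => /=; last by rewrite !(mulr0, subr0).
  have u0 := lt_trans v0 vu.
  have [ut|tu] := ltP u t; last first.
    by rewrite /fbm_kernel1 u0 /= ltNge tu /= !(mulr0, subr0).
  rewrite fbm_kernel1E// -/a -/(J u) !powRN.
  have ua : u `^ a != 0 by rewrite gt_eqF// powR_gt0.
  have uva : (u - v) `^ a != 0 by rewrite gt_eqF// powR_gt0 ?subr_gt0.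
  by field; rewrite ua uva.
have iaB : leb.-integrable setT (fun u => a%:E * (B u)%:E)%E by exact: integrableZl.
rewrite integralZl//; last exact: integrableB.
rewrite integralB// integralZl// IA IB; congr EFin.
have := primitive_powR_split a v0 vt.
set I1 := Rintegral _ _ _; set I2 := Rintegral _ _ _ => e.
rewrite (_ : t `^ a * _ = abel_const a * (t `^ a * (t - v))); last by ring.
by rewrite -e; ring.
Qed.

End AbelIdentity.

(** * Injectivity *)

Section Injectivity.
Context {R : realType} (T : R).
Local Notation leb := (@lebesgue_measure R).
Local Notation rT := (measurableTypeR R).
Local Notation mu := (lebT T).
Hypothesis T0 : 0 < T.

Definition tail (s t : R) : R := if s < t then 1 else 0.

(** For a = 0 this is almost everywhere [ind t], and the operator is f |-> \int_u^T f; for a = h -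
    1/2 it is what the Abel transform leaves of the first order kernel. *)
Definition primitive_kernel a (t z : R) : R := if 0 < z < t then z `^ a else 0.

Lemma L2_bounded (f : R -> R) C : measurable_fun setT (f : rT -> R) ->
  (forall x, `|f x| <= C) -> L2 T f.
Proof.
move=> mf fC; apply/Lfun2P; split => //.
apply: (@le_lt_trans _ _ (\int[mu]_t (C ^+ 2)%:E)%E).
  apply: ge0_le_integral => //.
  - by move=> t _; rewrite lee_fin sqr_ge0.
  - by apply/measurable_EFinP; exact: measurable_funX.
  - move=> t _; rewrite lee_fin -(real_normK (num_real (f t))).
    by rewrite ler_pXn2r ?nnegrE// (le_trans _ (fC t)).
rewrite (integral_cst mu measurableT (C ^+ 2)%:E) (_ : (mu setT = T%:E)%E); last exact: lebT_setT.
by rewrite -EFinM ltry.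
Qed.

Lemma tail_L2 s : L2 T (tail s).
Proof.
apply: (@L2_bounded _ 1).
  by apply: measurable_fun_ifT => //; exact: measurable_fun_ltr.
by move=> x; rewrite /tail; case: ifP => _; rewrite ?normr1 ?normr0.
Qed.

Lemma ind_L2 t : L2 T (ind t).
Proof.
apply: (@L2_bounded _ 1); first by apply: measurable_indic.
by move=> x; rewrite /ind indicE; case: (_ \in _); rewrite ?normr1 ?normr0.
Qed.

Lemma L2_integrable f : L2 T f -> mu.-integrable setT (EFin \o f).
Proof.
move=> lf; have l1 : L2 T (cst 1 : R -> R).
  by apply: (@L2_bounded _ 1) => // x; rewrite normr1.
have := Lfun2_ipI lf l1; rewrite (_ : (fun x => _) = EFin \o f)//.
by apply/funext => x /=; rewrite mulr1.
Qed.

Lemma ae_neq (r : R) : {ae mu, forall x, x != r}.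
Proof.
apply/ae_lebT; exists [set r]; split; [by []|exact: lebesgue_measure_set1|].
by move=> x /=; apply: contra_notP => /eqP xr _.
Qed.

(** Tests at s > 0 suffice, s = 0 being a null set; the power weights are controlled only away from
    0. *)
Lemma L2_tail_eq0 f : L2 T f -> {ae mu, forall s, 0 < s -> ip mu (tail s) f = 0} ->
  f = 0 %[ae mu].
Proof.
move=> lf f0; apply: ae_eq_tail_integral0; first exact: L2_integrable.
apply/ae_lebT; apply: ae_imp2 ((ae_lebT T _).1 f0) ((ae_lebT T _).1 (ae_neq 0)) => s fs s0 sT.
have sp : 0 < s by rewrite lt_neqAle eq_sym s0//; case/andP: sT.
transitivity (ip mu (tail s) f)%:E; last by rewrite fs.
rewrite (ipE (tail_L2 s) lf); apply: eq_integral => t _.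
by rewrite /tail; case: ifP => _; rewrite ?mul1r ?mul0r.
Qed.

Lemma primitive_kernel_bound a : - (1 / 2) < a ->
  sqr_kernel_bound T (primitive_kernel a) (- (a * 2)) 1.
Proof.
move=> a2; split => //; last 2 first.
- by lra.
- move=> u t tT; rewrite /primitive_kernel mul1r; case: ifP => _; last by rewrite expr0n.
  by rewrite -powR_mulrn ?powR_ge0// -powRrM opprK lerDl powR_ge0.
have m1 : measurable_fun setT (fun q : rT * rT => q.1) by exact: measurable_fst.
have m2 : measurable_fun setT (fun q : rT * rT => q.2) by exact: measurable_snd.
apply: measurable_fun_ifT => //; first by apply: measurable_and; exact: measurable_fun_ltr.
exact: (measurableT_comp (measurable_powR _)).
Qed.

Lemma volterra_primitive a f u : L2 T f -> 0 < u ->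
  volterra T (primitive_kernel a) f u = u `^ a * ip mu (tail u) f.
Proof.
move=> lf u0; rewrite -ipZl//; last exact: tail_L2.
apply: eq_Rintegral => t _; rewrite /primitive_kernel u0 /=.
rewrite -[(_ *: _) t]/(u `^ a * tail u t) /tail.
by case: ifP => _; rewrite ?mul0r ?mulr0 ?mul0r// mulr1 mulrC.
Qed.

Lemma primitive_inj a f : - (1 / 2) < a -> L2 T f ->
  volterra T (primitive_kernel a) f = 0 %[ae mu] -> f = 0 %[ae mu].
Proof.
move=> a2 lf f0; apply: L2_tail_eq0 => //.
apply: ae_imp f0 => s /(_ I) + s0; rewrite volterra_primitive// => /eqP.
by rewrite mulf_eq0 gt_eqF ?powR_gt0//= => /eqP.
Qed.

Lemma primitive_recurrence n H t u : (1 <= n)%N -> t <= T ->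
  volterra T (fbm_kernel n (H - 1)) (primitive_kernel 0 t) u = fbm_kernel n.+1 H t u.
Proof.
move=> n1 tT.
have [ut|ut] := boolP (0 < u < t); last first.
  rewrite [RHS]fbm_kernel_out// /volterra /Rintegral integral0_eq// => s _.
  congr EFin; rewrite /primitive_kernel.
  case: ifPn => [/andP[s0 st]|_]; last by rewrite mul0r.
  rewrite fbm_kernel_out ?mulr0//; apply: contra ut => /andP[u0 us].
  by rewrite u0 (lt_trans us st).
case/andP: ut => u0 ut; rewrite fbm_kernelSE//; congr fine.
have mk : measurable_fun setT (fun s : rT => fbm_kernel n (H - 1) s u).
  exact: (measurable_curry_l _ (measurable_fbm_kernel _ _)).
have mp : measurable_fun setT (primitive_kernel 0 t : rT -> R).
  have [mq _ _ _] := @primitive_kernel_bound 0 ltac:(lra).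
  exact: (measurable_curry_r _ mq).
rewrite lebT_integral; last by apply/measurable_EFinP; exact: measurable_funM.
rewrite [LHS]integral_mkcond.
transitivity (\int[leb]_(s in `]u, t[) (fbm_kernel n (H - 1) s u)%:E)%E; last first.
  by symmetry; apply: integral_itv_bndoo; apply/measurable_EFinP; exact: measurable_funTS.
rewrite [RHS]integral_mkcond; apply: eq_integral => s _; rewrite !patchE !mem_setE /= !in_itv/=.
rewrite /primitive_kernel; have [us|su] := ltP u s; last first.
  by case: ifP => // _; rewrite (@fbm_kernel_out _ n) ?mulr0// u0 /= -leNgt.
have s0 := lt_trans u0 us; rewrite (ltW s0) s0 /=; have [st|ts] := ltP s t.
  by rewrite (le_trans (ltW st) tT) powRr0 mul1r.
by case: ifP => // _; rewrite mul0r.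
Qed.

Lemma ind_primitive t : ind t = primitive_kernel 0 t %[ae mu].
Proof.
apply/ae_lebT; apply: ae_imp ((ae_lebT T _).1 (ae_neq 0)) => x x0 xT _.
have xp : 0 < x by rewrite lt_neqAle eq_sym x0//; case/andP: xT.
rewrite /ind indicE /primitive_kernel mem_setE in_itv/= xp (ltW xp) /=.
by case: ifP; rewrite ?powRr0.
Qed.

Lemma volterra_ae k p D f g u : sqr_kernel_bound T k p D -> L2 T f -> L2 T g ->
  f = g %[ae mu] -> volterra T k f u = volterra T k g u.
Proof. by move=> kb lf lg fg; apply: (@ae_eq_ip _ _ _ mu) => //; exact: (kernel_L2_l T0 kb u). Qed.

(** The operator of order n + 1 is that of order n after the primitive. Moving the primitive to the
    column [k' ^~ u] by its adjoint produces the integral over s that defines the next kernel, by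
    [primitive_recurrence]. *)
Lemma volterra_recurrence n H f u : (1 <= n)%N -> n.+1%:R - 1 < H < n.+1%:R -> L2 T f ->
  volterra T (fbm_kernel n.+1 H) f u =
  volterra T (fbm_kernel n (H - 1)) (volterra T (primitive_kernel 0) f) u.
Proof.
move=> n1 nH lf; have [p [D kb]] := fbm_sqr_kernel_bound (isT : (1 <= n.+1)%N) nH T0.
have nH1 : n%:R - 1 < H - 1 < n%:R by move: nH; rewrite -natr1; lra.
have [p' [D' kb']] := fbm_sqr_kernel_bound n1 nH1 T0.
have pb := @primitive_kernel_bound 0 ltac:(lra).
have lk := kernel_L2_l T0 kb' u.
rewrite -[RHS]/(ip mu _ (fun t => fbm_kernel n (H - 1) t u)) ipC (volterra_adjoint T0 pb)//.
rewrite -[LHS]/(ip mu f (fun t => fbm_kernel n.+1 H t u)) ipC [RHS]ipC.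
apply: (@ae_eq_ip _ _ _ mu) => //.
- exact: (kernel_L2_l T0 kb u).
- exact: (kernel_ip_L2 T0 pb lk).
- apply/ae_lebT; apply: aeW => t /andP[_ tT] _.
  by rewrite ipC -(primitive_recurrence H u n1 tT).
Qed.



(** Write P for the operator of [primitive_kernel a] and w for the Abel weight at v. Two uses of the
    adjoint give <w, A f> = c <[tail v], P f>. So A f = 0 makes every tail integral of P f vanish,
    whence P f = 0, and then f = 0 since P f (u) is u^a times a tail integral of f. *)
Lemma volterra_fbm1_inj h f : 0 < h < 1 -> L2 T f ->
  volterra T (fbm_kernel 1 h) f = 0 %[ae mu] -> f = 0 %[ae mu].
Proof.
move=> h01 lf f0; pose a := h - 1 / 2.
have a2 : - (1 / 2) < a by rewrite /a; lra.
have aabs : `|a| < 1 by rewrite /a ltr_norml; lra.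
have h01' : 1%:R - 1 < h < 1%:R by rewrite subrr.
have [p [D kb]] := fbm_sqr_kernel_bound (isT : (1 <= 1)%N) h01' T0.
have pb := primitive_kernel_bound a2.
apply: (@primitive_inj a) => //; apply: L2_tail_eq0; first exact: (volterra_L2 T0 pb lf).
apply: aeW => v v0.
pose c := fbm_const h * abel_const a.
have c0 : 0 < c by rewrite mulr_gt0// ?fbm_const_gt0// abel_const_gt0.
pose w (u : R) : R := if v < u then (u - v) `^ (- a) * u `^ a else 0.
have mw : measurable_fun setT (w : rT -> R).
  apply: measurable_fun_ifT => //; first exact: measurable_fun_ltr.
  apply: measurable_funM; last exact: measurable_powR.
  by apply: (measurableT_comp (measurable_powR _)); exact: measurable_funB.
(* On (v, T] the factor u^a is at most v^a + T^a for either sign of a, and (u - v)^(-2a) is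
   integrable because 2a < 1. *)
have lw : L2 T w.
  apply/Lfun2P; split => //.
  pose S (u : R) : R := if v < u <= T then (u - v) `^ (- (a * 2)) else 0.
  pose C := (v `^ a + T `^ a) ^+ 2.
  have mS : measurable_fun setT (S : rT -> R).
    apply: measurable_powR_shift.
    by apply: measurable_and; [exact: measurable_fun_ltr|exact: measurable_fun_ler].
  have S0 (u : rT) : setT u -> (0 <= (S u)%:E)%E.
    by move=> _; rewrite lee_fin /S; case: ifP => // _; exact: powR_ge0.
  rewrite ge0_lebT_integral; last 2 first.
  - by apply/measurable_EFinP; exact: measurable_funX.
  - by move=> u; rewrite lee_fin sqr_ge0.
  apply: (@le_lt_trans _ _ (\int[leb]_u (C%:E * (S u)%:E))%E).
    apply: (@le_trans _ _ (\int[leb]_(u in `[0%R, T]) (C%:E * (S u)%:E))%E); last first.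
      apply: ge0_subset_integral => //; first by apply: measurable_funeM; exact/measurable_EFinP.
      by move=> u _; rewrite mule_ge0 ?lee_fin ?sqr_ge0//; exact: S0.
    apply: ge0_le_integral => //.
    - by move=> u _; rewrite lee_fin sqr_ge0.
    - by apply/measurable_EFinP; apply: measurable_funTS; exact: measurable_funX.
    - by apply: measurable_funeM; apply/measurable_EFinP; exact: measurable_funTS.
    - move=> u; rewrite /= in_itv/= => /andP[u0 uT]; rewrite -EFinM lee_fin /w /S uT andbT.
      case: ifP => vu; last by rewrite expr0n mulr0.
      rewrite exprMn mulrC -(powR_mulrn 2 (powR_ge0 _ (- a))) -powRrM mulNr ler_wpM2r ?powR_ge0//.
      rewrite ler_pXn2r ?nnegrE ?addr_ge0 ?powR_ge0//.
      have [a0|a0] := leP 0 a.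
        by rewrite (le_trans (ler_powR_base a0 u0 uT))// lerDr powR_ge0.
      rewrite (@le_trans _ _ (v `^ a))// ?lerDl ?powR_ge0//.
      rewrite -[a]opprK; apply: ler_powRN_base => //; [by rewrite oppr_ge0 ltW|exact: ltW].
  have E := @ge0_integralZl_EFin _ rT R leb setT measurableT (EFin \o S) S0 _ C (sqr_ge0 _).
  rewrite [ltLHS]E; last exact/measurable_EFinP.
  rewrite lte_mul_pinfty ?lee_fin ?sqr_ge0//.
  apply: le_lt_trans (@integral_powR_shift _ (a * 2) v T T _ (ltW v0) (lexx T)) _; last exact: ltry.
  by rewrite /a; lra.
have wk t : t <= T -> ip mu w (fbm_kernel 1 h t) = c * ip mu (tail v) (primitive_kernel a t).
  move=> tT; apply: EFin_inj.
  rewrite EFinM (ipE lw (kernel_L2_r kb tT)) (ipE (tail_L2 v) (kernel_L2_r pb tT)).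
  have mk : measurable_fun setT (fun u : rT => w u * fbm_kernel 1 h t u).
    by apply: measurable_funM => //; exact: (Lfun2_measurable (kernel_L2_r kb tT)).
  have [tv|vt] := leP t v.
    rewrite !integral0_eq ?mule0// => u _; congr EFin.
      rewrite /tail /primitive_kernel; case: ifP => vu; last by rewrite mul0r.
      by rewrite [u < t]ltNge (le_trans tv (ltW vu)) andbF mulr0.
    rewrite /w; case: ifP => vu; last by rewrite mul0r.
    by rewrite fbm_kernel_out ?mulr0// [u < t]ltNge (le_trans tv (ltW vu)) andbF.
  have -> : (\int[mu]_u (w u * fbm_kernel 1 h t u)%:E = (c * \int[leb]_(z in `[v, t]) (z `^ a))%:E)%E.
    rewrite -abel_fbm_kernel1// lebT_integral_supp; last 2 first.
    - exact/measurable_EFinP.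
    - move=> u uT; rewrite fbm_kernel_out ?mulr0//; apply: contra uT => /andP[u0 ut].
      by rewrite !ltW// (lt_le_trans ut tT).
    by apply: eq_integral => u _; rewrite /w; case: ifP => // _; rewrite mul0r.
  rewrite EFinM; congr (_ * _)%E.
  rewrite -(ipE (tail_L2 v) (kernel_L2_r pb tT)); congr (fine _)%:E.
  rewrite lebT_integral_supp; last 2 first.
  - apply/measurable_EFinP; apply: measurable_funM; first exact: (Lfun2_measurable (tail_L2 v)).
    exact: (Lfun2_measurable (kernel_L2_r pb tT)).
  - move=> u uT; rewrite /primitive_kernel; case: ifPn => [/andP[u0 ut]|_]; last by rewrite mulr0.
    by rewrite !ltW// (lt_le_trans ut tT) in uT.
  rewrite (_ : (\int[leb]_(z in `[v, t]) (z `^ a)%:E = \int[leb]_(z in `]v, t[) (z `^ a)%:E)%E); last first.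
    apply: integral_itv_bndoo; apply/measurable_EFinP; apply: measurable_funTS.
    exact: measurable_powR.
  rewrite integral_mkcond; apply: eq_integral => u _; rewrite patchE mem_setE /= in_itv/=.
  rewrite /tail /primitive_kernel; case: (ltP v u) => [vu|uv] /=; last by rewrite mul0r.
  by rewrite (lt_trans v0 vu) /=; case: ifP => _; rewrite mul1r.
apply: (mulfI (lt0r_neq0 c0)); rewrite mulr0 (volterra_adjoint T0 pb lf (tail_L2 v)).
have <- : ip mu w (volterra T (fbm_kernel 1 h) f) = 0.
  rewrite ipC (@ae_eq_ip _ _ _ mu _ 0)//; last 2 first.
  - exact: (volterra_L2 T0 kb lf).
  - exact: Lfun20.
  exact: ip0l.
rewrite (volterra_adjoint T0 kb lf lw) ipC -ipZl//; last exact: (kernel_ip_L2 T0 pb (tail_L2 v)).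
rewrite [RHS]ipC; apply: (@ae_eq_ip _ _ _ mu) => //.
- apply: Lfun2Z; exact: (kernel_ip_L2 T0 pb (tail_L2 v)).
- exact: (kernel_ip_L2 T0 kb lw).
- by apply/ae_lebT; apply: aeW => t /andP[_ tT] _; rewrite wk.
Qed.

Lemma volterra_fbm_inj n H f : (1 <= n)%N -> n%:R - 1 < H < n%:R -> L2 T f ->
  volterra T (fbm_kernel n H) f = 0 %[ae mu] -> f = 0 %[ae mu].
Proof.
case: n => // n _; elim: n H f => [|n IH] H f nH lf f0.
  by apply: (volterra_fbm1_inj _ lf f0); move: nH; rewrite subrr.
have h0 : - (1 / 2) < 0 :> R by lra.
have pb := primitive_kernel_bound h0.
apply: (primitive_inj h0) => //.
apply: (IH (H - 1)).
- by move: nH; rewrite -[n.+2%:R]natr1; lra.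
- exact: (volterra_L2 T0 pb lf).
- by apply: ae_imp f0 => u /(_ I) <- _; rewrite [RHS]volterra_recurrence.
Qed.

End Injectivity.

(** * The inclusion of L2 *)

Section Inclusion.
Context {R : realType} (T : R) (n : nat) (H : R).
Local Notation mu := (lebT T).
Local Notation k := (fbm_kernel n.+1 H).
Local Notation k' := (fbm_kernel n (H - 1)).
Hypothesis T0 : 0 < T.
Hypothesis n1 : (1 <= n)%N.
Hypothesis nH : n.+1%:R - 1 < H < n.+1%:R.

Let nH' : n%:R - 1 < H - 1 < n%:R. Proof. by move: nH; rewrite -natr1; lra. Qed.
Let h0 : - (1 / 2) < 0 :> R. Proof. lra. Qed.

(** Holds for every u: the operator sees its argument only up to null sets, so [ind t] may be
    replaced by [primitive_kernel 0 t]. *)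
Lemma volterra_ind t : 0 <= t <= T -> volterra T k' (ind t) = k t.
Proof.
move=> /andP[_ tT]; apply/funext => u; have [p [D kb]] := fbm_sqr_kernel_bound n1 nH' T0.
have pb := primitive_kernel_bound T h0.
rewrite (volterra_ae T0 u kb (ind_L2 T0 t) (kernel_L2_r pb tT) (ind_primitive T t)).
exact: primitive_recurrence.
Qed.

Lemma volterra_lin_comb c : times_in T c ->
  volterra T k' (lin_comb ind c) = lin_comb k c.
Proof.
have [p [D kb]] := fbm_sqr_kernel_bound n1 nH' T0.
elim: c => [_|q c IH /times_in_cons[qT cT]]; apply/funext => u.
  by rewrite !lin_comb_nil; exact: ip0l.
have li t : 0 <= t <= T -> L2 T (ind t) by move=> _; exact: ind_L2.
rewrite !lin_comb_cons (volterraD T0 kb _ _ (ind_L2 T0 _) (lin_comb_L2 li cT)).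
by rewrite volterra_ind// IH.
Qed.

(** Let phi t = <g, k' t>. The adjoint gives <[ind t], phi> = <g, k t> = 0 for all t, so phi is 0
    almost everywhere, and <g, A f> = <f, phi> = 0. *)
Lemma volterra_range f g : L2 T f -> L2 T g ->
  (forall t, 0 <= t <= T -> ip mu g (k t) = 0) -> ip mu g (volterra T k' f) = 0.
Proof.
move=> lf lg gk; have [p [D kb]] := fbm_sqr_kernel_bound n1 nH' T0.
have lphi := kernel_ip_L2 T0 kb lg; pose phi t := ip mu g (k' t).
have ind0 t : 0 <= t <= T -> ip mu (ind t) phi = 0.
  by move=> tT; rewrite -(volterra_adjoint T0 kb (ind_L2 T0 t) lg) volterra_ind// gk.
rewrite (volterra_adjoint T0 kb lf lg) ipC (@ae_eq_ip _ _ _ mu _ 0)//; last 2 first.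
- exact: Lfun20.
- apply: L2_tail_eq0 => //; apply/ae_lebT; apply: aeW => s /andP[s0 sT] _.
  (* Off the points s and T of [0, T], [tail s] is [ind T] minus [ind s]. *)
  have -> : ip mu (tail s) phi = ip mu (- 1 *: ind s + ind T) phi.
    apply: (@ae_eq_ip _ _ _ mu) => //.
    + exact: tail_L2.
    + by apply: Lfun2D; [apply: Lfun2Z|]; exact: ind_L2.
    + apply/ae_lebT; apply: ae_imp2 ((ae_lebT T _).1 (ae_neq T s)) ((ae_lebT T _).1 (ae_neq T T)).
      move=> x xs xT x0T _; have ns := xs x0T; have nT := xT x0T; case/andP: x0T => x0 xT'.
      rewrite -[RHS]/(-1 * ind s x + ind T x) /ind !indicE !mem_setE !in_itv/= x0 /tail.
      have -> : x < T by rewrite lt_neqAle nT.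
      by case: (ltgtP s x) ns => //= _ _; ring.
  rewrite (ipDl (Lfun2Z _ (ind_L2 T0 s)) (ind_L2 T0 T) lphi) (ipZl _ (ind_L2 T0 s) lphi).
  by rewrite !ind0 ?mulr0 ?addr0 ?s0// lexx andbT ltW.
exact: ip0l.
Qed.

Context (V : completeNormedModType R) (dot : {dot V for idfun})
  (iota : (R -> R) -> V) (r : R -> R -> \bar R).
Hypothesis comp : step_completion T r dot iota.
Hypothesis kL2 : forall t, 0 <= t <= T -> L2 T (k t).
Hypothesis rk : forall t s, 0 <= t <= T -> 0 <= s <= T ->
  r t s = (ip mu (k t) (k s))%:E.
Local Notation K := (closed_op comp kL2 rk).

Lemma closed_op_dist x y f g : L2 T f -> L2 T g -> K x = f %[ae mu] -> K y = g %[ae mu] ->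
  `|x - y| = nrm mu (f - g).
Proof.
move=> lf lg xf yg; rewrite -(closed_op_norm comp kL2 rk); apply: nrm_ae.
- exact: closed_op_L2.
- exact: Lfun2B.
- have := closed_op_axpy comp kL2 rk (- 1) y x; rewrite scaleN1r addrC.
  move=> h; apply: ae_imp2 (ae_and xf yg) h => u [+ +] + _.
  move=> /(_ I) e1 /(_ I) e2 /(_ I) ->.
  rewrite -[LHS]/(-1 * K y u + K x u) e1 e2 -[RHS]/(f u - g u); ring.
Qed.

(** Since K preserves norms, distances between values of J are L^2 distances between values of A.
    Linearity, injectivity and continuity of J are thereby those of A, and J extends the identity
    because A and K both send step functions to combinations of [k]. *)
Lemma L2_inclusion_volterra : exists2 J : (R -> R) -> V, L2_inclusion T iota J &
  forall f, L2 T f -> K (J f) = volterra T k' f %[ae mu].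
Proof.
have [p [D kb]] := fbm_sqr_kernel_bound n1 nH' T0.
pose A := volterra T k'.
have /choice[J JE] f : exists x, L2 T f -> K x = A f %[ae mu].
  (* The value of J outside L^2 is an arbitrary 0. *)
  have [lf|nf] := pselect (L2 T f); last by exists 0.
  have [x xE] := closed_op_range comp kL2 rk (volterra_L2 T0 kb lf) (fun g lg => @volterra_range f g lf lg).
  by exists x.
have lA f (lf : L2 T f) : L2 T (A f) := volterra_L2 T0 kb lf.
have AD a f g u : L2 T f -> L2 T g -> A (a *: f + g) u = a * A f u + A g u by exact: (volterraD T0 kb).
have JB f g (lf : L2 T f) (lg : L2 T g) : `|J f - J g| = nrm mu (A f - A g).
  by apply: closed_op_dist; [exact: lA..|exact: JE|exact: JE].
have Kinj x y f : L2 T f -> K x = f %[ae mu] -> K y = f %[ae mu] -> x = y.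
  move=> lf xf yf; apply/eqP; rewrite -subr_eq0 -normr_eq0 (closed_op_dist lf lf xf yf).
  by rewrite subrr nrm0.
have AB f g : L2 T f -> L2 T g -> A (f - g) = A f - A g.
  move=> lf lg; apply/funext => u; rewrite addrC -scaleN1r AD//.
  by rewrite -[RHS]/(A f u - A g u); ring.
exists J => //; split.
- move=> a f g lf lg; have lfg : L2 T (a *: f + g) by apply: Lfun2D => //; exact: Lfun2Z.
  apply: (Kinj _ _ (A (a *: f + g))); [exact: lA|exact: JE|].
  apply: ae_imp2 (closed_op_axpy comp kL2 rk a (J f) (J g)) (ae_and (JE f lf) (JE g lg)).
  move=> u /(_ I) -> [/(_ I) e1 /(_ I) e2] _.
  by rewrite AD// -e1 -e2.
- move=> f g lf lg; split => [fg|fg]; last first.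
    apply: (Kinj _ _ (A f)); [exact: lA|exact: JE|].
    apply: ae_imp (JE g lg) => u /(_ I) -> _.
    by rewrite /A (volterra_ae T0 u kb lf lg fg).
  apply: nrm_eq => //; rewrite (nrm_ae (Lfun2B lf lg) (@Lfun20 _ _ _ mu)) ?nrm0//.
  apply: (volterra_fbm_inj T0 n1 nH'); first exact: Lfun2B.
  rewrite -/A AB//; apply: nrm_eq0; first exact: Lfun2B (lA _ lf) (lA _ lg).
  by rewrite -JB// fg subrr normr0.
- move=> f lf e e0; pose C := volterra_norm T p D.
  have C0 : 0 <= C by exact: sqrtr_ge0.
  have C1 : 0 < C + 1 by rewrite ltr_wpDl.
  (* Adding 1 keeps the quotient meaningful when the operator bound C is 0. *)
  exists (e / (C + 1)); first by rewrite divr_gt0.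
  move=> g lg; rewrite L2_distE// lte_fin => gf.
  rewrite JB// -AB//; apply: le_lt_trans (volterra_nrm_le T0 kb (Lfun2B lg lf)) _.
  rewrite -/C; move: gf; rewrite ltr_pdivlMr//; have := nrm_ge0 mu (g - f); nra.
- move=> _ [c tc ->]; apply: (Kinj _ _ (lin_comb k c)).
  + exact: lin_comb_L2.
  + have li t : 0 <= t <= T -> L2 T (ind t) by move=> _; exact: ind_L2.
    by rewrite -volterra_lin_comb//; apply: JE; exact: lin_comb_L2.
  + exact: closed_op_lin_comb.
Qed.

End Inclusion.

Theorem theorem3p2 (R : realType) (n : nat) (H T : R)
    (d : measure_display) (Omega : measurableType d) (P : probability Omega R)
    (W B : R -> {RV P >-> R}) (intW : (R -> R) -> Omega -> R)
    (V : completeNormedModType R) (dot : {dot V for idfun})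
    (iota : (R -> R) -> V) (intB : V -> Omega -> R) :
  (1 <= n)%N -> n%:R - 1 < H < n%:R -> 0 < T ->
  brownian T W ->
  wiener_integral T (L2 T) (L2_dot T) ind W intW ->
  (forall t : R, 0 <= t <= T -> (B t : Omega -> R) = intW (fbm_kernel n H t) %[ae P]) ->
  step_completion T (covar_fun B) dot iota ->
  wiener_integral T setT (fun f g => (dot f g)%:E) (fun t => iota (ind t)) B intB ->
  exists K : V -> R -> R,
    [/\ closed_operator T iota (fbm_kernel n H) K,
        forall f g, L2_dot T (K f) (K g) = (dot f g)%:E,
        forall f, intB f = intW (K f) %[ae P]
      & (2 <= n)%N ->
        exists2 J : (R -> R) -> V, L2_inclusion T iota J &
          forall f, L2 T f ->
            {ae lebT T, forall u, (K (J f) u)%:E =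
              (\int[lebT T]_t (f t * fbm_kernel n.-1 (H - 1) t u)%:E)%E}].
Proof.
move=> n1 nH T0 _ wW Bk comp wB.
have [p [D kb]] := fbm_sqr_kernel_bound n1 nH T0.
have kL2 t : 0 <= t <= T -> L2 T (fbm_kernel n H t).
  by move=> /andP[_ tT]; exact: (kernel_L2_r kb tT).
pose rk := covar_kernel kL2 wW Bk.
exists (closed_op comp kL2 rk); split.
- exact: closed_op_closed.
- move=> f g; rewrite /L2_dot -ipE; [|exact: closed_op_L2..].
  by rewrite closed_op_isometry.
- exact: (wiener_closed_op kL2 wW Bk comp wB).
- clearbody rk; case: n n1 nH Bk p D kb kL2 rk => // n _ nH Bk p D _ kL2 rk n1.
  have [J Jinc JE] := L2_inclusion_volterra T0 n1 nH comp kL2 rk.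
  exists J => // f lf; apply: ae_imp (JE f lf) => u /(_ I) ->.
  have nH' : n%:R - 1 < H - 1 < n%:R by move: nH; rewrite -natr1; lra.
  have [q [C kb']] := fbm_sqr_kernel_bound n1 nH' T0.
  (* Every column is in L^2, so the extended integral is finite for each u and equals its real
     counterpart [volterra]. *)
  exact: ipE lf (kernel_L2_l T0 kb' u).
Qed.
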